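(* Let $d\ge1$ and suppose that $g\in R_d=\mathbb{Z}[z_1^{\pm1},\dots,z_d^{\pm1}]$ is primitive, irreducible and atoral. For every integer $H\ge1$ there exists an integer $m\ge1$ with the following property: for every pair of nonempty sets $\mathcal{S},\mathcal{S}'\subset\mathbb{Z}^d$ with distance $$d(\mathcal{S},\mathcal{S}'):=\min_{\boldsymbol n\in\mathcal{S},\,\boldsymbol n'\in\mathcal{S}'}\|\boldsymbol n-\boldsymbol n'\|\ge m,$$ and for every $v=\sum_{\boldsymbol n\in\mathcal{S}\cup\mathcal{S}'}v_{\boldsymbol n}\boldsymbol z^{\boldsymbol n}\in\mathcal{P}(\mathcal{S}\cup\mathcal{S}',H)$ which is divisible by $g$ in $R_d$, the restriction $v_{\mathcal{S}}=\sum_{\boldsymbol n\in\mathcal{S}}v_{\boldsymbol n}\boldsymbol z^{\boldsymbol n}$ of $v$ to $\mathcal{S}$ is also divisible by $g$ in $R_d$.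
   Context: For $\boldsymbol n=(n_1,\dots,n_d)\in\mathbb{Z}^d$: $\boldsymbol z^{\boldsymbol n}=z_1^{n_1}\cdots z_d^{n_d}$ and $\|\boldsymbol n\|=\max_i|n_i|$. For nonempty $\mathcal{S}\subset\mathbb{Z}^d$ and an integer $H\ge1$, $\mathcal{P}(\mathcal{S},H)$ is the set of Laurent polynomials $v\in R_d$ whose support $\{\boldsymbol n:v_{\boldsymbol n}\ne0\}$ is contained in $\mathcal{S}$ and whose coefficients satisfy $|v_{\boldsymbol n}|\le H$ for all $\boldsymbol n$. A nonzero $g\in R_d$ is primitive if the gcd of its coefficients is $1$, and irreducible if it is not a product of two non-units of $R_d$. A nonzero $g\in R_d$ is atoral if it is not a unit in $R_d$ and its unitary variety $\mathsf{U}(g)=\{(t_1,\dots,t_d)\in\mathbb{T}^d : g(e^{2\pi it_1},\dots,e^{2\pi it_d})=0\}$ ($\mathbb{T}=\mathbb{R}/\mathbb{Z}$) has (real) dimension $\le d-2$; the case $\mathsf{U}(g)=\varnothing$ is included. *)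

(* Defs.v *)
From HB Require Import structures.
From mathcomp Require Import all_boot all_order all_algebra.
From mathcomp Require Import finmap complex.
From mathcomp Require Import all_classical all_reals all_analysis.
Import numFieldNormedType.Exports.

Set Implicit Arguments.
Unset Strict Implicit.
Unset Printing Implicit Defensive.

Import Order.TTheory GRing.Theory Num.Theory.

Local Open Scope classical_set_scope.
Local Open Scope fset_scope.
Local Open Scope quotient_scope.
Local Open Scope ring_scope.

(** A Laurent polynomial in Z[z_1^{+-1}, ..., z_d^{+-1}] is the finitely
    supported family of its coefficients, indexed by the exponents in Z^d.
    The monoid algebras of the multinomials library do not apply, because
    their monomials are not allowed to be invertible. *)

Record laurent (d : nat) : predArgType :=
  Laurent { lcoef : {fsfun 'rV[int]_d -> int with 0} }.

Section LaurentRing.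
Variable d : nat.
Local Notation Zd := 'rV[int]_d.
Local Notation L := (laurent d).
Implicit Types (f g h : L) (n k l : Zd).

HB.instance Definition _ := [isNew for @lcoef d].
HB.instance Definition _ := [Choice of laurent d by <:].

Definition lsupp f : {fset Zd} := finsupp (lcoef f).

Lemma laurentP f g : (forall n, lcoef f n = lcoef g n) -> f = g.
Proof. by case: f g => f [] g /= fg; congr Laurent; apply/fsfunP. Qed.

Lemma lcoef_notin f n : n \notin lsupp f -> lcoef f n = 0.
Proof. exact: fsfun_dflt. Qed.

Definition lzero : L := Laurent [fsfun].
Definition lopp f : L := Laurent [fsfun n in lsupp f => - lcoef f n].
Definition ladd f g : L :=
  Laurent [fsfun n in lsupp f `|` lsupp g => lcoef f n + lcoef g n].

Definition lmono (c : int) k : L := Laurent [fsfun n in [fset k] => c].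

Definition lmul f g : L :=
  Laurent [fsfun n in [fset k + l | k in lsupp f, l in lsupp g] =>
    \sum_(k <- lsupp f) \sum_(l <- lsupp g | k + l == n)
      lcoef f k * lcoef g l].

Lemma lzeroE n : lcoef lzero n = 0.
Proof. by rewrite /= fsfunE. Qed.

Lemma loppE f n : lcoef (lopp f) n = - lcoef f n.
Proof. by rewrite /= fsfunE; case: ifPn => // /lcoef_notin ->; rewrite oppr0. Qed.

Lemma laddE f g n : lcoef (ladd f g) n = lcoef f n + lcoef g n.
Proof.
rewrite /= fsfunE in_fsetU; case: ifPn => //; rewrite negb_or => /andP[nf ng].
by rewrite !lcoef_notin // addr0.
Qed.

Lemma lmonoE c k n : lcoef (lmono c k) n = if n == k then c else 0.
Proof. by rewrite /= fsfunE in_fset1. Qed.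

Lemma lmulE f g n : lcoef (lmul f g) n =
  \sum_(k <- lsupp f) \sum_(l <- lsupp g | k + l == n) lcoef f k * lcoef g l.
Proof.
rewrite /= fsfunE; case: ifPn => // nfg; rewrite big_seq big1 // => k kf.
rewrite big_seq_cond big1 // => l /andP[lg /eqP kl]; case/negP: nfg.
by rewrite -kl; apply/imfset2P; exists k => //; exists l.
Qed.

Fact laddA : associative ladd.
Proof. by move=> f g h; apply: laurentP => n; rewrite !laddE addrA. Qed.
Fact laddC : commutative ladd.
Proof. by move=> f g; apply: laurentP => n; rewrite !laddE addrC. Qed.
Fact ladd0 : left_id lzero ladd.
Proof. by move=> f; apply: laurentP => n; rewrite laddE lzeroE add0r. Qed.
Fact laddN : left_inverse lzero lopp ladd.
Proof. by move=> f; apply: laurentP => n; rewrite laddE loppE lzeroE addNr. Qed.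

HB.instance Definition _ := GRing.isZmodule.Build L laddA laddC ladd0 laddN.

Definition lpair f (phi : Zd -> int) : int :=
  \sum_(k <- lsupp f) lcoef f k * phi k.

Lemma lpairW (D : {fset Zd}) f phi : lsupp f `<=` D ->
  lpair f phi = \sum_(k <- D) lcoef f k * phi k.
Proof.
move=> fD; rewrite /lpair (big_fset_incl _ fD) // => k _ /lcoef_notin ->.
by rewrite mul0r.
Qed.

Lemma eq_lpair f phi psi : phi =1 psi -> lpair f phi = lpair f psi.
Proof. by move=> e; apply: eq_bigr => k _; rewrite e. Qed.

Lemma lpairD f g phi : lpair (f + g) phi = lpair f phi + lpair g phi.
Proof.
have fgs : lsupp (f + g) `<=` lsupp f `|` lsupp g.
  apply/fsubsetP => n; rewrite mem_finsupp laddE => /eqP nfg.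
  rewrite in_fsetU; apply: contra_notT nfg; rewrite negb_or => /andP[? ?].
  by rewrite !lcoef_notin.
rewrite (lpairW _ fgs) (lpairW _ (fsubsetUl _ (lsupp g))).
rewrite (lpairW _ (fsubsetUr (lsupp f) _)) -big_split; apply: eq_bigr => n _ /=.
by rewrite -mulrDl -laddE.
Qed.

Lemma lpair_mono c k phi : lpair (lmono c k) phi = c * phi k.
Proof.
rewrite (lpairW (D := [fset k])); first by rewrite big_seq_fset1 lmonoE eqxx.
apply/fsubsetP => n; rewrite mem_finsupp lmonoE in_fset1.
by case: (n == k) => //; rewrite eqxx.
Qed.

Lemma lpair_delta f n : lpair f (fun k => (k == n)%:R) = lcoef f n.
Proof.
rewrite (lpairW (D := n |` lsupp f)) ?fsubsetUr // (big_fsetD1 n) ?fset1U1 //=.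
rewrite eqxx mulr1 big1_fset ?addr0 // => k; rewrite in_fsetD1 => /andP[kn _] _.
by rewrite (negbTE kn) mulr0.
Qed.

Lemma lpairC f g (phi : Zd -> Zd -> int) :
  lpair f (fun k => lpair g (phi k)) =
  lpair g (fun l => lpair f (fun k => phi k l)).
Proof.
rewrite /lpair; under eq_bigr do rewrite mulr_sumr.
rewrite exchange_big; apply: eq_bigr => l _; rewrite mulr_sumr.
by apply: eq_bigr => k _; rewrite mulrCA.
Qed.

Lemma lmul_pairE f g n :
  lcoef (lmul f g) n = lpair f (fun k => lpair g (fun l => (k + l == n)%:R)).
Proof.
rewrite lmulE; apply: eq_bigr => k _; rewrite /lpair mulr_sumr big_mkcond.
by apply: eq_bigr => l _; case: (_ == _); rewrite ?mulr1 ?mulr0.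
Qed.

Lemma lpairM f g phi :
  lpair (lmul f g) phi = lpair f (fun k => lpair g (fun l => phi (k + l))).
Proof.
pose D := [fset k + l | k in lsupp f, l in lsupp g].
have sD : lsupp (lmul f g) `<=` D.
  by apply/fsubsetP => n; rewrite mem_finsupp fsfunE; case: ifP; rewrite ?eqxx.
rewrite (lpairW _ sD).
under eq_bigr do rewrite lmul_pairE mulr_suml.
rewrite exchange_big; apply: eq_big_seq => k kf /=.
under eq_bigr do rewrite -mulrA mulr_suml mulr_sumr.
rewrite exchange_big [in RHS]/lpair mulr_sumr; apply: eq_big_seq => l lg /=.
rewrite (big_fsetD1 (k + l)) /=; last by apply/imfset2P; exists k => //; exists l.
rewrite eqxx mulr1 big1_fset ?addr0 // => n.
by rewrite in_fsetD1 eq_sym => /andP[/negbTE -> _] _; rewrite mulr0 mul0r mulr0.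
Qed.

Fact lmulC : commutative lmul.
Proof.
move=> f g; apply: laurentP => n; rewrite !lmul_pairE lpairC.
by apply: eq_lpair => k; apply: eq_lpair => l; rewrite addrC.
Qed.

Fact lmulA : associative lmul.
Proof.
move=> f g h; apply: laurentP => n; rewrite !lmul_pairE lpairM.
apply: eq_lpair => k; rewrite lpairM; apply: eq_lpair => l.
by apply: eq_lpair => m; rewrite addrA.
Qed.

Fact lmul1 : left_id (lmono 1 0) lmul.
Proof.
move=> f; apply: laurentP => n; rewrite lmul_pairE lpair_mono mul1r.
by under eq_lpair do rewrite add0r; rewrite lpair_delta.
Qed.

Fact lmulDl : left_distributive lmul +%R.
Proof.
by move=> f g h; apply: laurentP => n; rewrite lmul_pairE lpairD laddE !lmul_pairE.
Qed.

Fact lone_neq0 : lmono 1 0 != 0 :> L.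
Proof.
apply/eqP => e; have := lzeroE 0.
by rewrite -[lzero]/(0 : L) -e lmonoE eqxx.
Qed.

HB.instance Definition _ :=
  GRing.Zmodule_isComNzRing.Build L lmulA lmulC lmul1 lmulDl lone_neq0.

End LaurentRing.

Definition ldivides d (g v : laurent d) : Prop := exists q : laurent d, v = g * q.

Definition lunit d (g : laurent d) : Prop := exists h : laurent d, g * h = 1.

Definition primitive d (g : laurent d) : Prop :=
  g != 0 /\ (\big[gcdn/0]_(n <- lsupp g) `|lcoef g n|)%N = 1%N.

Definition irreducible d (g : laurent d) : Prop :=
  g != 0 /\
  ~ exists a b : laurent d, [/\ ~ lunit a, ~ lunit b & g = a * b].

(** T^d as the topological quotient of R^d by Z^d. *)

Section Torus.
Variables (R : realType) (d : nat).

Definition eq_mod_Zd (s t : 'rV[R]_d) : bool :=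
  [forall i, (s 0 i - t 0 i) \is a Num.int].

Fact eq_mod_Zd_equiv : equiv_class_of eq_mod_Zd.
Proof.
split=> [t|s t|t s u].
- by apply/forallP => i; rewrite subrr rpred0.
- by apply/forallP/forallP => st i; rewrite -rpredN opprB.
- move=> /forallP st /forallP tu; apply/forallP => i.
  by rewrite -(subrKA (t 0 i)) rpredD.
Qed.

Canonical eq_mod_Zd_equiv_rel := EquivRelPack eq_mod_Zd_equiv.

Definition torus := quotient_topology {eq_quot eq_mod_Zd}.

HB.instance Definition _ := Topological.on torus.
HB.instance Definition _ := Quotient.on torus.

End Torus.

Definition leval (R : realType) d (g : laurent d) (z : 'I_d -> R[i]) : R[i] :=
  \sum_(n <- lsupp g) (lcoef g n)%:~R * \prod_(i < d) z i ^ n 0 i.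

Definition expi2pi (R : realType) (t : R) : R[i] :=
  (cos (2 * pi * t) +i* sin (2 * pi * t))%C.

Definition unitary_variety (R : realType) d (g : laurent d) : set (torus R d) :=
  [set \pi_(torus R d) t | t in
    [set t : 'rV[R]_d | leval g (fun i => expi2pi (t 0 i)) = 0]].

Arguments unitary_variety R {d} g.

Definition open_cube (R : realType) (k : nat) : set 'rV[R]_k :=
  [set x | forall i, 0 < x 0 i < 1].

Arguments open_cube : clear implicits.

Definition contains_cell (R : realType) (T : topologicalType) (A : set T)
    (k : nat) : Prop :=
  exists (f : 'rV[R]_k -> T) (f' : T -> 'rV[R]_k),
    [/\ f @` open_cube R k `<=` A,
        {within open_cube R k, continuous f},
        {within f @` open_cube R k, continuous f'}
      & {in open_cube R k, cancel f f'}]%classic.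

(** The dimension of a semialgebraic set, such as a unitary variety, is the
    largest dimension of a cell (homeomorphic image of an open cube) that it
    contains.  A point is a cell of dimension 0, and set0 has dimension -oo, so
    for d = 1 the bound d - 2 in [atoral] says that U(g) is empty. *)
Definition real_dim (R : realType) (T : topologicalType) (A : set T) : \bar R :=
  ereal_sup [set k%:R%:E | k in contains_cell R A].

Definition atoral (R : realType) d (g : laurent d) : Prop :=
  [/\ g != 0, ~ lunit g
    & (real_dim R (unitary_variety R g) <= (d%:R - 2)%:E)%E].

Definition Znorm d (n : 'rV[int]_d) : nat := \max_(i < d) `|n 0%R i|%N.

Definition bounded_on d (S : set 'rV[int]_d) (H : nat) : set (laurent d) :=
  [set v | (forall n, lcoef v n != 0 -> S n) /\
           (forall n, `|lcoef v n| <= H%:Z)].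

Definition lrestrict d (S : set 'rV[int]_d) (v : laurent d) : laurent d :=
  Laurent [fsfun n in lsupp v => if `[< S n >] then lcoef v n else 0].

(* Main.v *)
(** Irreducible elements of the factorial ring R_d are prime.  The central
    point is that there is a u, not divisible by g, with |u| <= C |g| on the
    torus.  If g does not divide its conjugate g*, take u = g*.  Otherwise g*
    is g times a monomial up to sign, so that |g| is the absolute value of a
    real function G.  If G changed sign along some coordinate line, then g would
    have a zero at which a partial derivative does not vanish, hence a cell of
    zeros of dimension d - 1, and g would not be atoral.  So G has constant sign
    on every line, and G'^2 <= C |G| by Glaeser's inequality; G' is again the
    absolute value of a Laurent polynomial, whose square is u.

    Put h = u^(r+1) with r large.  The r-th differences of h/g on the grid of
    N-th roots of unity are O(N^-r), hence the inverse discrete Fourier transform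
    Phi of h/g decays like |n|^-r uniformly in N, and g Phi is close to h.  If S
    and S' are far apart and v = g q, then v_S Phi is uniformly close to the
    integral q h near S and to 0 elsewhere.  This makes g divide h v_S, as an
    integer of absolute value less than 1 vanishes, and g is prime. *)

From HB Require Import structures.
Require Import Defs.
From mathcomp Require Import all_boot all_order all_fingroup all_algebra.
From mathcomp Require Import finmap complex ring lra zify.
From mathcomp Require Import all_classical all_reals all_analysis.
Import numFieldNormedType.Exports.
Set Implicit Arguments.
Unset Strict Implicit.
Unset Printing Implicit Defensive.
Import Order.TTheory GRing.Theory Num.Theory ComplexField.Normc.
Local Open Scope classical_set_scope.
Local Open Scope quotient_scope.
Local Open Scope ring_scope.

(** * Unique factorization of polynomials *)

(** The order of the quantifiers shapes the proof. The gap may depend on [H] and [g] but not on [v],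
    and the quotient q of [v] by [g] can have arbitrarily large coefficients. Hence the decay
    constant of Phi must not depend on the grid, while the error between g Phi and h, the only one
    that gets multiplied by the size of q, is made small after [v] is known, by refining the grid.
    Domination alone makes u/g merely bounded. Elsewhere g is nearly constant over r steps and a
    discrete quotient rule applies. The exponent r is 2d+1: the part 2d gives summability over Z^d
    by comparison with a product of inverse squares, and the remaining factor makes the tail beyond
    m of order 1/m. *)

Definition rdvd (A : comNzRingType) (a b : A) : Prop := exists c, b = a * c.
Definition runit (A : comNzRingType) (a : A) : Prop := exists c, a * c = 1.
Definition rirred (A : comNzRingType) (a : A) : Prop :=
  ~ runit a /\ forall b c, a = b * c -> runit b \/ runit c.
Definition rprime (A : comNzRingType) (a : A) : Prop :=
  ~ runit a /\ forall b c, rdvd a (b * c) -> rdvd a b \/ rdvd a c.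

(* The function [mu] makes factorization into irreducibles terminate. *)
Definition factorial_domain (A : idomainType) : Prop :=
  (exists mu : A -> nat,
     (forall a b, a * b != 0 -> (mu b <= mu (a * b)%R)%N) /\
     (forall a b, a * b != 0 -> ~ runit a -> (mu b < mu (a * b)%R)%N)) /\
  (forall a : A, a != 0 -> rirred a -> rprime a).

Lemma runitP (A : idomainType) (a : A) : reflect (runit a) (a \is a GRing.unit).
Proof. exact: unitrPr. Qed.

Lemma rprime_neq0_irred (A : idomainType) (p : A) :
  p != 0 -> rprime p -> rirred p.
Proof.
move=> p0 [pu pp]; split=> // b c pbc.
have [|[e be]|[e ce]] := pp b c.
- by exists 1; rewrite mulr1 -pbc.
- right; exists e; apply: (mulfI p0).
  by rewrite mulr1 [RHS]pbc be; ring.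
- left; exists e; apply: (mulfI p0).
  by rewrite mulr1 [RHS]pbc ce; ring.
Qed.

Lemma factorial_prime_factor (A : idomainType) (a : A) :
  factorial_domain A -> a != 0 -> ~ runit a -> exists2 p : A, p != 0 /\ rprime p & rdvd p a.
Proof.
move=> [[mu [mule mult]] irrp].
have [n] := ubnP (mu a); elim: n a => // n IH a an a0 au.
have [[b [c [abc bu cu]]]|nf] :=
  boolp.EM (exists b c, [/\ a = b * c, ~ runit b & ~ runit c]).
- have c0 : c != 0 by apply: contraNneq a0 => c0; rewrite abc c0 mulr0.
  have [|p pp [e ce]] := IH c _ c0 cu.
    by apply: (@leq_trans (mu a)); [rewrite abc mult // -abc | rewrite -ltnS].
  by exists p => //; exists (e * b); rewrite abc ce mulrC mulrA.
- exists a; last by exists 1; rewrite mulr1.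
  split=> //; apply: irrp => //; split=> // b c abc.
  have [|bu] := boolp.EM (runit b); first by left.
  have [|cu] := boolp.EM (runit c); first by right.
  by case: nf; exists b, c.
Qed.

Lemma rdvd_polyC (A : comNzRingType) (p : A) (f : {poly A}) :
  rdvd p%:P f <-> forall i, rdvd p f`_i.
Proof.
split=> [[h ->] i|pf]; first by exists h`_i; rewrite coefCM.
elim/poly_ind: f pf => [|f c IH] pf; first by exists 0; rewrite mulr0.
have [|h fh] := IH.
  by move=> i; have := pf i.+1; rewrite coefD coefMX coefC /= addr0.
have [e ce] := pf 0; rewrite coefD coefMX coefC /= add0r in ce.
by exists (h * 'X + e%:P); rewrite mulrDr fh ce polyCM mulrA.
Qed.

(** Gauss's lemma. [p] divides the product of the two constant coefficients, hence one of them; that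
    factor can drop its constant coefficient and be divided by 'X, which shortens it. Hence the
    double induction. *)
Lemma rprime_polyC (A : idomainType) (p : A) : rprime p -> rprime p%:P.
Proof.
move=> [pu pp]; split.
  move=> [h /(congr1 (fun q : {poly A} => q`_0))].
  by rewrite coefCM coef1 /= => ph; apply: pu; exists h`_0.
have pc (f : {poly A}) (c : A) : rdvd p c -> rdvd p%:P f -> rdvd p%:P (f * 'X + c%:P).
  move=> [e ->] [h ->]; exists (h * 'X + e%:P).
  by rewrite mulrDr polyCM mulrA.
elim/poly_ind=> [|f c IHf] g; first by left; exists 0; rewrite mulr0.
elim/poly_ind: g => [|g e IHg]; first by right; exists 0; rewrite mulr0.
move=> pfg.
have [[c' pc']|[e' pe']] : rdvd p c \/ rdvd p e.
- apply: pp; have /rdvd_polyC /(_ 0) := pfg.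
  by rewrite coef0M !coefD !coefMX !coefC /= !add0r.
- have : rdvd p%:P (f * (g * 'X + e%:P)).
    apply/rdvd_polyC => i; have [h ph] := pfg.
    have : rdvd p%:P (f * (g * 'X + e%:P) * 'X).
      exists (h - c'%:P * (g * 'X + e%:P)); rewrite mulrBr -ph pc' polyCM; ring.
    by move/rdvd_polyC => /(_ i.+1); rewrite coefMX.
  case/IHf => [pf|]; last by right.
  by left; apply: pc => //; exists c'.
- have : rdvd p%:P ((f * 'X + c%:P) * g).
    apply/rdvd_polyC => i; have [h ph] := pfg.
    have : rdvd p%:P ((f * 'X + c%:P) * g * 'X).
      exists (h - e'%:P * (f * 'X + c%:P)); rewrite mulrBr -ph pe' polyCM; ring.
    by move/rdvd_polyC => /(_ i.+1); rewrite coefMX.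
  case/IHg => [|pg]; first by left.
  by right; apply: pc => //; exists e'.
Qed.

Lemma factorial_ind (A : idomainType) (P : A -> Prop) : factorial_domain A ->
  (forall c, runit c -> P c) ->
  (forall p c, p != 0 -> rprime p -> c != 0 -> P c -> P (p * c)) ->
  forall c, c != 0 -> P c.
Proof.
move=> facA Pu Pp; have [[mu [mule mult]] _] := facA.
move=> c; have [n] := ubnP (mu c); elim: n c => // n IH c cn c0.
have [/Pu//|cu] := boolp.EM (runit c).
have [p [p0 pp] [e ce]] := factorial_prime_factor facA c0 cu.
have e0 : e != 0 by apply: contraNneq c0 => e0; rewrite ce e0 mulr0.
rewrite ce; apply: Pp => //; apply: IH => //.
apply: (@leq_trans (mu c)); last by rewrite -ltnS.
by rewrite ce mult -?ce //; case: pp.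
Qed.

(** Goes from divisibility over the fraction field back to [A] when no prime constant divides [f]: a
    prime factor of [c] divides [f * q], hence [q] by Gauss's lemma, and is cancelled. *)
Lemma rdvd_cancel_content (A : idomainType) (f : {poly A}) : factorial_domain A ->
  (forall p, p != 0 -> rprime p -> ~ rdvd p%:P f) ->
  forall c, c != 0 -> forall a, rdvd f (c%:P * a) -> rdvd f a.
Proof.
move=> facA prf; apply: factorial_ind => //.
  move=> c [c' cc'] a [q cq]; exists (c'%:P * q).
  by rewrite mulrCA -cq mulrA -polyCM mulrC [c' * c]mulrC cc' mulr1.
move=> p c p0 pp c0 IH a [q pq]; apply: IH.
have [||[q' qq']] := (rprime_polyC pp).2 f q.
- by rewrite -pq polyCM -mulrA; exists (c%:P * a).
- by move/prf; case.
exists q'; apply: (mulfI (_ : p%:P != 0)); first by rewrite polyC_eq0.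
by rewrite mulrA -polyCM pq qq' mulrCA.
Qed.

(** A factorization of [f] over the fraction field, with denominators cleared by [c], descends to
    [A] in the same degrees: by Gauss's lemma every prime factor of [c] can be cancelled from [a] or
    from [b]. *)
Lemma split_content (A : idomainType) : factorial_domain A ->
  forall c, c != 0 -> forall f a b : {poly A}, c%:P * f = a * b ->
  exists a' b', [/\ f = a' * b', size a' = size a & size b' = size b].
Proof.
move=> facA; apply: factorial_ind => //.
  move=> c [c' cc'] f a b cab; exists (c'%:P * a), b; split=> //.
    by rewrite -mulrA -cab mulrA -polyCM [c' * c]mulrC cc' mul1r.
  rewrite size_Cmul //; apply: contraTneq (oner_neq0 A) => c0.
  by rewrite negbK -cc' c0 mulr0.
move=> p c p0 pp c0 IH f a b pab.
have P0 : p%:P != 0 :> {poly A} by rewrite polyC_eq0.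
have [|[e ae]|[e be]] := (rprime_polyC pp).2 a b.
- by rewrite -pab polyCM -mulrA; exists (c%:P * f).
- have [|a' [b' [-> sa sb]]] := IH f e b.
    by apply: (mulfI P0); rewrite mulrA -polyCM pab ae mulrA.
  by exists a', b'; split=> //; rewrite sa ae size_Cmul.
- have [|a' [b' [-> sa sb]]] := IH f a e.
    by apply: (mulfI P0); rewrite mulrA -polyCM pab be mulrCA.
  by exists a', b'; split=> //; rewrite sb be size_Cmul.
Qed.

Lemma runit_polyC (A : idomainType) (f : {poly A}) :
  runit f -> exists2 c : A, runit c & f = c%:P.
Proof.
move/runitP; rewrite poly_unitE => /andP[/size_poly1P[c c0 ->]].
by rewrite coefC => /runitP cu; exists c.
Qed.

(** The gcd divides [f] only up to a constant. [split_content] turns this into a true factorization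
    of [f] with a factor of the same size as the gcd, and irreducibility leaves only the two extreme
    sizes. *)
Lemma rirred_coprime_or_dvd (A : idomainType) (f a : {poly A}) : factorial_domain A ->
  (1 < size f)%N -> rirred f -> Pdiv.Idomain.coprimep f a \/ Pdiv.Idomain.dvdp f a.
Proof.
move=> facA sf [fu firr].
have f0 : f != 0 by rewrite -size_poly_gt0 ltnW.
have /Pdiv.WeakIdomain.dvdpP [[c e'] /= c0 cfe] := Pdiv.Idomain.dvdp_gcdl f a.
move: cfe; rewrite -mul_polyC => /(split_content facA c0) [b [e [fbe sb se]]].
have [/runit_polyC[x [y xy] bx]|/runit_polyC[x [y xy] ex]] := firr _ _ fbe.
- right; rewrite -(Pdiv.Idomain.eqp_dvdl _ (_ : gcdp f a %= f)) ?Pdiv.Idomain.dvdp_gcdr //.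
  rewrite -Pdiv.Idomain.dvdp_size_eqp ?Pdiv.Idomain.dvdp_gcdl //.
  rewrite -se; have -> : size f = size e; last exact: eqxx.
  rewrite fbe bx size_Cmul //.
  by apply: contraTneq (oner_neq0 A) => x0; rewrite negbK -xy x0 mul0r.
- left; rewrite Pdiv.Idomain.coprimep_def -se ex size_polyC.
  rewrite [x != 0](_ : _ = true) //.
  by apply: contraTneq (oner_neq0 A) => x0; rewrite negbK -xy x0 mul0r.
Qed.

(** For termination, a nonunit factor either raises the degree or is a constant and raises [mu] of
    the leading coefficient. For primality, constants are handled by Gauss's lemma; an irreducible
    of positive degree has no prime constant factor, so that divisibility may be tested over the
    fraction field. *)
Lemma factorial_poly (A : idomainType) : factorial_domain A -> factorial_domain {poly A}.
Proof.
move=> facA; have [[mu [mule mult]] irrA] := facA.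
split.
  exists (fun f : {poly A} => size f + mu (lead_coef f))%N; split=> a b ab0.
    have [a0 b0] : a != 0 /\ b != 0 by apply/andP; rewrite -negb_or -mulf_eq0.
    rewrite leq_add // ?size_mul //; first by have := size_poly_gt0 a; rewrite a0; lia.
    by rewrite lead_coefM mule // -lead_coefM lead_coef_eq0.
  have [a0 b0] : a != 0 /\ b != 0 by apply/andP; rewrite -negb_or -mulf_eq0.
  move=> au; rewrite size_mul // lead_coefM.
  have l0 : lead_coef a * lead_coef b != 0 by rewrite -lead_coefM lead_coef_eq0.
  have := mule _ _ l0; have := mult _ _ l0.
  have := size_poly_gt0 a; rewrite a0.
  move: (mu (lead_coef a * lead_coef b)) (mu (lead_coef b)) => M m sa Hu Hle.
  have [s1|s1] := leqP (size a) 1; last by clear Hu; lia.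
  have : ~ runit (lead_coef a).
    move=> [y xy]; apply: au; exists y%:P.
    rewrite (size1_polyC s1) -polyCM; congr (_%:P).
    by move: xy; rewrite lead_coefE; have -> : (size a).-1 = 0 by lia.
  by move=> /Hu; clear Hu; lia.
move=> f f0 firr.
have [s1|s2] := leqP (size f) 1.
  have fE := size1_polyC s1; move: f0 firr; rewrite {}fE polyC_eq0.
  move=> c0 [cu ci]; apply/rprime_polyC/irrA => //; split.
    by move=> [y xy]; apply: cu; exists y%:P; rewrite -polyCM xy.
  move=> b c bc; have [|/runit_polyC[x xu /polyC_inj->]|/runit_polyC[x xu /polyC_inj->]] := ci b%:P c%:P.
  - by rewrite -polyCM bc.
  - by left.
  - by right.
have prf : forall p, p != 0 -> rprime p -> ~ rdvd p%:P f.
  move=> p p0 [pu _] [h fh]; case: firr => _ /(_ _ _ fh) [].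
    by case/runit_polyC=> x xu /polyC_inj px; apply: pu; rewrite px.
  by case/runit_polyC=> x xu hx; move: s2; rewrite fh hx -polyCM size_polyC; case: eqP.
split; first by case: firr.
have pdvd a : Pdiv.Idomain.dvdp f a -> rdvd f a.
  case/Pdiv.WeakIdomain.dvdpP => [[c q] /= c0 ca].
  by apply: (rdvd_cancel_content facA prf c0); exists q; rewrite mul_polyC ca mulrC.
move=> a b [q abq].
have [cop|/pdvd] := rirred_coprime_or_dvd a facA s2 firr; last by left.
right; apply: pdvd; rewrite -(Pdiv.Idomain.Gauss_dvdpr _ cop) abq.
by rewrite Pdiv.Idomain.dvdp_mulr // Pdiv.Idomain.dvdpp.
Qed.

(** * Iterated polynomial rings over the integers *)

Lemma factorial_int : factorial_domain int.
Proof.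
have unitE (a : int) : `|a|%N = 1%N -> runit a.
  move=> a1; exists a; have [->|->] : a = 1 \/ a = -1 by lia.
  - by rewrite mulr1.
  - by rewrite mulrNN mulr1.
split.
  exists (fun a => `|a|%N); split=> a b ab0; rewrite abszM.
    by rewrite leq_pmull // absz_gt0; apply: contraNneq ab0 => ->; rewrite mul0r.
  move=> au; have [a0 b0] : a != 0 /\ b != 0 by apply/andP; rewrite -negb_or -mulf_eq0.
  have : `|a|%N <> 1%N by move/unitE.
  move=> a1; rewrite ltn_Pmull ?absz_gt0 //.
  by move: a0 a1; rewrite -absz_gt0; lia.
move=> a a0 [au airr].
have pra : prime `|a|%N.
  apply/primeP; split.
    by have : `|a|%N <> 1%N by [move/unitE]; lia.
  move=> e /dvdnP[c ce].
  have [|[x cx]|[x ex]] := airr ((-1) ^+ (a < 0)%R * c%:Z) e%:Z.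
  + by rewrite -mulrA -PoszM -ce; exact: intEsign.
  + apply/orP; right; apply/eqP; rewrite ce.
    suff -> : c = 1%N by rewrite mul1n.
    by move: cx => /(congr1 absz)/eqP; rewrite !abszM abszX /= exp1n mul1n muln_eq1 => /andP[/eqP].
  + apply/orP; left; apply/eqP; move: ex => /(congr1 absz)/eqP; rewrite abszM muln_eq1 => /andP[/eqP e1 _].
    exact: e1.
split=> // b c [q bcq].
have : (`|a| %| `|b| * `|c|)%N by rewrite -abszM bcq abszM dvdn_mulr.
have dvd x : (`|a| %| `|x|)%N -> rdvd a x.
  move=> ax; have : (a %| x)%Z by rewrite dvdzE.
  by case/dvdzP=> y ->; exists y; rewrite mulrC.
by rewrite Euclid_dvdM // => /orP[] /dvd; [left|right].
Qed.

(** Variables are adjoined one at a time, so that the one-variable theory (degree, gcd, derivative)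
    applies to the outermost one over a factorial ring of constants. *)
Fixpoint tower (k : nat) : idomainType :=
  if k is k'.+1 then {poly tower k'} : idomainType else int.

Lemma factorial_tower k : factorial_domain (tower k).
Proof.
by elim: k => [|k IH]; [exact: factorial_int | exact: factorial_poly].
Qed.

Definition tev_step (A : comNzRingType) (x : A) (B : idomainType)
    (f : {rmorphism B -> A}) : {rmorphism {poly B} -> A} :=
  horner_eval x \o map_poly f.

(** The recursion builds a bundled morphism, hence the [rmorph] lemmas apply at every level. *)
Fixpoint tev (A : comNzRingType) (x : nat -> A) (k : nat) :
    {rmorphism tower k -> A} :=
  if k is k'.+1 return {rmorphism tower k -> A} then tev_step (x k') (tev x k')
  else intr : {rmorphism int -> A}.

Arguments tev : simpl never.

Lemma tevS (A : comNzRingType) (x : nat -> A) k (p : {poly tower k}) :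
  tev x k.+1 p = \sum_(j < size p) tev x k p`_j * x k ^+ j.
Proof.
transitivity (map_poly (tev x k) p).[x k] => //.
by rewrite (horner_coef_wide _ (size_poly _ _)); apply: eq_bigr => j _; rewrite coef_map.
Qed.

Lemma tevC (A : comNzRingType) (x : nat -> A) k (c : tower k) :
  tev x k.+1 c%:P = tev x k c.
Proof. by transitivity (map_poly (tev x k) c%:P).[x k] => //; rewrite map_polyC hornerC. Qed.

Lemma tevX (A : comNzRingType) (x : nat -> A) k :
  tev x k.+1 ('X : {poly tower k}) = x k.
Proof. by transitivity (map_poly (tev x k) 'X).[x k] => //; rewrite map_polyX hornerX. Qed.

Lemma tev_comp (A B : comNzRingType) (h : {rmorphism A -> B}) (x : nat -> A) k p :
  h (tev x k p) = tev (h \o x) k p.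
Proof.
elim: k p => [|k IH] p; first by rewrite /tev /= rmorph_int.
rewrite !tevS rmorph_sum; apply: eq_bigr => j _.
by rewrite rmorphM rmorphXn IH.
Qed.

Lemma eq_tev (A : comNzRingType) (x y : nat -> A) k p :
  (forall j, (j < k)%N -> x j = y j) -> tev x k p = tev y k p.
Proof.
elim: k p => [//|k IH] p xy; rewrite !tevS; apply: eq_bigr => j _.
by rewrite IH ?xy // => l lk; apply: xy; rewrite ltnS ltnW.
Qed.

(** A nonzero polynomial does not vanish on a product of infinite sets: the inner variables are
    chosen to keep the leading coefficient nonzero, after which the outermost one has only finitely
    many values to avoid. *)
Lemma tev_neq0 (A : idomainType) (E : nat -> A -> Prop) :
  (forall n : int, n%:~R = 0 :> A -> n = 0) ->
  (forall j n, exists s : seq A, [/\ size s = n, uniq s & forall a, a \in s -> E j a]) ->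
  forall k (p : tower k), p != 0 ->
  exists2 x : nat -> A, (forall j, E j (x j)) & tev x k p != 0.
Proof.
move=> char0 infE; have Ene j : exists a, E j a.
  have [[|a s] [//= _ _ sE]] := infE j 1; exists a; apply: sE; exact: mem_head.
elim=> [|k IH] p p0.
  have [x xE] := boolp.choice Ene; exists x => //.
  by apply: contraNneq p0 => /char0 ->.
have l0 : lead_coef (p : {poly tower k}) != 0 by rewrite lead_coef_eq0.
have [x xE xl] := IH _ l0.
pose q := map_poly (tev x k) p.
have q0 : q != 0.
  apply: contraNneq xl => q0; have := congr1 (fun r : {poly A} => r`_(size (p : {poly tower k})).-1) q0.
  by rewrite coef_map coef0 lead_coefE => ->.
have [s [ss us sE]] := infE k (size q).
have [a as_ ra] : exists2 a, a \in s & ~~ root q a.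
  have [/hasP//|] := boolP (has (fun a => ~~ root q a) s).
  rewrite -all_predC => /allP nr.
  suff : (size s < size q)%N by rewrite ss ltnn.
  apply: max_poly_roots => //.
  by apply/allP => a /nr /=; rewrite negbK.
exists (fun j => if j == k then a else x j).
  by move=> j; case: eqP => [->|_] //; apply: sE.
rewrite tevS; apply: contraNneq ra => h; rewrite /root (horner_coef_wide _ (size_poly _ _)).
rewrite -[X in _ == X]h; apply/eqP; apply: eq_bigr => j _; rewrite coef_map eqxx.
by congr (_ * _); apply: eq_tev => l lk; rewrite ltn_eqF.
Qed.

(** * Laurent polynomials *)

Section LaurentTheory.
Local Open Scope fset_scope.
Local Open Scope ring_scope.
Variable d : nat.
Local Notation L := (laurent d).
Local Notation Zd := 'rV[int]_d.
Implicit Types (f g : L) (k l n : Zd) (c : int).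

Lemma lcoefM f g n :
  lcoef (f * g) n = lpair f (fun k => lpair g (fun l => (k + l == n)%:R)).
Proof. exact: lmul_pairE. Qed.

Lemma lcoefD f g n : lcoef (f + g) n = lcoef f n + lcoef g n.
Proof. exact: laddE. Qed.

Lemma lcoef0 n : lcoef (0 : L) n = 0.
Proof. exact: lzeroE. Qed.

Lemma lcoefN f n : lcoef (- f) n = - lcoef f n.
Proof. exact: loppE. Qed.

Lemma lcoef_sum (I : Type) (r : seq I) (P : pred I) (F : I -> L) n :
  lcoef (\sum_(i <- r | P i) F i) n = \sum_(i <- r | P i) lcoef (F i) n.
Proof.
by apply: (big_morph (fun f : L => lcoef f n)) => [f g|]; rewrite ?lcoefD ?lcoef0.
Qed.

Lemma lcoef_monoM c k f n : lcoef (lmono c k * f) n = c * lcoef f (n - k).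
Proof.
rewrite lcoefM lpair_mono -lpair_delta; congr (_ * _).
by apply: eq_lpair => l; rewrite (can2_eq (addKr k) (addNKr k)) addrC.
Qed.

Lemma lmonoM c c' k l : lmono c k * lmono c' l = lmono (c * c') (k + l).
Proof.
apply: laurentP => n; rewrite lcoef_monoM !lmonoE.
by rewrite subr_eq addrC; case: eqP => // _; rewrite mulr0.
Qed.

Lemma lmono0 : lmono 1 0 = 1 :> L. Proof. by []. Qed.

Lemma lmonoVr k : lmono 1 k * lmono 1 (- k) = 1.
Proof. by rewrite lmonoM subrr mulr1. Qed.

Lemma mem_lsupp f n : (n \in lsupp f) = (lcoef f n != 0).
Proof. by rewrite mem_finsupp. Qed.

Lemma laurent_neq0 f : f != 0 -> exists n, lcoef f n != 0.
Proof.
move=> f0; apply: boolp.contrapT => nf; case/negP: f0; apply/eqP/laurentP => n.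
rewrite lcoef0; apply/eqP; apply: boolp.contrapT => fn; apply: nf; exists n.
by apply/negP.
Qed.

Lemma lmono_sum f : f = \sum_(n <- lsupp f) lmono (lcoef f n) n.
Proof.
apply: laurentP => m; rewrite lcoef_sum -[LHS]lpair_delta; apply: eq_bigr => n _.
by rewrite lmonoE eq_sym; case: eqP; rewrite ?mulr1 ?mulr0.
Qed.

(** The additive extension of a function of the exponents. It is evaluation at a point when [phi] is
    a character, and convolution when [phi] is a translate of a reflected sequence. *)
Definition lsum (A : pzRingType) (phi : Zd -> A) f : A :=
  \sum_(n <- lsupp f) (lcoef f n)%:~R * phi n.

Lemma lsumW (A : pzRingType) (phi : Zd -> A) (D : {fset Zd}) f : lsupp f `<=` D ->
  lsum phi f = \sum_(n <- D) (lcoef f n)%:~R * phi n.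
Proof.
move=> fD; rewrite /lsum (big_fset_incl _ fD) // => k _ /lcoef_notin ->.
by rewrite mul0r.
Qed.

Lemma lsumD (A : pzRingType) (phi : Zd -> A) f g :
  lsum phi (f + g) = lsum phi f + lsum phi g.
Proof.
have fgs : lsupp (f + g) `<=` lsupp f `|` lsupp g.
  apply/fsubsetP => n; rewrite in_fsetU !mem_lsupp lcoefD.
  by apply: contraR; rewrite negb_or !negbK => /andP[/eqP-> /eqP->].
rewrite (lsumW _ fgs) (lsumW _ (fsubsetUl (lsupp f) (lsupp g))).
rewrite (lsumW _ (fsubsetUr (lsupp f) (lsupp g))) -big_split.
by apply: eq_bigr => n _ /=; rewrite -mulrDl -rmorphD lcoefD.
Qed.

Lemma lsum0 (A : pzRingType) (phi : Zd -> A) : lsum phi (0 : L) = 0.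
Proof. by apply: (addrI (lsum phi 0)); rewrite -lsumD !addr0. Qed.

Lemma lsum_big (A : pzRingType) (phi : Zd -> A) (I : Type) (r : seq I) P (F : I -> L) :
  lsum phi (\sum_(i <- r | P i) F i) = \sum_(i <- r | P i) lsum phi (F i).
Proof. by apply: big_morph; [exact: lsumD | exact: lsum0]. Qed.

Lemma lsum_mono (A : pzRingType) (phi : Zd -> A) c k :
  lsum phi (lmono c k) = c%:~R * phi k.
Proof.
rewrite (lsumW phi (D := [fset k])); first by rewrite big_seq_fset1 lmonoE eqxx.
apply/fsubsetP => n; rewrite mem_lsupp lmonoE in_fset1.
by case: (n == k) => //; rewrite eqxx.
Qed.

Lemma lsum_monoE f : f = lsum (lmono 1) f.
Proof.
rewrite {1}[f]lmono_sum; apply: eq_bigr => n _; rewrite mulrzl.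
apply: laurentP => m; rewrite -[_ *~ _]mulrzl.
have intE (z : int) : z%:~R = lmono z 0 :> L.
  elim/int_rect: z => [|z IH|z IH].
  - by apply: laurentP => l; rewrite lcoef0 lmonoE; case: ifP.
  - rewrite intS intrD IH; apply: laurentP => l.
    by rewrite lcoefD !lmonoE; case: ifP; rewrite ?addr0.
  - rewrite intS opprD intrD IH mulrN1z; apply: laurentP => l.
    by rewrite lcoefD lcoefN !lmonoE; case: ifP; rewrite ?addr0 ?oppr0.
by rewrite intE lmonoM mulr1 add0r.
Qed.

Lemma lsumM (A : comPzRingType) (phi : Zd -> A) f g :
  lsum phi (f * g) = lsum (fun k => lsum (fun l => phi (k + l)) g) f.
Proof.
rewrite {1}[f]lmono_sum mulr_suml lsum_big; apply: eq_bigr => k _.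
rewrite {1}[g]lmono_sum mulr_sumr lsum_big [in RHS]mulr_sumr.
by apply: eq_bigr => l _; rewrite lmonoM lsum_mono rmorphM /= mulrA.
Qed.

Lemma lsum_rmorph (A : comNzRingType) (phi : Zd -> A) :
  phi 0 = 1 -> (forall k l, phi (k + l) = phi k * phi l) ->
  exists h : {rmorphism L -> A}, h =1 lsum phi.
Proof.
move=> phi0 phiD.
have hB : zmod_morphism (lsum phi : L -> A).
  move=> f g; rewrite lsumD; congr (_ + _); apply: (addrI (lsum phi g)).
  by rewrite -lsumD !subrr lsum0.
have hM : monoid_morphism (lsum phi : L -> A).
  split; first by rewrite -lmono0 lsum_mono phi0 mulr1.
  move=> f g; rewrite lsumM mulr_suml; apply: eq_bigr => k _.
  rewrite -mulrA; congr (_ * _); rewrite mulr_sumr; apply: eq_bigr => l _.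
  by rewrite phiD mulrCA.
pose h1 := GRing.isZmodMorphism.Build L A (lsum phi) hB.
pose h2 := GRing.isMonoidMorphism.Build L A (lsum phi) hM.
pose h : {rmorphism L -> A} := HB.pack (lsum phi) h1 h2.
by exists h.
Qed.

(** The Euler derivation z_i d/dz_i, which preserves monomials up to a factor; on the torus it is
    the partial derivative divided by 2 pi i. *)
Definition lderiv i f : L := Laurent [fsfun n in lsupp f => n 0 i * lcoef f n].

Lemma lderivE i f n : lcoef (lderiv i f) n = n 0 i * lcoef f n.
Proof. by rewrite /= fsfunE; case: ifPn => // /lcoef_notin ->; rewrite mulr0. Qed.

Lemma lderivD i f g : lderiv i (f + g) = lderiv i f + lderiv i g.
Proof. by apply: laurentP => n; rewrite lcoefD !lderivE lcoefD mulrDr. Qed.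

Lemma lderiv0 i : lderiv i 0 = 0.
Proof. by apply: laurentP => n; rewrite lderivE !lcoef0 mulr0. Qed.

Lemma lderiv_sum i (I : Type) (r : seq I) P (F : I -> L) :
  lderiv i (\sum_(j <- r | P j) F j) = \sum_(j <- r | P j) lderiv i (F j).
Proof. by apply: big_morph; [exact: lderivD | exact: lderiv0]. Qed.

Lemma lderiv_mono i c k : lderiv i (lmono c k) = lmono (k 0 i * c) k.
Proof.
by apply: laurentP => n; rewrite lderivE !lmonoE; case: eqP => [->|]; rewrite ?mulr0.
Qed.

Lemma lderivM i f g : lderiv i (f * g) = lderiv i f * g + f * lderiv i g.
Proof.
rewrite {1 2 3}[f]lmono_sum lderiv_sum !mulr_suml lderiv_sum -big_split.
apply: eq_bigr => k _; rewrite {1 2 3}[g]lmono_sum lderiv_sum !mulr_sumr lderiv_sum -big_split.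
apply: eq_bigr => l _; rewrite /= lmonoM !lderiv_mono !lmonoM mxE.
by apply: laurentP => n; rewrite lcoefD !lmonoE; case: eqP => // _; ring.
Qed.

(** The substitution of 1/z for z, which on the torus is complex conjugation of the value. *)
Definition lconj f : L :=
  Laurent [fsfun n in [fset - k | k in lsupp f] => lcoef f (- n)].

Lemma lconjE f n : lcoef (lconj f) n = lcoef f (- n).
Proof.
rewrite /= fsfunE; case: ifPn => // nf; apply/esym/lcoef_notin; apply: contra nf => nf.
by apply/imfsetP; exists (- n) => //; rewrite opprK.
Qed.

End LaurentTheory.

(** * Irreducible Laurent polynomials are prime *)

Definition chi (A : fieldType) d (y : 'I_d -> A) (n : 'rV[int]_d) : A :=
  \prod_(i < d) y i ^ n 0 i.

Lemma chi0 (A : fieldType) d (y : 'I_d -> A) : chi y 0 = 1.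
Proof. by rewrite /chi big1 // => i _; rewrite mxE expr0z. Qed.

Lemma chiD (A : fieldType) d (y : 'I_d -> A) : (forall i, y i != 0) ->
  forall k l, chi y (k + l) = chi y k * chi y l.
Proof.
move=> y0 k l; rewrite -big_split; apply: eq_bigr => i _.
by rewrite mxE expfzDr.
Qed.

Lemma chi_delta (A : fieldType) d (y : 'I_d -> A) i : chi y (delta_mx 0 i) = y i.
Proof.
rewrite /chi (bigD1 i) //= mxE !eqxx expr1z big1 ?mulr1 // => j ji.
by rewrite mxE (negbTE ji) andbF expr0z.
Qed.

Lemma rdvd_unit (A : comNzRingType) (a b : A) : rdvd a b -> runit b -> runit a.
Proof. by move=> [c ->] [e ce]; exists (c * e); rewrite mulrA. Qed.

Lemma rmorph_rdvd (A B : comNzRingType) (h : {rmorphism A -> B}) a b :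
  rdvd a b -> rdvd (h a) (h b).
Proof. by move=> [c ->]; exists (h c); rewrite rmorphM. Qed.

Section Localization.
Variables (d' : nat) (s : {perm 'I_d'.+1}).
Local Notation d := d'.+1.
Local Notation L := (laurent d).
Local Notation Zd := 'rV[int]_d.

(* The permutation [s] lets any variable be the outermost one of the tower. *)
Definition towvar (j : nat) : L := lmono 1 (delta_mx 0 (s (inord j))).
Local Notation phi := (tev towvar).

Lemma lmono_expr (n : Zd) m : lmono 1 n ^+ m = lmono 1 (n *+ m) :> L.
Proof.
elim: m => [|m IH]; first by rewrite expr0 mulr0n.
by rewrite exprS IH lmonoM mulrS mulr1.
Qed.

Lemma lmono_tower k (n : Zd) : (k <= d)%N -> (forall i, 0 <= n 0 i) ->
  (forall i, n 0 i != 0 -> exists2 j, (j < k)%N & s (inord j) = i) ->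
  exists c, phi k c = lmono 1 n.
Proof.
elim: k n => [|k IH] n kd n0 nk.
  exists 1; rewrite rmorph1 -lmono0; congr lmono; apply/rowP => i; rewrite mxE.
  by apply/eqP; rewrite eq_sym; apply: contraT => /nk[].
set i := s (inord k).
have [m nm] : exists m : nat, n 0 i = m by exists (absz (n 0 i)); rewrite gez0_abs.
have [|||c cE] := IH (n - delta_mx 0 i *+ m).
- exact: ltnW.
- move=> l; rewrite !mxE mulmxnE mxE /=.
  by case: eqP => [->|_]; [rewrite nm -natz subrr | rewrite mul0rn subr0].
- move=> l; rewrite !mxE; have [->|li] := eqVneq l i.
    by rewrite nm !mulmxnE mxE !eqxx -natz mulr1n subrr.
  rewrite mulmxnE mxE (negbTE li) andbF mul0rn subr0 => /nk[j jk jl]; exists j => //.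
  rewrite ltnS leq_eqVlt in jk; case/orP: jk => // /eqP jk.
  by rewrite -jl jk eqxx in li.
exists (c%:P * 'X^m : {poly tower k}); rewrite rmorphM rmorphXn tevC tevX cE lmono_expr.
by rewrite lmonoM mulr1 subrK.
Qed.

(** The shape matters: all variables but the outermost are hidden in the constant [c], so that
    arguments by degree see a monomial as a constant times a power of 'X. *)
Lemma lmono_tower_top (n : Zd) : (forall i, 0 <= n 0 i) ->
  exists (c : tower d') m, phi d (c%:P * 'X^m) = lmono 1 n.
Proof.
move=> n0; set i := s (inord d').
have [m nm] : exists m : nat, n 0 i = m by exists (absz (n 0 i)); rewrite gez0_abs.
have [|||c cE] := @lmono_tower d' (n - delta_mx 0 i *+ m).
- exact: leqnSn.
- move=> l; rewrite !mxE mulmxnE mxE /=.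
  by case: eqP => [->|_]; [rewrite nm -natz subrr | rewrite mul0rn subr0].
- move=> l; rewrite !mxE; have [->|li] := eqVneq l i.
    by rewrite nm !mulmxnE mxE !eqxx -natz mulr1n subrr.
  rewrite mulmxnE mxE (negbTE li) andbF mul0rn subr0 => _.
  exists (val ((s^-1)%g l)); last by rewrite inord_val permKV.
  rewrite ltn_neqAle -ltnS ltn_ord andbT; apply: contraNneq li => /= jd.
  by rewrite -[l](permKV s) /i (inj_eq perm_inj) -val_eqE /= jd inordK.
by exists c, m; rewrite rmorphM rmorphXn tevC tevX cE lmono_expr lmonoM mulr1 subrK.
Qed.

(** R_d is the tower with its variables inverted: one monomial, all of whose exponents bound the
    support of [v], clears the denominators. *)
Lemma localize (v : L) : exists (n : Zd) P, (forall i, 0 <= n 0 i) /\ v * lmono 1 n = phi d P.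
Proof.
pose B := \max_(l <- lsupp v) Znorm l.
have Bl l i : l \in lsupp v -> (`|l 0%R i| <= B)%N.
  move=> lv; apply: (@leq_trans (Znorm l)).
    exact: (leq_bigmax (F := fun i => `|l 0%R i|%N)).
  by rewrite /B leq_bigmax_seq.
pose n : Zd := const_mx B%:Z; exists n.
suff [P PE] : exists P, v * lmono 1 n = phi d P.
  by exists P; split=> // i; rewrite mxE.
rewrite {1}[v]lmono_sum mulr_suml.
rewrite big_seq; apply: (big_ind (fun u => exists P, u = phi d P)).
- by exists 0; rewrite rmorph0.
- by move=> u w [P ->] [Q ->]; exists (P + Q); rewrite rmorphD.
move=> l lv; have [|c [m cm]] := @lmono_tower_top (l + n).
  by move=> i; rewrite !mxE; move: (l 0 i) (B) (Bl l i lv) => z b; lia.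
exists ((lcoef v l)%:~R * (c%:P * 'X^m)); rewrite rmorphM cm rmorph_int.
have -> : (lcoef v l)%:~R = lmono (lcoef v l) 0 :> L.
  rewrite -[LHS]mulr1 -[1 in X in _ * X](@lmono0 d).
  by rewrite -(@lsum_mono d L (lmono 1)) -lsum_monoE.
by rewrite !lmonoM mulr1 add0r.
Qed.

Lemma tower_eval (A : fieldType) (y : 'I_d -> A) : (forall i, y i != 0) ->
  forall P, lsum (chi y) (phi d P) = tev (fun j => y (s (inord j))) d P.
Proof.
move=> y0 P; have [h hE] := lsum_rmorph (chi0 y) (chiD y0).
rewrite -hE tev_comp; apply: eq_tev => j jd /=.
by rewrite hE lsum_mono mul1r chi_delta.
Qed.

Lemma tower_nonvanishing (A : fieldType) (E : 'I_d -> A -> Prop) :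
  (forall n : int, n%:~R = 0 :> A -> n = 0) ->
  (forall i a, E i a -> a != 0) ->
  (forall i n, exists r : seq A, [/\ size r = n, uniq r & forall a, a \in r -> E i a]) ->
  forall P, P != 0 ->
  exists2 y : 'I_d -> A, (forall i, E i (y i)) & lsum (chi y) (phi d P) != 0.
Proof.
move=> char0 Enz Einf P P0.
have [x xE xP] := tev_neq0 (E := fun j => E (s (inord j))) char0 (fun j => Einf _) P0.
pose y i := x (val ((s^-1)%g i)).
have yE i : E i (y i) by have := xE (val ((s^-1)%g i)); rewrite inord_val permKV.
exists y => //; rewrite tower_eval; last by move=> i; exact: (Enz i).
apply: contraNneq xP => <-; apply/eqP; apply: eq_tev => j jd.
by rewrite /y permK /= inordK.
Qed.

(** The tower embeds in R_d because evaluation at a rational point with nonzero coordinates factors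
    through [phi], and such points detect nonzero polynomials. *)
Lemma phi_eq0 P : phi d P = 0 -> P = 0.
Proof.
move=> P0; apply/eqP; apply: contraT => /(tower_nonvanishing (A := rat) (E := fun _ a => a != 0)).
case=> //.
- by move=> n /eqP; rewrite intr_eq0 => /eqP.
- move=> _ n; exists [seq j.+1%:R | j <- iota 0 n]; rewrite size_map size_iota.
  rewrite map_inj_uniq ?iota_uniq; last by move=> j k /eqP; rewrite eqr_nat => /eqP[].
  by split=> // a /mapP[j _ ->]; rewrite pnatr_eq0.
- by move=> y _; rewrite P0 lsum0 eqxx.
Qed.

Lemma laurent_nonvanishing_perm (A : fieldType) (E : 'I_d -> A -> Prop) :
  (forall n : int, n%:~R = 0 :> A -> n = 0) ->
  (forall i a, E i a -> a != 0) ->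
  (forall i n, exists r : seq A, [/\ size r = n, uniq r & forall a, a \in r -> E i a]) ->
  forall v : L, v != 0 ->
  exists2 y : 'I_d -> A, (forall i, E i (y i)) & lsum (chi y) v != 0.
Proof.
move=> char0 Enz Einf v v0; have [n [P [n0 vP]]] := localize v.
have P0 : P != 0.
  apply: contraNneq v0 => P0; rewrite P0 rmorph0 in vP.
  by rewrite -[v]mulr1 -(lmonoVr n) mulrA vP mul0r.
have [y yE yP] := tower_nonvanishing char0 Enz Einf P0.
exists y => //; apply: contraNneq yP => v0'.
have [h hE] := lsum_rmorph (chi0 y) (chiD (fun i => Enz i _ (yE i))).
by rewrite -vP -hE rmorphM hE v0' mul0r.
Qed.

(** The monomial clears the denominators of the quotient; injectivity of [phi] then brings the
    equation back to the tower. *)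
Lemma rdvd_phi p a : rdvd (phi d p) (phi d a) ->
  exists (c : tower d') m, [/\ c != 0, runit (phi d (c%:P * 'X^m)) & rdvd p (a * (c%:P * 'X^m))].
Proof.
move=> [q qE]; have [n [Q [n0 QE]]] := localize q.
have [c [m cm]] := lmono_tower_top n0.
have nu : runit (lmono 1 n : L) by exists (lmono 1 (- n)); rewrite lmonoVr.
exists c, m; split.
- apply: contraT; rewrite negbK => /eqP c0; have [w nw] := nu.
  by have := oner_neq0 L; rewrite -nw -cm c0 mul0r rmorph0 mul0r eqxx.
- by rewrite cm.
- exists Q; apply/eqP; rewrite -subr_eq0; apply/eqP/phi_eq0.
  by rewrite rmorphB rmorphM cm qE rmorphM -QE mulrA subrr.
Qed.

(** The polynomial obtained by clearing denominators may contain factors that become units of R_d.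
    Removing such a factor lowers [mu]; when none is left, a proper factorization would contradict
    the irreducibility of [g], and in the factorial tower an irreducible is prime. *)
Lemma irreducible_tower (g : L) : ~ lunit g -> irreducible g ->
  exists p w w', [/\ p != 0, rprime p, w * w' = 1 & g * w = phi d p].
Proof.
move=> gu [g0 girr]; have [[mu [mule mult]] irrp] := factorial_tower d.
suff H (P : tower d) w w' : w * w' = 1 -> g * w = phi d P ->
    exists p w w', [/\ p != 0, rprime p, w * w' = 1 & g * w = phi d p].
  have [n [P [n0 vP]]] := localize g; apply: H vP; exact: lmonoVr.
have [N] := ubnP (mu P); elim: N P w w' => // N IH P w w' PN ww' gP.
have P0 : P != 0.
  by apply: contraNneq g0 => P0; rewrite -[g]mulr1 -ww' mulrA gP P0 rmorph0 mul0r.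
have Pu : ~ runit P.
  move=> [Q PQ]; apply: gu; exists (w * phi d Q).
  by rewrite mulrA gP -rmorphM PQ rmorph1.
have [[b [c [Pbc bu cu]]]|nf] :=
  boolp.EM (exists b c, [/\ P = b * c, ~ runit b & ~ runit c]); last first.
  exists P, w, w'; split=> //; apply: irrp => //; split=> // b c abc.
  have [|bu] := boolp.EM (runit b); first by left.
  have [|cu] := boolp.EM (runit c); first by right.
  by case: nf; exists b, c.
have gE : g = phi d b * (phi d c * w') by rewrite mulrA -rmorphM -Pbc -gP -mulrA ww' mulr1.
have [[e be]|nb] := boolp.EM (runit (phi d b)).
  apply: (IH c (w * e) (w' * phi d b)).
  - apply: (@leq_trans (mu P)); last by rewrite -ltnS.
    by rewrite Pbc mult // -Pbc.
  - by rewrite mulrACA ww' mul1r mulrC be.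
  - rewrite mulrA gP Pbc rmorphM; rewrite mulrAC be mul1r //.
have [[e ce]|nc] := boolp.EM (runit (phi d c)); last first.
  case: girr; exists (phi d b), (phi d c * w'); split=> //.
  by move=> [e ce]; apply: nc; exists (w' * e); rewrite mulrA.
apply: (IH b (w * e) (w' * phi d c)).
- apply: (@leq_trans (mu P)); last by rewrite -ltnS.
  by rewrite Pbc mulrC mult // mulrC -Pbc.
- by rewrite mulrACA ww' mul1r mulrC ce.
- by rewrite mulrA gP Pbc rmorphM -mulrA ce mulr1.
Qed.

(** The prime [p] of the tower associated with [g] divides a product of [P], [Q] and a monomial. It
    cannot divide the monomial, since [g] would then be a unit. *)
Lemma laurent_prime_perm (g : L) : ~ lunit g -> irreducible g -> rprime g.
Proof.
move=> gu girr; split=> // a b [q abq].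
have [p [w [w' [p0 pp ww' gp]]]] := irreducible_tower gu girr.
have [n [P [n0 aP]]] := localize a; have [m [Q [m0 bQ]]] := localize b.
have : rdvd (phi d p) (phi d (P * Q)).
  exists (w' * q * lmono 1 n * lmono 1 m).
  rewrite rmorphM -aP -bQ -gp mulrACA abq !mulrA; congr (_ * _ * _).
  by rewrite -[g * w * w']mulrA ww' mulr1.
case/rdvd_phi => c [k [c0 cu]]; case: (pp) => pu pdvd.
have gdvd v : rdvd (phi d p) v -> ldivides g v.
  by move=> [e ->]; exists (w * e); rewrite mulrA gp.
have back v l R : v * lmono 1 l = phi d R -> rdvd p R -> ldivides g v.
  move=> vR [S RS]; have [e eE] : ldivides g (v * lmono 1 l).
    by apply: gdvd; rewrite vR RS rmorphM; exists (phi d S).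
  by exists (e * lmono 1 (- l)); rewrite mulrA -eE -mulrA lmonoVr mulr1.
case/pdvd => [/pdvd[]|pc].
- by move/(back _ _ _ aP); left.
- by move/(back _ _ _ bQ); right.
- case: gu; apply: (rdvd_unit _ cu); apply: gdvd; exact: rmorph_rdvd.
Qed.

Local Notation top := (s (inord d')).

Lemma lderiv_low k (c : tower k) : (k <= d')%N -> lderiv top (phi k c) = 0.
Proof.
elim: k c => [|k IH] c kd.
  have -> : phi 0 c = lmono c 0; last by rewrite lderiv_mono mxE mul0r; apply: laurentP => n; rewrite lmonoE lcoef0 if_same.
  by rewrite -[LHS]mulr1 -[1 in X in _ * X](@lmono0 d) -(@lsum_mono d L (lmono 1)) -lsum_monoE.
elim/poly_ind: (c : {poly tower k}) => [|q e IHq]; first by rewrite rmorph0 lderiv0.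
rewrite rmorphD rmorphM tevC tevX lderivD lderivM IHq mul0r add0r IH ?(ltnW kd) // addr0.
rewrite /towvar lderiv_mono mxE eqxx /=.
have -> : (top == s (inord k)) = false.
  rewrite (inj_eq perm_inj) -val_eqE /= !inordK //; last by rewrite ltnS ltnW.
  by rewrite gtn_eqF.
rewrite mul0r; have -> : lmono 0 (delta_mx 0 (s (inord k))) = 0 :> L.
  by apply: laurentP => n; rewrite lmonoE lcoef0 if_same.
by rewrite mulr0.
Qed.

Lemma lderiv_top (p : {poly tower d'}) : lderiv top (phi d p) = phi d ('X * p^`()).
Proof.
elim/poly_ind: p => [|q e IH]; first by rewrite deriv0 mulr0 rmorph0 lderiv0.
rewrite derivD derivM derivC derivX addr0 mulr1 [in LHS]rmorphD [in LHS]rmorphM.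
rewrite tevC tevX lderivD lderivM IH lderiv_low // addr0.
rewrite {2}/towvar lderiv_mono mxE !eqxx mul1r -/(towvar d').
rewrite mulrDr rmorphD !rmorphM tevX; ring.
Qed.

Lemma tower_natr_neq0 k m : (m.+1)%:R != 0 :> tower k.
Proof.
apply/eqP => /(congr1 (tev (fun=> 0 : rat) k)); rewrite rmorph0 rmorph_nat.
by move/eqP; rewrite pnatr_eq0.
Qed.

Lemma lderiv_eq0 (f : L) i : lderiv i f = 0 -> forall n, lcoef f n != 0 -> n 0 i = 0.
Proof.
move=> Df n fn; have := lderivE i f n; rewrite Df lcoef0 => /esym/eqP.
by rewrite mulf_eq0 (negbTE fn) orbF => /eqP.
Qed.

(** If [g] divided twice its derivative, then [q], coprime to 'X, would divide a constant multiple
    of its own derivative, which by degree would be 0. All exponents of [g] would then agree in the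
    outermost variable. The factor 2 is the one in [umul]. *)
Lemma not_dvd_lderiv_perm (g : L) n m : lcoef g n != 0 -> lcoef g m != 0 ->
  n 0 top != m 0 top -> ~ ldivides g (lderiv top g *+ 2).
Proof.
move=> gn gm nm [e ge].
have g0 : g != 0 by apply: contraNneq gn => ->; rewrite lcoef0.
have [l [P [l0 gP]]] := localize g.
have P0 : P != 0.
  by apply: contraNneq g0 => P0; rewrite -[g]mulr1 -(lmonoVr l) mulrA gP P0 rmorph0 mul0r.
(* Taking out the power of the outermost variable leaves [q] with a nonzero constant coefficient,
   hence coprime to 'X. *)
have [k [q]] := multiplicity_XsubC (P : {poly tower d'}) 0.
rewrite P0 /= subr0 => q0 Pq.
pose w : L := lmono 1 (l - delta_mx 0 top *+ k).
have gw : g * w = phi d q.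
  have : phi d q * lmono 1 (delta_mx 0 top *+ k) = g * lmono 1 l.
    by rewrite gP Pq rmorphM rmorphXn tevX lmono_expr.
  move/(congr1 (fun v => v * lmono 1 (- (delta_mx 0 top *+ k)))).
  by rewrite -!mulrA lmonoVr mulr1 => ->; rewrite lmonoM mulr1.
have [w' ww'] : exists w', w * w' = 1 by exists (lmono 1 (- (l - delta_mx 0 top *+ k))); rewrite lmonoVr.
have : rdvd (phi d q) (phi d ('X * (q : {poly tower d'})^`() *+ 2)).
  exists (w' * (e * w + lderiv top w *+ 2)).
  rewrite rmorphMn -lderiv_top -gw lderivM mulrnDl -mulrnAl ge !mulrA -[g * w * w']mulrA ww' mulr1.
  by rewrite mulrDr mulrnAr mulrA.
case/rdvd_phi => c [j [c0 cu [Q qQ]]].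
have q'0 : (q : {poly tower d'})^`() = 0.
  apply/eqP; apply: contraT => q'0.
  have cop : Pdiv.Idomain.coprimep (q : {poly tower d'}) 'X^(j.+1).
    by rewrite Pdiv.Idomain.coprimep_expr // Pdiv.Idomain.coprimepX.
  have : Pdiv.Idomain.dvdp (q : {poly tower d'}) ((2%:R * c) *: (q : {poly tower d'})^`()).
    rewrite -(Pdiv.Idomain.Gauss_dvdpl _ cop).
    have -> : (2%:R * c) *: (q : {poly tower d'})^`() * 'X^(j.+1) = q * Q.
      by rewrite -qQ -mul_polyC polyCM polyCMn exprS; ring.
    by rewrite Pdiv.Idomain.dvdp_mulr // Pdiv.Idomain.dvdpp.
  have c20 : 2%:R * c != 0 by rewrite mulf_neq0 // tower_natr_neq0.
  have nz : (2%:R * c) *: (q : {poly tower d'})^`() != 0 by rewrite -size_poly_eq0 size_scale // size_poly_eq0.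
  move/(Pdiv.Idomain.dvdp_leq nz); rewrite size_scale // leqNgt lt_size_deriv //.
  by apply: contraNneq q'0 => ->; rewrite deriv0.
have Dgw : lderiv top (g * w) = 0 by rewrite gw lderiv_top q'0 mulr0 rmorph0.
have E x : lcoef g x != 0 -> (x + (l - delta_mx 0 top *+ k)) 0 top = 0.
  by move=> gx; apply: (lderiv_eq0 Dgw); rewrite mulrC lcoef_monoM mul1r addrK.
by move: nm; have := E _ gn; have := E _ gm; rewrite !mxE => /eqP; rewrite addr_eq0 => /eqP-> /eqP; rewrite addr_eq0 => /eqP->; rewrite eqxx.
Qed.

(** Elimination of one variable: an irreducible [p] is coprime to its nonzero derivative, and a
    Bezout relation yields a nonzero [c] free of that variable. On a coordinate line of the torus
    where [c] does not vanish, [g] and its derivative have no common zero. *)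
Lemma lderiv_bezout_perm (g : L) n m : ~ lunit g -> irreducible g ->
  lcoef g n != 0 -> lcoef g m != 0 -> n 0 top != m 0 top ->
  exists c A B : L, [/\ c != 0, lderiv top c = 0 & c = A * g + B * lderiv top g].
Proof.
move=> gu girr gn gm nm.
have [p [w [w' [p0 pp ww' gp]]]] := irreducible_tower gu girr.
have Dg : lderiv top g * w + g * lderiv top w = phi d ('X * (p : {poly tower d'})^`()).
  by rewrite -lderiv_top -gp lderivM.
have p'0 : (p : {poly tower d'})^`() != 0.
  apply/eqP => p'0; case: (not_dvd_lderiv_perm gn gm nm).
  exists (- (lderiv top w * w') *+ 2); rewrite mulrnAr; congr (_ *+ 2).
  rewrite -[LHS]mulr1 -ww' mulrA; move: Dg; rewrite p'0 mulr0 rmorph0 => /eqP.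
  by rewrite addr_eq0 => /eqP->; ring.
have sp : (1 < size (p : {poly tower d'}))%N.
  rewrite ltnNge; apply: contraNN p'0 => s1.
  by rewrite (size1_polyC s1) derivC.
have cop : Pdiv.Idomain.coprimep (p : {poly tower d'}) p^`().
  have [//|/(Pdiv.Idomain.dvdp_leq p'0)] := rirred_coprime_or_dvd p^`() (factorial_tower d') sp (rprime_neq0_irred p0 pp).
  by rewrite leqNgt lt_size_deriv.
have [[u v] /Pdiv.Idomain.eqpP[[c1 c2] /= /andP[c10 c20] uv]] := Pdiv.Idomain.Bezout_coprimepP _ _ cop.
(* The derivation is 'X times the formal derivative, so the Bezout relation appears multiplied by
   the outermost variable; [x'] is its inverse. *)
pose x' : L := lmono 1 (- delta_mx 0 top).
have xx' : towvar d' * x' = 1 by rewrite lmonoVr.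
exists (phi d (c2%:P : {poly tower d'})).
exists (x' * phi d (c1%:P * u * 'X) * w + x' * phi d (c1%:P * v) * lderiv top w).
exists (x' * phi d (c1%:P * v) * w); split.
- by apply/eqP => /phi_eq0/eqP; rewrite polyC_eq0 (negbTE c20).
- by rewrite tevC lderiv_low.
transitivity (x' * phi d (c1%:P * u * 'X * p + c1%:P * v * ('X * (p : {poly tower d'})^`()))).
  have -> : c1%:P * u * 'X * p + c1%:P * v * ('X * (p : {poly tower d'})^`()) = c2%:P * 'X.
    rewrite -['X * _]mulrC -[c1%:P * u * 'X * p]mulrAC mulrA -mulrDl; congr (_ * _).
    by rewrite -[RHS]alg_polyC -uv -mul_polyC; ring.
  by rewrite rmorphM tevX mulrCA mulrC [x' * _]mulrC xx' mul1r.
rewrite rmorphD [phi d (_ * p)]rmorphM -gp [phi d (_ * _ * ('X * _))]rmorphM -Dg; ring.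
Qed.

End Localization.

Lemma tperm_top d' (i : 'I_d'.+1) : tperm i ord_max (inord d') = i.
Proof. by rewrite (_ : inord d' = ord_max) ?tpermR //; apply: val_inj; rewrite /= inordK. Qed.

Lemma laurent_prime d' (g : laurent d'.+1) : ~ lunit g -> irreducible g -> rprime g.
Proof. exact: (laurent_prime_perm 1%g). Qed.

Lemma laurent_nonvanishing d' (A : fieldType) (E : 'I_d'.+1 -> A -> Prop) :
  (forall n : int, n%:~R = 0 :> A -> n = 0) ->
  (forall i a, E i a -> a != 0) ->
  (forall i n, exists r : seq A, [/\ size r = n, uniq r & forall a, a \in r -> E i a]) ->
  forall v : laurent d'.+1, v != 0 ->
  exists2 y : 'I_d'.+1 -> A, (forall i, E i (y i)) & lsum (chi y) v != 0.
Proof. exact: (laurent_nonvanishing_perm 1%g). Qed.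

Lemma not_dvd_lderiv d' (g : laurent d'.+1) i n m : lcoef g n != 0 -> lcoef g m != 0 ->
  n 0 i != m 0 i -> ~ ldivides g (lderiv i g *+ 2).
Proof. by have := @not_dvd_lderiv_perm d' (tperm i ord_max) g n m; rewrite tperm_top. Qed.

Lemma lderiv_bezout d' (g : laurent d'.+1) i n m : ~ lunit g -> irreducible g ->
  lcoef g n != 0 -> lcoef g m != 0 -> n 0 i != m 0 i ->
  exists c A B, [/\ c != 0, lderiv i c = 0 & c = A * g + B * lderiv i g].
Proof. by have := @lderiv_bezout_perm d' (tperm i ord_max) g n m; rewrite tperm_top. Qed.

Lemma laurent_mulf_eq0 d' (f g : laurent d'.+1) : f * g = 0 -> f = 0 \/ g = 0.
Proof.
move=> fg0; have [n [P [n0 fP]]] := localize 1%g f; have [m [Q [m0 gQ]]] := localize 1%g g.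
have : tev (@towvar d' 1%g) d'.+1 (P * Q) = 0.
  by rewrite rmorphM -fP -gQ mulrACA fg0 mul0r.
move/phi_eq0/eqP; rewrite mulf_eq0 => /orP[] /eqP h; [left|right].
  by rewrite -[f]mulr1 -(lmonoVr n) mulrA fP h rmorph0 mul0r.
by rewrite -[g]mulr1 -(lmonoVr m) mulrA gQ h rmorph0 mul0r.
Qed.

(** * Finite differences of a quotient *)

Section Differences.
Variables (F : fieldType) (R : realFieldType) (nrm : F -> R).
Hypothesis nrm_ge0 : forall x, 0 <= nrm x.
Hypothesis nrm0 : nrm 0 = 0.
Hypothesis nrm1 : nrm 1 = 1.
Hypothesis nrm_eq0 : forall x, nrm x = 0 -> x = 0.
Hypothesis nrmD : forall x y, nrm (x + y) <= nrm x + nrm y.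
Hypothesis nrmM : forall x y, nrm (x * y) = nrm x * nrm y.
Implicit Types x y z : nat -> F.

Definition dif x : nat -> F := fun i => x i.+1 - x i.

Lemma eq_dif j x y : x =1 y -> iter j dif x =1 iter j dif y.
Proof. by move=> xy; elim: j => [//|j IH] i; rewrite /= /dif !IH. Qed.

Lemma difD j x y i :
  iter j dif (fun i => x i + y i) i = iter j dif x i + iter j dif y i.
Proof. by elim: j i => [//|j IH] i; rewrite /= /dif !IH; ring. Qed.

Lemma dif_shift j x i : iter j dif (fun i => x i.+1) i = iter j dif x i.+1.
Proof. by elim: j i => [//|j IH] i; rewrite /= /dif !IH. Qed.

Lemma nrmN (x : F) : nrm (- x) = nrm x.
Proof.
have nN1 : nrm (-1) = 1.
  have h : nrm (-1) * nrm (-1) = 1 by rewrite -nrmM mulrNN mulr1 nrm1.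
  by have := nrm_ge0 (-1); nra.
by rewrite -mulN1r nrmM nN1 mul1r.
Qed.

Lemma nrmX (x : F) n : nrm (x ^+ n) = nrm x ^+ n.
Proof. by elim: n => [|n IH]; rewrite ?expr0 // !exprS nrmM IH. Qed.

Lemma nrmV (x : F) : nrm x^-1 = (nrm x)^-1.
Proof.
have [->|x0] := eqVneq x 0; first by rewrite invr0 nrm0 invr0.
have n0 : nrm x != 0 by apply: contraNneq x0 => /nrm_eq0 ->.
by apply: (mulfI n0); rewrite -nrmM !divff.
Qed.

Lemma nrm_sum (I : Type) (r : seq I) (P : pred I) (f : I -> F) :
  nrm (\sum_(i <- r | P i) f i) <= \sum_(i <- r | P i) nrm (f i).
Proof.
elim/big_rec2: _ => [|i a b _ ab]; first by rewrite nrm0.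
by apply: le_trans (nrmD _ _) _; rewrite lerD2l.
Qed.

(** Discrete counterpart of a bound on the derivatives up to order [m], with scale [l]. The
    condition [i + j <= r] keeps all the values involved in the window from 0 to [r], where a
    denominator is known not to vanish. *)
Definition dbound (m r : nat) (A l : R) x :=
  forall j i, (j <= m)%N -> (i + j <= r)%N -> nrm (iter j dif x i) <= A * l ^+ j.

Lemma dbound_le m r A A' l l' x : A <= A' -> 0 <= A -> 0 <= l -> l <= l' ->
  dbound m r A l x -> dbound m r A' l' x.
Proof.
move=> AA A0 l0 ll H j i jm ir; apply: le_trans (H j i jm ir) _.
by apply: ler_pM => //; [exact: exprn_ge0 | apply: lerXn2r; rewrite ?nnegrE // (le_trans l0)].
Qed.

Lemma dbound_ext m r A l x y : x =1 y -> dbound m r A l x -> dbound m r A l y.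
Proof. by move=> xy H j i jm ir; rewrite -(eq_dif _ xy) H. Qed.

Lemma dbound_dif m r A l x : dbound m.+1 r.+1 A l x -> dbound m r (A * l) l (dif x).
Proof.
move=> H j i jm ir; rewrite -iterSr -mulrA -exprS; apply: H => //.
by rewrite addnS.
Qed.

Lemma dbound_shift m r A l x : dbound m r.+1 A l x -> dbound m r A l (fun i => x i.+1).
Proof. by move=> H j i jm ir; rewrite dif_shift; apply: H. Qed.

Lemma dboundW m m' r r' A l x : (m' <= m)%N -> (r' <= r)%N ->
  dbound m r A l x -> dbound m' r' A l x.
Proof.
by move=> mm rr H j i jm ir; apply: H; [exact: leq_trans mm | exact: leq_trans rr].
Qed.

Lemma dboundS m r A l x : (forall i, (i <= r.+1)%N -> nrm (x i) <= A) ->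
  dbound m r (A * l) l (dif x) -> dbound m.+1 r.+1 A l x.
Proof.
move=> xA H [|j] i jm ir; first by rewrite expr0 mulr1 /=; apply: xA; rewrite -(addn0 i).
by rewrite iterSr exprS mulrA; apply: H => //; rewrite -ltnS -addnS.
Qed.

(** Discrete Leibniz rule: a difference of the product is a sum of two products of the same kind,
    and the doubled scale absorbs the number of terms. *)
Lemma dboundM m r A B l x y : 0 <= A -> 0 <= B -> 0 <= l ->
  dbound m r A l x -> dbound m r B l y ->
  dbound m r (A * B) (2 * l) (fun i => x i * y i).
Proof.
elim: m r A B x y => [|m IH] r A B x y A0 B0 l0 xA yB.
  move=> [|//] i _; rewrite addn0 => ir; rewrite expr0 mulr1 /= nrmM.
  apply: ler_pM => //; first by have := xA 0%N i isT; rewrite addn0 expr0 mulr1; apply.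
  by have := yB 0%N i isT; rewrite addn0 expr0 mulr1; apply.
have H0 i : (i <= r)%N -> nrm (x i * y i) <= A * B.
  move=> ir; rewrite nrmM; apply: ler_pM => //.
    by have := xA 0%N i isT; rewrite addn0 expr0 mulr1; apply.
  by have := yB 0%N i isT; rewrite addn0 expr0 mulr1; apply.
case: r xA yB H0 => [|r] xA yB H0.
  by move=> [|j] [|i] //= _ _; rewrite expr0 mulr1; apply: H0.
apply: dboundS => //.
have xA' := dboundW (leqnSn m) (leqnSn r) xA.
have yB' := dbound_shift (dboundW (leqnSn m) (leqnn _) yB).
have h1 := IH _ _ _ _ _ (mulr_ge0 A0 l0) B0 l0 (dbound_dif xA) yB'.
have h2 := IH _ _ _ _ _ A0 (mulr_ge0 B0 l0) l0 xA' (dbound_dif yB).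
move=> j i jm ir.
rewrite (@eq_dif _ _ (fun i => dif x i * y i.+1 + x i * dif y i)); last first.
  by move=> k; rewrite /dif; ring.
rewrite difD; apply: le_trans (nrmD _ _) _; apply: le_trans (lerD (h1 j i jm ir) (h2 j i jm ir)) _.
by rewrite -mulrDl ler_wpM2r ?exprn_ge0 ?mulr_ge0 //; lra.
Qed.

(** The difference of 1/x is minus the difference of x over two consecutive values. Each order thus
    costs two products, and each product doubles the scale: hence the factor 4. The initial scale is
    the relative variation of x. *)
Lemma dbound_inv r (A delta rho : R) x : 0 <= A -> 0 <= delta -> 0 < rho ->
  rho <= 2 * A -> (forall j i, nrm (iter j dif x i) <= A * delta ^+ j) ->
  (forall i, (i <= r)%N -> rho / 2 <= nrm (x i)) ->
  forall k, dbound k r (2 / rho) (4 ^+ k * (2 * A * delta / rho)) (fun i => (x i)^-1).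
Proof.
move=> A0 d0 rho0 rhoA xA xrho; set l0 := 2 * A * delta / rho.
have l00 : 0 <= l0 by rewrite divr_ge0 ?mulr_ge0 // ltW.
have dl0 : delta <= l0 by rewrite ler_pdivlMr //; nra.
have xV i : (i <= r)%N -> nrm (x i)^-1 <= 2 / rho.
  move=> ir; rewrite nrmV -[2 / rho]invf_div lef_pV2 ?posrE ?divr_gt0 //; first exact: xrho.
  by apply: lt_le_trans (xrho i ir); rewrite divr_gt0.
have x0 i : (i <= r)%N -> x i != 0.
  move=> ir; apply/eqP => x0; have := xrho i ir; rewrite x0 nrm0 => h.
  by have : 0 < rho / 2 by [rewrite divr_gt0]; lra.
elim=> [|k IH].
  by move=> [|//] i _; rewrite addn0 => ir; rewrite expr0 mulr1; apply: xV.
case: r xrho xV x0 IH => [|r] xrho xV x0 IH.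
  by move=> [|j] [|i] //= _ _; rewrite expr0 mulr1; apply: xV.
apply: dboundS => //.
set l := 4 ^+ k * l0 in IH.
have l0l : l0 <= l by rewrite ler_peMl // exprn_ege1 //; lra.
have lE : 4 ^+ k.+1 * l0 = 2 * (2 * l) by rewrite exprS /l; ring.
have l_ge0 : 0 <= l by exact: le_trans l0l.
have y1 := dboundW (leqnn k) (leqnSn r) IH.
have y2 := dbound_shift IH.
have r0 : 0 <= 2 / rho by rewrite divr_ge0 // ltW.
have yy := dboundM r0 r0 l_ge0 y1 y2.
have dx : dbound k r (A * delta) (2 * l) (dif x).
  move=> j i _ _; rewrite -iterSr; apply: le_trans (xA _ _) _.
  have dl : delta <= 2 * l by apply: le_trans dl0 _; apply: le_trans l0l _; rewrite ler_peMl // ler1n.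
  rewrite exprS mulrA ler_wpM2l ?mulr_ge0 //.
  have l2 : 0 <= 2 * l by apply: mulr_ge0.
  by apply: lerXn2r => //; rewrite nnegrE.
have := dboundM (mulr_ge0 A0 d0) (mulr_ge0 r0 r0) (mulr_ge0 (ler0n _ 2) l_ge0) dx yy.
rewrite -lE => H j i jm ir.
have ir1 : (i.+1 <= r.+1)%N by rewrite ltnS (leq_trans _ ir) // leq_addr.
have -> : nrm (iter j dif (dif (fun i => (x i)^-1)) i) =
          nrm (iter j dif (fun i => dif x i * ((x i)^-1 * (x i.+1)^-1)) i).
  (* The identity between the sequences needs nonzero values, known only inside the window, so
     [eq_dif] does not apply and the induction carries the bound on [i']. *)
  have E : forall i', (i' + j <= r)%N -> iter j dif (dif (fun i => (x i)^-1)) i' =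
      - iter j dif (fun i => dif x i * ((x i)^-1 * (x i.+1)^-1)) i'.
    elim: (j) => [|j' IHj] i' i'r.
      rewrite addn0 in i'r; rewrite /= /dif.
      by field; rewrite !x0 // ltnW.
    rewrite /= {1}/dif !IHj; first by rewrite /dif; ring.
    - by rewrite (leq_trans _ i'r) // addnS.
    - by rewrite (leq_trans _ i'r) // addSnnS.
  by rewrite E // nrmN.
apply: le_trans (H j i jm ir) _.
rewrite ler_wpM2r ?exprn_ge0 ?mulr_ge0 ?exprn_ge0 //; try lra.
have -> : A * delta * (2 / rho * (2 / rho)) = 2 / rho * l0 by rewrite /l0; ring.
rewrite ler_wpM2l //; apply: le_trans l0l _; rewrite lE; lra.
Qed.

Lemma dbound_exp m r B l x a : 0 <= B -> 0 <= l -> dbound m r B l x ->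
  dbound m r (B ^+ a) (2 ^+ a * l) (fun i => x i ^+ a).
Proof.
move=> B0 l0 xB; elim: a => [|a IH].
  move=> [|j] i _ _; first by rewrite /= !expr0 mulr1 nrm1.
  have -> : iter j.+1 dif (fun i => x i ^+ 0) i = 0.
    by rewrite iterSr; elim: j i => [|j IH] i; rewrite /= /dif ?expr0 ?subrr // !IH subrr.
  by rewrite nrm0 mulr_ge0 ?expr0 // mul1r exprn_ge0.
have h2 : 1 <= 2 ^+ a :> R by rewrite exprn_ege1 //; lra.
have l2 : 0 <= 2 ^+ a * l by nra.
have xB' : dbound m r B (2 ^+ a * l) x.
  by apply: dbound_le xB => //; rewrite ler_peMl.
have := dboundM B0 (exprn_ge0 a B0) l2 xB' IH.
rewrite -exprS mulrA -exprS; apply: dbound_ext => i; by rewrite -exprS.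
Qed.

Lemma nrm_dif_le j M x i : (forall k, (k <= i + j)%N -> nrm (x k) <= M) ->
  nrm (iter j dif x i) <= 2 ^+ j * M.
Proof.
elim: j i => [|j IH] i xM; first by rewrite expr0 mul1r xM // addn0.
rewrite /= {1}/dif; apply: le_trans (nrmD _ _) _; rewrite nrmN exprS.
have h1 : nrm (iter j dif x i.+1) <= 2 ^+ j * M.
  by apply: IH => k kj; apply: xM; rewrite addnS -addSn.
have h2 : nrm (iter j dif x i) <= 2 ^+ j * M.
  by apply: IH => k kj; apply: xM; rewrite addnS leqW.
lra.
Qed.

(** Let rho be |g| at the first point. If rho = O(delta), then |g| = O(delta) at all r+1 points,
    each value of u^(r+1)/g is O(delta^r), and the difference costs a factor 2^r ([K1]). Otherwise
    |g| stays comparable to rho, u is O(rho) with scale delta/rho, and the product bound rho^(r+1)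
    rho^-1 (delta/rho)^r is delta^r: the powers of rho cancel ([K2]). *)
Lemma quotient_diff (r : nat) (A C : R) : 1 <= A -> 0 <= C ->
  exists2 K, 0 <= K & forall (u g : nat -> F) (delta : R), 0 <= delta ->
  (forall j i, nrm (iter j dif u i) <= A * delta ^+ j) ->
  (forall j i, nrm (iter j dif g i) <= A * delta ^+ j) ->
  (forall i, nrm (u i) <= C * nrm (g i)) ->
  nrm (iter r dif (fun i => u i ^+ r.+1 / g i) 0%N) <= K * delta ^+ r.
Proof.
move=> A1 C0; have A0 : 0 <= A by lra.
pose K1 := 2 ^+ r * (C ^+ r.+1 * (3 * r%:R * A) ^+ r).
pose K2 := 2 * (2 * C + 1) ^+ r.+1 * (4 * 8 ^+ r.+1 * A) ^+ r.
have r0 : 0 <= r%:R :> R by rewrite ler0n.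
have K10 : 0 <= K1 by rewrite !mulr_ge0 ?exprn_ge0 // ?mulr_ge0 //; lra.
have K20 : 0 <= K2 by rewrite !mulr_ge0 ?exprn_ge0 // ?mulr_ge0 ?exprn_ge0 //; lra.
exists (K1 + K2); first exact: addr_ge0.
move=> u g delta d0 uA gA ug.
pose rho := nrm (g 0%N).
have gg i : nrm (g i - g 0%N) <= i%:R * (A * delta).
  elim: i => [|i IH]; first by rewrite subrr nrm0 mul0r.
  have -> : g i.+1 - g 0%N = (g i.+1 - g i) + (g i - g 0%N) by ring.
  apply: le_trans (nrmD _ _) _; have := gA 1%N i; rewrite expr1 /= /dif -natr1; lra.
have dr0 : 0 <= delta ^+ r by rewrite exprn_ge0.
have [rhos|rhol] := leP rho (2 * r%:R * A * delta).
  apply: (@le_trans _ _ (K1 * delta ^+ r)); last by rewrite ler_wpM2r //; lra.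
  rewrite /K1 -!mulrA -exprMn; apply: nrm_dif_le => i; rewrite add0n => ir.
  have gi : nrm (g i) <= 3 * r%:R * A * delta.
    have -> : g i = (g i - g 0%N) + g 0%N by ring.
    apply: le_trans (nrmD _ _) _; have := gg i.
    have : i%:R * (A * delta) <= r%:R * (A * delta) by rewrite ler_wpM2r ?mulr_ge0 // ler_nat.
    rewrite -/rho; lra.
  apply: (@le_trans _ _ (C ^+ r.+1 * nrm (g i) ^+ r)).
    rewrite nrmM nrmX nrmV; have [g0|g0] := eqVneq (nrm (g i)) 0.
      by rewrite g0 invr0 mulr0 mulr_ge0 ?exprn_ge0.
    rewrite ler_pdivrMr ?lt_def ?g0 //= -mulrA -exprSr -exprMn.
    by rewrite lerXn2r ?nnegrE ?mulr_ge0.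
  rewrite ler_wpM2l ?exprn_ge0 // lerXn2r ?nnegrE //; last by rewrite !mulrA.
  by rewrite !mulr_ge0 //; lra.
apply: (@le_trans _ _ (K2 * delta ^+ r)); last by rewrite ler_wpM2r //; lra.
have rho0 : 0 < rho by apply: le_lt_trans rhol; rewrite !mulr_ge0 //; lra.
have rhoA : rho <= A by have := gA 0%N 0%N; rewrite expr0 mulr1.
have gi i : (i <= r)%N -> rho / 2 <= nrm (g i) <= 3 / 2 * rho.
  move=> ir; have := gg i.
  have h1 : i%:R * (A * delta) <= r%:R * (A * delta) by rewrite ler_wpM2r ?mulr_ge0 // ler_nat.
  have h2 : nrm (g i) <= nrm (g i - g 0%N) + rho.
    by have -> : g i = (g i - g 0%N) + g 0%N by [ring]; rewrite [in leRHS]addrK nrmD.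
  have h3 : rho <= nrm (g i - g 0%N) + nrm (g i).
    rewrite -[nrm (g i - _)]nrmN opprB /rho.
    have {1}-> : g 0%N = (g 0%N - g i) + g i by ring.
    exact: nrmD.
  by move=> h4; apply/andP; split; lra.
set l0 := 2 * A * delta / rho.
have l00 : 0 <= l0 by rewrite divr_ge0 ?mulr_ge0 // ltW.
have dl0 : delta <= l0 by rewrite ler_pdivlMr //; nra.
have Al0 : 2 * (A * delta) = rho * l0 by rewrite /l0; field; rewrite gt_eqF.
(* Domination gives [u] the size [rho]; the differences of order at least 1 fit because [rho * l0]
   is [2 * (A * delta)]. *)
have uB : dbound r r ((2 * C + 1) * rho) l0 u.
  move=> [|j] i jr ir.
    rewrite expr0 mulr1 /=; rewrite addn0 in ir; apply: le_trans (ug i) _.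
    have /andP[_ h] := gi i ir; have : C * nrm (g i) <= C * (3 / 2 * rho) by rewrite ler_wpM2l.
    have : 0 <= C * rho by rewrite mulr_ge0 // ltW.
    lra.
  apply: le_trans (uA _ _) _; rewrite exprS mulrA.
  rewrite [leRHS](_ : _ = ((2 * C + 1) * (rho * l0)) * l0 ^+ j); last by rewrite exprS; ring.
  apply: ler_pM; rewrite ?mulr_ge0 ?exprn_ge0 //.
    have : 0 <= A * delta by rewrite mulr_ge0.
    by move=> h; rewrite -Al0; nra.
  by rewrite lerXn2r ?nnegrE.
have rhoge : 0 <= (2 * C + 1) * rho by rewrite mulr_ge0 ?(ltW rho0) //; lra.
have e28 : 2 ^+ r.+1 <= 8 ^+ r.+1 :> R by rewrite lerXn2r ?nnegrE //; lra.
have e48 : 4 ^+ r <= 8 ^+ r.+1 :> R.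
  rewrite exprS; have : 4 ^+ r <= 8 ^+ r :> R by rewrite lerXn2r ?nnegrE //; lra.
  by have : 0 <= 8 ^+ r :> R by [rewrite exprn_ge0]; lra.
(* A common scale, above both the factor [2 ^+ r.+1] lost by the power and the factor [4 ^+ r] lost
   by the inverse. *)
set l := 8 ^+ r.+1 * l0.
have l_ge0 : 0 <= l by rewrite mulr_ge0 ?exprn_ge0.
have uX : dbound r r (((2 * C + 1) * rho) ^+ r.+1) l (fun i => u i ^+ r.+1).
  apply: dbound_le (dbound_exp r.+1 rhoge l00 uB) => //; first exact: exprn_ge0.
    by rewrite mulr_ge0 ?exprn_ge0.
  by rewrite /l ler_wpM2r.
have r2 : 0 <= 2 / rho by rewrite divr_ge0 // ltW.
have gV : dbound r r (2 / rho) l (fun i => (g i)^-1).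
  have rho2A : rho <= 2 * A by lra.
  have rhog i : (i <= r)%N -> rho / 2 <= nrm (g i) by move=> /gi/andP[].
  have h := @dbound_inv r A delta rho g A0 d0 rho0 rho2A gA rhog r.
  apply: dbound_le h => //; first by rewrite mulr_ge0 ?exprn_ge0.
  by rewrite /l ler_wpM2r.
have /(_ r 0%N (leqnn _) (leqnn _)) := dboundM (exprn_ge0 r.+1 rhoge) r2 l_ge0 uX gV.
move/le_trans; apply.
rewrite le_eqVlt; apply/orP; left; apply/eqP.
have rn0 : rho != 0 by rewrite gt_eqF.
rewrite /K2 /l /l0 !exprMn exprS [rho ^+ r.+1]exprS exprVn.
have rn : rho ^+ r != 0 by rewrite expf_neq0.
have -> : 4 ^+ r = 2 ^+ r * 2 ^+ r :> R by rewrite -exprMn; congr (_ ^+ _); ring.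
by field; rewrite rn0 rn.
Qed.

End Differences.

(** * Trigonometric estimates and the unit circle *)

Section Trigo.
Variable R : realType.
Implicit Types x y : R.

Lemma sin_pMVT y : 0 < y -> exists2 c, 0 < c < y & sin y = cos c * y.
Proof.
move=> y0; have [|c] := @MVT R sin cos 0 y y0 (fun x _ => is_derive_sin x).
  by apply: continuous_subspaceT => x; exact: continuous_sin.
by rewrite in_itv /= sin0 !subr0 => cy ->; exists c.
Qed.

Lemma cos_pMVT y : 0 < y -> exists2 c, 0 < c < y & cos y - 1 = - sin c * y.
Proof.
move=> y0; have [|c] := @MVT R cos (fun x => - sin x) 0 y y0 (fun x _ => is_derive_cos x).
  by apply: continuous_subspaceT => x; exact: continuous_cos.
by rewrite in_itv /= cos0 subr0 => cy ->; exists c.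
Qed.

Lemma sin_norm_le y : `|sin y| <= `|y|.
Proof.
wlog y0 : y / 0 < y.
  move=> H; have [->|y0] := eqVneq y 0; first by rewrite sin0 normr0.
  have [/H//|yn] := ltP 0 y; rewrite -(normrN y) -(normrN (sin y)) -sinN; apply: H.
  by rewrite oppr_gt0 lt_def eq_sym y0.
have [c _ ->] := sin_pMVT y0; rewrite normrM ler_piMl //.
by rewrite cos_max.
Qed.

Lemma cosB1_norm_le y : `|cos y - 1| <= `|y|.
Proof.
wlog y0 : y / 0 < y.
  move=> H; have [->|y0] := eqVneq y 0; first by rewrite cos0 subrr normr0.
  have [/H//|yn] := ltP 0 y; rewrite -(normrN y) -cosN; apply: H.
  by rewrite oppr_gt0 lt_def eq_sym y0.
have [c _ ->] := cos_pMVT y0; rewrite normrM normrN ler_piMl //.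
by rewrite sin_max.
Qed.

Lemma cosB1_norm_le2 y : `|cos y - 1| <= y ^+ 2.
Proof.
wlog y0 : y / 0 < y.
  move=> H; have [->|y0] := eqVneq y 0; first by rewrite cos0 subrr normr0 expr0n.
  have [/H//|yn] := ltP 0 y; rewrite -sqrrN -cosN; apply: H.
  by rewrite oppr_gt0 lt_def eq_sym y0.
have [c /andP[c0 cy] ->] := cos_pMVT y0; rewrite normrM normrN expr2.
apply: ler_pM => //; last by rewrite gtr0_norm.
by apply: le_trans (sin_norm_le c) _; rewrite gtr0_norm // ltW.
Qed.

Lemma sinBid_norm_le2 y : `|sin y - y| <= y ^+ 2.
Proof.
wlog y0 : y / 0 < y.
  move=> H; have [->|y0] := eqVneq y 0; first by rewrite sin0 subrr normr0 expr0n.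
  have [/H//|yn] := ltP 0 y; 
  have -> : sin y - y = - (sin (- y) - - y) by rewrite sinN; ring.
  rewrite normrN -sqrrN; apply: H.
  by rewrite oppr_gt0 lt_def eq_sym y0.
have [c /andP[c0 cy] ->] := sin_pMVT y0.
rewrite -[X in _ - X]mul1r -mulrBl normrM expr2.
apply: ler_pM => //; last by rewrite gtr0_norm.
by apply: le_trans (cosB1_norm_le c) _; rewrite gtr0_norm // ltW.
Qed.

(** Jordan's inequality with a cruder constant: up to 1 the mean value theorem gives the slope cos
    1, and beyond 1 the sine is at least sin 1 while y is less than 2. *)
Lemma sin_lower : exists2 k : R, 0 < k & forall y, 0 <= y <= pi / 2 -> k * y <= sin y.
Proof.
have s1 : 0 < sin (1 : R) by apply: sin2_gt0; lra.
have c1 := @cos1_gt0 R.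
have pi1 := @pihalf_ge1 R; have pi2 := @pihalf_lt2 R.
exists (Num.min (cos 1) (sin 1 / 2)); first by rewrite lt_min c1 divr_gt0.
move=> y /andP[y0 ypi].
have [->|yn0] := eqVneq y 0; first by rewrite sin0 mulr0.
have {}y0 : 0 < y by rewrite lt_def yn0.
have [y1|y1] := leP y 1.
  have [c /andP[c0 cy] ->] := sin_pMVT y0; rewrite ler_pM2r //.
  rewrite ge_min; apply/orP; left; rewrite ltW // ltr_cos ?in_itv /=; lra.
apply: (@le_trans _ _ (sin 1 / 2 * 2)).
  apply: ler_pM => //; last 1 first.
  - lra.
  - by rewrite le_min !ltW // divr_gt0.
  - exact: ltW.
  - by rewrite ge_min lexx orbT.
rewrite divfK // ltW // ltr_sin ?in_itv /= //; lra.
Qed.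

End Trigo.

Section Exponential.
Variable R : realType.
Local Notation C := R[i].
Local Notation e := (@expi2pi R).
Implicit Types x y : R.

Lemma expi2piD x y : e (x + y) = e x * e y.
Proof.
rewrite /expi2pi mulrDr cosD sinD; simpc; congr (_ +i* _)%C; ring.
Qed.

Lemma expi2pi0 : e 0 = 1.
Proof. by rewrite /expi2pi mulr0 cos0 sin0. Qed.

Lemma expi2pi1 : e 1 = 1.
Proof. by rewrite /expi2pi mulr1 mulr_natl cos2pi sin2pi. Qed.

Lemma normc_expi2pi x : normc (e x) = 1.
Proof. by rewrite /= cos2Dsin2 sqrtr1. Qed.

Lemma expi2pi_neq0 x : e x != 0.
Proof.
by apply/eqP => ex; have := normc_expi2pi x; rewrite ex normc0 => /eqP; rewrite eq_sym oner_eq0.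
Qed.

Lemma expi2piN x : e (- x) = (e x)^-1.
Proof.
by apply: (mulIf (expi2pi_neq0 x)); rewrite mulVf ?expi2pi_neq0 // -expi2piD addNr expi2pi0.
Qed.

Lemma expi2pi_conj x : (e x)^*%C = e (- x).
Proof. by rewrite /expi2pi mulrN cosN sinN. Qed.

Lemma expi2piMn x n : e (x *+ n) = e x ^+ n.
Proof.
elim: n => [|n IH]; first by rewrite mulr0n expi2pi0 expr0.
by rewrite mulrS expi2piD IH exprS.
Qed.

Lemma expi2piMz x (n : int) : e (n%:~R * x) = e x ^ n.
Proof.
case: n => n; first by rewrite -exprnP -expi2piMn -mulr_natl pmulrn.
rewrite NegzE -exprnN mulrNz mulNr expi2piN; congr (_^-1).
by rewrite -expi2piMn -mulr_natl pmulrn.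
Qed.

Lemma expi2pi_int (n : int) : e n%:~R = 1.
Proof. by rewrite -[n%:~R]mulr1 expi2piMz expi2pi1 exp1rz. Qed.

Lemma normc_expi2piB1 x : normc (e x - 1) = 2 * `|sin (pi * x)|.
Proof.
have -> : e x - 1 = ((- 2 * sin (pi * x) ^+ 2) +i* (2 * (sin (pi * x) * cos (pi * x))))%C.
  have -> : e x = (cos ((pi * x) *+ 2) +i* sin ((pi * x) *+ 2))%C.
    by rewrite /expi2pi -[(pi * x) *+ 2]mulr_natl mulrA.
  rewrite cos_mulr2n sin_mulr2n cos2sin2; simpc; congr (_ +i* _)%C; ring.
rewrite /=; set s := sin _; set c := cos _.
have -> : (- 2 * s ^+ 2) ^+ 2 + (2 * (s * c)) ^+ 2 = (2 * s) ^+ 2.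
  have c2 : c ^+ 2 = 1 - s ^+ 2 :> R by rewrite cos2sin2.
  by transitivity (4 * s ^+ 4 + 4 * s ^+ 2 * c ^+ 2); [ring | rewrite c2; ring].
by rewrite sqrtr_sqr normrM ger0_norm.
Qed.

Lemma expi2piB1_neq0 x : 0 < x < 1 -> e x != 1.
Proof.
move=> /andP[x0 x1]; rewrite -subr_eq0; apply/eqP => h.
have := normc_expi2piB1 x; rewrite h normc0.
have : 0 < sin (pi * x).
  apply: sin_gt0_pi; rewrite mulr_gt0 ?pi_gt0 //= -[ltRHS]mulr1 ltr_pM2l //.
  exact: pi_gt0.
by move=> s0; rewrite gtr0_norm //; lra.
Qed.

(** The chord from 1 to w^n is at least a fixed multiple of |n| times the chord from 1 to w, as long
    as n covers at most half a turn. This converts bounds on differences into decay in n, uniformly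
    in N. *)
Lemma expi2pi_ratio : exists2 k : R, 0 < k & forall (N : nat) (n : int), (0 < N)%N ->
  (2 * `|n| <= N)%N ->
  k * `|n|%N%:R * normc (e N%:R^-1 - 1) <= normc (e N%:R^-1 ^ n - 1).
Proof.
have [k k0 kP] := sin_lower R; exists k => // N n N0 nN.
have Nr : 0 < N%:R :> R by rewrite ltr0n.
have Nn : (`|n|%N%:R / N%:R) <= 1 / 2 :> R.
  by rewrite ler_pdivrMr // mulrC mulrA mulr1 ler_pdivlMr // mulrC -natrM ler_nat.
have pi0 := pi_gt0 R.
rewrite -expi2piMz !normc_expi2piB1.
have -> : `|sin (pi * (n%:~R / N%:R))| = `|sin (pi * (`|n|%N%:R / N%:R))| :> R.
  have [n0|n0] := leP 0 n; first by rewrite -{1}[n]gez0_abs.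
  have -> : n%:~R = - (`|n|%N%:R) :> R by rewrite pmulrn -mulrNz ltz0_abs // opprK.
  by rewrite mulNr mulrN sinN normrN.
have q0 : 0 <= `|n|%N%:R / N%:R :> R by rewrite divr_ge0.
have h1 : `|sin (pi / N%:R)| <= pi / N%:R :> R.
  by apply: le_trans (sin_norm_le _) _; rewrite ger0_norm // divr_ge0 // ltW.
have h2 : k * (pi * (`|n|%N%:R / N%:R)) <= sin (pi * (`|n|%N%:R / N%:R)).
  by apply: kP; rewrite mulr_ge0 ?(ltW pi0) //=; apply: ler_wpM2l; [exact: ltW|lra].
apply: (@le_trans _ _ (2 * sin (pi * (`|n|%N%:R / N%:R)))); last first.
  by rewrite ler_wpM2l // ler_norm.
apply: (@le_trans _ _ (2 * (k * (pi * (`|n|%N%:R / N%:R))))); last by rewrite ler_wpM2l.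
rewrite [leLHS](_ : _ = (2 * (k * `|n|%N%:R)) * `|sin (pi / N%:R)|); last by ring.
rewrite [leRHS](_ : _ = (2 * (k * `|n|%N%:R)) * (pi / N%:R)); last by ring.
by apply: ler_wpM2l => //; rewrite mulr_ge0 // mulr_ge0 // ltW.
Qed.

Lemma expi2pi_taylor x :
  normc (e x - 1 - (0 +i* (2 * pi * x))%C) <= 2 * (2 * pi * x) ^+ 2.
Proof.
rewrite /expi2pi; set y := 2 * pi * x.
have -> : ((cos y +i* sin y) - 1 - (0 +i* y))%C = ((cos y - 1) +i* (sin y - y))%C.
  by simpc; congr (_ +i* _)%C; ring.
have h1 := cosB1_norm_le2 y; have h2 := sinBid_norm_le2 y.
have -> : 2 * y ^+ 2 = Num.sqrt ((2 * y ^+ 2) ^+ 2).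
  by rewrite sqrtr_sqr ger0_norm // mulr_ge0 ?sqr_ge0.
apply: ler_wsqrtr.
have : (cos y - 1) ^+ 2 <= (y ^+ 2) ^+ 2 by rewrite -[leLHS]real_normK ?num_real // lerXn2r ?nnegrE ?sqr_ge0.
have : (sin y - y) ^+ 2 <= (y ^+ 2) ^+ 2 by rewrite -[leLHS]real_normK ?num_real // lerXn2r ?nnegrE ?sqr_ge0.
have : 0 <= (y ^+ 2) ^+ 2 by rewrite sqr_ge0.
rewrite [(2 * _) ^+ 2]exprMn; lra.
Qed.

Lemma normcB_expi2pi x : normc (e x - 1) <= 2 * pi * `|x|.
Proof.
rewrite normc_expi2piB1 -mulrA ler_wpM2l //; apply: le_trans (sin_norm_le _) _.
by rewrite normrM ger0_norm // pi_ge0.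
Qed.

Lemma normc_Re_le (z : C) : `|complex.Re z| <= normc z.
Proof.
case: z => a b /=; rewrite -sqrtr_sqr; apply: ler_wsqrtr.
by rewrite lerDl sqr_ge0.
Qed.

Lemma normc_int (n : int) : normc (n%:~R : C) = `|n|%N%:R.
Proof.
have -> : (n%:~R : C) = ((n%:~R : R)%:C)%C by rewrite rmorph_int.
by rewrite /= expr0n /= addr0 sqrtr_sqr -intr_norm -abszE pmulrn.
Qed.

End Exponential.

(** * Values on the torus *)

Lemma chi_scale (A : fieldType) d (y z : 'I_d -> A) i a n :
  (forall j, z j = if j == i then a * y j else y j) -> chi z n = a ^ n 0 i * chi y n.
Proof.
move=> zE; have E j : z j ^ n 0 j = (if j == i then a ^ n 0 i else 1) * y j ^ n 0 j.
  by rewrite zE; case: eqP => [->|_]; rewrite ?expfzMl ?mul1r.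
rewrite /chi (eq_bigr _ (fun j _ => E j)) big_split /=; congr (_ * _).
by rewrite (bigD1 i) //= eqxx big1 ?mulr1 // => j /negbTE ->.
Qed.

Section NormC.
Variable R : realType.
Local Notation C := R[i].

Lemma normc_ge0 (z : C) : 0 <= normc z.
Proof. by case: z => a b; exact: sqrtr_ge0. Qed.

Lemma normcD (x y : C) : normc (x + y) <= normc x + normc y.
Proof. exact: le_normcD. Qed.

Lemma normc_sum (I : Type) (r : seq I) (P : pred I) (f : I -> C) :
  normc (\sum_(i <- r | P i) f i) <= \sum_(i <- r | P i) normc (f i).
Proof. exact: (nrm_sum (@normc0 R) normcD). Qed.

Lemma normcXn (x : C) n : normc (x ^+ n) = normc x ^+ n.
Proof. exact: (nrmX (@normc1 R) (@normcM R)). Qed.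

Lemma normcB (x y : C) : normc (x - y) = normc (y - x).
Proof. by rewrite -(@normcN R (y - x)) opprB. Qed.

Lemma normc_exprz (x : C) (n : int) : normc x = 1 -> normc (x ^ n) = 1.
Proof.
move=> x1; case: n => n; first by rewrite -exprnP normcXn x1 expr1n.
by rewrite NegzE -exprnN normcV normcXn x1 expr1n invr1.
Qed.

Lemma normc_exprzB1 (x : C) (n : int) : normc x = 1 ->
  normc (x ^ n - 1) <= `|n|%N%:R * normc (x - 1).
Proof.
move=> x1; have x0 : x != 0.
  by apply/eqP => h; move: x1; rewrite h normc0 => /eqP; rewrite eq_sym oner_eq0.
have natc (m : nat) : normc (x ^+ m - 1) <= m%:R * normc (x - 1).
  elim: m => [|m IH]; first by rewrite subrr normc0 mul0r.
  have -> : x ^+ m.+1 - 1 = x * (x ^+ m - 1) + (x - 1) by rewrite exprS; ring.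
  apply: le_trans (normcD _ _) _; rewrite normcM x1 mul1r -natr1; lra.
case: n => n; first exact: natc.
rewrite NegzE -exprnN; have -> : x ^- n.+1 - 1 = - (x ^- n.+1 * (x ^+ n.+1 - 1)).
  by rewrite mulrBr mulVf ?expf_neq0 // mulr1 opprB.
by rewrite normcN normcM normcV normcXn x1 expr1n invr1 mul1r; exact: natc.
Qed.

Lemma normc_chi d (z : 'I_d -> C) n : (forall i, normc (z i) = 1) -> normc (chi z n) = 1.
Proof.
move=> z1; rewrite /chi; elim/big_rec: _ => [|i x _ IH]; first by rewrite normc1.
by rewrite normcM IH mulr1 normc_exprz.
Qed.

Definition lnorm1 d (f : laurent d) : R := \sum_(n <- lsupp f) `|lcoef f n|%N%:R.

Lemma lnorm1_ge0 d (f : laurent d) : 0 <= lnorm1 f.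
Proof. by apply: sumr_ge0 => n _. Qed.

Lemma normc_lsum d (f : laurent d) (phi : 'rV[int]_d -> C) M :
  (forall n, n \in lsupp f -> normc (phi n) <= M) -> normc (lsum phi f) <= lnorm1 f * M.
Proof.
move=> pM; apply: le_trans (normc_sum _ _ _) _.
rewrite mulr_suml big_seq [leRHS]big_seq; apply: ler_sum => n nf.
by rewrite normcM normc_int ler_wpM2l // pM.
Qed.

Lemma leval_chi d (f : laurent d) (z : 'I_d -> C) : leval f z = lsum (chi z) f.
Proof. by []. Qed.

Lemma leval_rmorph d (z : 'I_d -> C) : (forall i, z i != 0) ->
  exists h : {rmorphism laurent d -> C}, forall f, h f = leval f z.
Proof. by move=> z0; exact: (lsum_rmorph (chi0 z) (chiD z0)). Qed.

End NormC.

Lemma Znorm_ge d (n : 'rV[int]_d) i : (`|n 0%R i| <= Znorm n)%N.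
Proof. exact: (leq_bigmax (F := fun i => `|n 0%R i|%N)). Qed.

Lemma Znorm_le d (n : 'rV[int]_d) M : (forall i, (`|n 0%R i| <= M)%N) -> (Znorm n <= M)%N.
Proof. by move=> h; apply/bigmax_leqP => i _; exact: h. Qed.

Lemma ZnormD d (n m : 'rV[int]_d) : (Znorm (n + m) <= Znorm n + Znorm m)%N.
Proof.
apply: Znorm_le => i; rewrite mxE; move: (n 0 i) (m 0 i) (Znorm n) (Znorm m) (Znorm_ge n i) (Znorm_ge m i) => a b u v; lia.
Qed.

Lemma ZnormN d (n : 'rV[int]_d) : Znorm (- n) = Znorm n.
Proof. by apply: eq_bigr => i _; rewrite mxE abszN. Qed.

Lemma Znorm_attained d (n : 'rV[int]_d) : (0 < Znorm n)%N -> exists i, Znorm n = `|n 0%R i|%N.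
Proof.
move=> n0; have d0 : (0 < d)%N.
  by case: d n n0 => // n; rewrite /Znorm big_ord0.
have := @bigop.bigmax_eq_arg _ (Ordinal d0) xpredT (fun i => `|n 0%R i|%N) isT => h.
by eexists; exact: h.
Qed.

Lemma lsupp_bounded d (f : laurent d) : exists D, forall n, lcoef f n != 0 -> (Znorm n <= D)%N.
Proof.
exists (\max_(n <- lsupp f) Znorm n) => n fn.
by rewrite leq_bigmax_seq // mem_lsupp.
Qed.

Section Grid.
Variables (R : realType) (d : nat) (M : nat).
Local Notation C := R[i].
Local Notation Zd := 'rV[int]_d.
Local Notation N := (M.*2.+1).
Local Notation grid := {ffun 'I_d -> 'I_N}.
Let w : C := expi2pi (N%:R^-1 : R).
Implicit Types (x : grid) (n m : Zd).

Definition gridpt x (i : 'I_d) : C := expi2pi ((x i)%:R / N%:R : R).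

Lemma gridptE x i : gridpt x i = w ^+ x i.
Proof. by rewrite /gridpt mulr_natl expi2piMn. Qed.

Lemma normc_gridpt x i : normc (gridpt x i) = 1.
Proof. exact: normc_expi2pi. Qed.

Lemma gridpt_neq0 x i : gridpt x i != 0.
Proof. exact: expi2pi_neq0. Qed.

Lemma root_expN : w ^+ N = 1.
Proof. by rewrite -expi2piMn -[N%:R^-1 *+ N]mulr_natl divff ?pnatr_eq0 // expi2pi1. Qed.

Lemma root_expz_neq1 (k : int) : k != 0 -> (`|k| <= M.*2)%N -> w ^ k != 1.
Proof.
move=> k0 kM.
have natc (l : nat) : (0 < l)%N -> (l <= M.*2)%N -> w ^+ l != 1.
  move=> l0 lM; rewrite -expi2piMn -[N%:R^-1 *+ l]mulr_natl; apply: expi2piB1_neq0.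
  by rewrite divr_gt0 ?ltr0n //= ltr_pdivrMr ?ltr0n // mul1r ltr_nat ltnS.
case: k k0 kM => k k0 kM; first by apply: natc => //; rewrite lt0n.
by rewrite NegzE -exprnN -invr1 (inj_eq invr_inj); apply: natc.
Qed.

(** Orthogonality of characters. Since w has odd order 2M+1, the bound 2M, reached by differences of
    exponents of norm at most M, excludes nonzero multiples of the order. *)
Lemma sum_chi m : (forall i, (`|m 0%R i| <= M.*2)%N) ->
  \sum_x chi (gridpt x) m = if m == 0 then (N ^ d)%:R else 0.
Proof.
move=> mM.
have -> : \sum_x chi (gridpt x) m = \prod_(i < d) \sum_(j < N) (w ^ m 0 i) ^+ j.
  rewrite bigA_distr_bigA; apply: eq_bigr => x _; apply: eq_bigr => i _.
  by rewrite gridptE exprnP exprz_exp mulrC -exprz_exp -exprnP.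
case: eqP => [->|/eqP m0].
  rewrite natrX; transitivity (\prod_(i < d) (N%:R : C)); last by rewrite prodr_const card_ord.
  apply: eq_bigr => i _; rewrite mxE expr0z (eq_bigr (fun=> 1)) => [|j _]; last by rewrite expr1n.
  by rewrite sumr_const card_ord.
have [i mi] : exists i, m 0 i != 0.
  apply/existsP; apply: contraR m0; rewrite negb_exists => /forallP h.
  by apply/eqP/rowP => i; rewrite mxE; apply/eqP; have := h i; rewrite negbK.
rewrite (bigD1 i) //=; suff -> : \sum_(j < N) (w ^ m 0 i) ^+ j = 0 by rewrite mul0r.
have := subrX1 (w ^ m 0 i) N.
rewrite exprnP exprz_exp mulrC -exprz_exp -exprnP root_expN exp1rz subrr => /esym/eqP.
by rewrite mulf_eq0 subr_eq0 (negbTE (root_expz_neq1 mi (mM i))) => /eqP.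
Qed.

Definition gshift (i : 'I_d) x : grid := [ffun j => if j == i then ordS (x j) else x j].

Lemma gshift_bij i : bijective (gshift i).
Proof.
apply: injF_bij => x y xy; apply/ffunP => j.
have := congr1 (fun f : grid => f j) xy; rewrite !ffunE; case: eqP => // _.
exact: ordS_inj.
Qed.

Lemma gridpt_shift i x k j :
  gridpt (iter k (gshift i) x) j = if j == i then w ^+ k * gridpt x j else gridpt x j.
Proof.
elim: k => [|k IH]; first by rewrite /= mul1r if_same.
rewrite iterS gridptE ffunE; case: eqP IH => [->|_] IH; last by rewrite -gridptE.
rewrite /= expr_mod ?root_expN // exprS -gridptE IH exprS mulrA.
by [].
Qed.

Lemma chi_shift i x k n :
  chi (gridpt (iter k (gshift i) x)) n = (w ^ n 0 i) ^+ k * chi (gridpt x) n.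
Proof.
rewrite (chi_scale (i := i) (a := w ^+ k) (y := gridpt x)); last first.
  by move=> j; rewrite gridpt_shift.
by rewrite [w ^+ k]exprnP [in RHS]exprnP !exprz_exp [k%:Z * _]mulrC.
Qed.

Lemma dif_leval (f : laurent d) i x j k :
  iter j (@dif C) (fun l => leval f (gridpt (iter l (gshift i) x))) k =
  lsum (fun n => chi (gridpt x) n * (w ^ n 0 i) ^+ k * (w ^ n 0 i - 1) ^+ j) f.
Proof.
elim: j k => [|j IH] k.
  rewrite /= leval_chi; apply: eq_bigr => n _.
  by rewrite chi_shift expr0 mulr1 [chi _ _ * _]mulrC.
rewrite iterS {1}/dif !IH -sumrB; apply: eq_bigr => n _; rewrite -mulrBr; congr (_ * _).
by rewrite !exprS; ring.
Qed.

Lemma dif_leval_bound (f : laurent d) (B : R) i x j k :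
  (forall n, n \in lsupp f -> `|n 0%R i|%N%:R <= B) ->
  normc (iter j (@dif C) (fun l => leval f (gridpt (iter l (gshift i) x))) k)
    <= lnorm1 R f * (B * normc (w - 1)) ^+ j.
Proof.
move=> fB; rewrite dif_leval; apply: normc_lsum => n nf.
have w1 : normc w = 1 by exact: normc_expi2pi.
rewrite !normcM normc_chi; last by move=> l; exact: normc_gridpt.
rewrite mul1r !normcXn normc_exprz // expr1n mul1r.
apply: lerXn2r; rewrite ?nnegrE ?normc_ge0 //.
  rewrite mulr_ge0 ?normc_ge0 //; apply: le_trans (fB n nf) => //.
apply: le_trans (normc_exprzB1 _ w1) _.
by apply: ler_wpM2r; [exact: normc_ge0 | exact: fB].
Qed.

Definition gdif i (F : grid -> C) x : C := F (gshift i x) - F x.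

Lemma gdifE i r F x : iter r (gdif i) F x = iter r (@dif C) (fun k => F (iter k (gshift i) x)) 0%N.
Proof.
have H k : iter r (gdif i) F (iter k (gshift i) x) =
           iter r (@dif C) (fun k => F (iter k (gshift i) x)) k.
  elim: r k => [//|r IH] k; rewrite !iterS /gdif /dif -!IH.
  by rewrite iterS.
exact: (H 0%N).
Qed.

(** Summation by parts, without boundary terms since the shift is a bijection of the cyclic grid. *)
Lemma sum_gdif i r F n :
  \sum_x iter r (gdif i) F x * chi (gridpt x) (- n) =
  (w ^ n 0 i - 1) ^+ r * \sum_x F x * chi (gridpt x) (- n).
Proof.
elim: r => [|r IH]; first by rewrite expr0 mul1r.
rewrite exprS -mulrA -IH; set G := iter r (gdif i) F.
rewrite iterS -/G mulrBl mul1r.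
have -> : w ^ n 0 i * \sum_x G x * chi (gridpt x) (- n) =
          \sum_x G (gshift i x) * chi (gridpt x) (- n).
  rewrite (reindex_onto (gshift i) (invF (bij_inj (gshift_bij i)))) /=; last by move=> x _; exact: f_invF.
  rewrite mulr_sumr; apply: eq_big => [x|x _]; first by rewrite invF_f eqxx.
  rewrite mulrCA; congr (_ * _); have := chi_shift i x 1 (- n); rewrite /= expr1 => ->.
  rewrite mulrA mxE -expfzDr ?subrr ?expr0z ?mul1r //.
  exact: expi2pi_neq0.
by rewrite -sumrB; apply: eq_bigr => x _; rewrite -mulrBl.
Qed.

End Grid.

(** * Approximate inverses *)

Lemma normc_nat (R : realType) (n : nat) : normc (n%:R : R[i]) = n%:R.
Proof. exact: (normc_int R (Posz n)). Qed.

Section ApproximateInverse.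
Variables (R : realType) (d : nat) (g u : laurent d) (r : nat) (C0 : R).
Hypothesis C0_ge0 : 0 <= C0.
Hypothesis r_gt0 : (0 < r)%N.
Hypothesis ug : forall t : 'I_d -> R,
  normc (leval u (fun i => expi2pi (t i))) <= C0 * normc (leval g (fun i => expi2pi (t i))).
Local Notation C := R[i].
Local Notation Zd := 'rV[int]_d.

(** At a zero of [g] the quotient is 0 by convention; this is the right value, as [ug] makes [u]
    vanish there too. *)
Let F M (x : {ffun 'I_d -> 'I_M.*2.+1}) : C :=
  leval u (gridpt R x) ^+ r.+1 / leval g (gridpt R x).

Let S M (n : Zd) : C := \sum_x F (M := M) x * chi (gridpt R x) (- n).

(** The transform [S M] is periodic of period 2M+1 in each coordinate; only the period centred at 0
    is kept. *)
Definition gridinv M (n : Zd) : C :=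
  if (Znorm n <= M)%N then ((M.*2.+1 ^ d)%:R)^-1 * S M n else 0.

Lemma leval_bound (f : laurent d) (z : 'I_d -> C) :
  (forall i, normc (z i) = 1) -> normc (leval f z) <= lnorm1 R f.
Proof.
move=> z1; rewrite -[leRHS]mulr1; apply: normc_lsum => n _.
by rewrite normc_chi.
Qed.

Lemma F_bound M x : normc (F (M := M) x) <= C0 * lnorm1 R u ^+ r.
Proof.
rewrite /F normcM normcXn normcV.
have ug' : normc (leval u (gridpt R x)) <= C0 * normc (leval g (gridpt R x)) := ug _.
have uA : normc (leval u (gridpt R x)) ^+ r <= lnorm1 R u ^+ r.
  apply: lerXn2r; rewrite ?nnegrE ?normc_ge0 ?lnorm1_ge0 //.
  by apply: leval_bound => i; exact: normc_gridpt.
have [g0|g0] := eqVneq (normc (leval g (gridpt R x))) 0.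
  by rewrite g0 invr0 mulr0 mulr_ge0 // exprn_ge0 // lnorm1_ge0.
have gp : 0 < normc (leval g (gridpt R x)) by rewrite lt_def g0 normc_ge0.
rewrite ler_pdivrMr // exprS mulrAC; apply: ler_pM => //.
- exact: normc_ge0.
- by rewrite exprn_ge0 // normc_ge0.
Qed.

Lemma S_bound M n : normc (S M n) <= (M.*2.+1 ^ d)%:R * (C0 * lnorm1 R u ^+ r).
Proof.
apply: le_trans (normc_sum _ _ _) _.
have <- : #|{: {ffun 'I_d -> 'I_M.*2.+1}}| = (M.*2.+1 ^ d)%N.
  by rewrite card_ffun !card_ord.
rewrite mulr_natl -sumr_const; apply: ler_sum => x _; rewrite normcM normc_chi.
  by rewrite mulr1; exact: F_bound.
by move=> i; exact: normc_gridpt.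
Qed.

Lemma S_diff_bound : exists2 K, 0 <= K & forall (M : nat) (n : Zd) (i : 'I_d), (0 < M)%N ->
  normc (expi2pi ((M.*2.+1)%:R^-1 : R) ^ n 0 i - 1) ^+ r * normc (S M n) <=
  (M.*2.+1 ^ d)%:R * (K * normc (expi2pi ((M.*2.+1)%:R^-1 : R) - 1) ^+ r).
Proof.
pose A := 1 + lnorm1 R u + lnorm1 R g.
have u0 := lnorm1_ge0 R u; have g0 := lnorm1_ge0 R g.
have A1 : 1 <= A by rewrite /A; lra.
have [Du DuP] := lsupp_bounded u; have [Dg DgP] := lsupp_bounded g.
pose B := (Du + Dg)%:R : R.
have [K K0 KP] := quotient_diff (@normc_ge0 R) (@normc0 R) (@normc1 R) (@eq0_normc R)
  (@normcD R) (@normcM R) r A1 C0_ge0.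
exists (K * B ^+ r); first by rewrite mulr_ge0 // exprn_ge0 // ler0n.
move=> M n i M0; set w := expi2pi _.
rewrite -normcXn -normcM -sum_gdif.
apply: le_trans (normc_sum _ _ _) _.
have <- : #|{: {ffun 'I_d -> 'I_M.*2.+1}}| = (M.*2.+1 ^ d)%N.
  by rewrite card_ffun !card_ord.
rewrite mulr_natl -sumr_const; apply: ler_sum => x _; rewrite normcM normc_chi; last first.
  by move=> j; exact: normc_gridpt.
rewrite mulr1 gdifE -mulrA -exprMn.
apply: KP => [|j k|j k|k].
- by rewrite mulr_ge0 ?normc_ge0 // ler0n.
- apply: le_trans (@dif_leval_bound R d M u B i x j k _) _.
    move=> l; rewrite mem_lsupp => /DuP lD; rewrite ler_nat.
    by rewrite (leq_trans (Znorm_ge l i)) // (leq_trans lD) // leq_addr.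
  by apply: ler_wpM2r; [rewrite exprn_ge0 // mulr_ge0 ?normc_ge0 ?ler0n | rewrite /A; lra].
- apply: le_trans (@dif_leval_bound R d M g B i x j k _) _.
    move=> l; rewrite mem_lsupp => /DgP lD; rewrite ler_nat.
    by rewrite (leq_trans (Znorm_ge l i)) // (leq_trans lD) // leq_addl.
  by apply: ler_wpM2r; [rewrite exprn_ge0 // mulr_ge0 ?normc_ge0 ?ler0n | rewrite /A; lra].
- exact: ug.
Qed.

(** Differences are taken along a coordinate that attains the norm of [n]. Both sides then carry the
    same power of the grid step |w - 1|, and cancelling it leaves a bound free of [M]. *)
Lemma gridinv_decay : exists2 K, 0 <= K & forall M n, (0 < M)%N ->
  normc (gridinv M n) * (Znorm n).+1%:R ^+ r <= K.
Proof.
have [K K0 KP] := S_diff_bound.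
have [k k0 kP] := expi2pi_ratio R.
pose K1 := C0 * lnorm1 R u ^+ r.
have K10 : 0 <= K1 by rewrite mulr_ge0 // exprn_ge0 // lnorm1_ge0.
(* The factor [2 ^+ r] passes from |n| to |n| + 1 when n is nonzero; [K1] covers n = 0. *)
pose K2 := 2 ^+ r * K / k ^+ r.
have K20 : 0 <= K2 by rewrite divr_ge0 ?mulr_ge0 ?exprn_ge0 // ltW.
exists (K1 + K2); first exact: addr_ge0.
move=> M n M0; rewrite /gridinv; case: ifPn => nM; last first.
  by rewrite normc0 mul0r addr_ge0.
have Nd0 : 0 < (M.*2.+1 ^ d)%:R :> R by rewrite ltr0n expn_gt0.
have -> : normc (((M.*2.+1 ^ d)%:R)^-1 * S M n) = normc (S M n) / (M.*2.+1 ^ d)%:R.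
  rewrite normcM normcV mulrC; congr (_ / _).
  exact: normc_nat.
rewrite mulrAC ler_pdivrMr // [leRHS]mulrC.
have [n0|n0] := posnP (Znorm n).
  rewrite n0 expr1n mulr1; apply: le_trans (S_bound M n) _.
  by apply: ler_wpM2l; [exact: ltW | rewrite -/K1; lra].
have [i ni] := Znorm_attained n0.
have := KP M n i M0; set w := expi2pi _ => KPi.
have nM2 : (2 * `|n 0%R i| <= M.*2.+1)%N by rewrite -ni; lia.
have := kP _ (n 0 i) (ltn0Sn M.*2) nM2; rewrite -/w -ni => ratio.
have d0 : 0 < normc (w - 1).
  rewrite lt_def normc_ge0 andbT; apply/eqP => /eq0_normc/eqP.
  rewrite subr_eq0; apply/negP; apply: expi2piB1_neq0.
  rewrite invr_gt0 ltr0n /= invf_lt1 ?ltr0n // ltr1n; lia.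
have h1 : (k * (Znorm n)%:R) ^+ r * normc (S M n) <= (M.*2.+1 ^ d)%:R * K.
  have dr : 0 < normc (w - 1) ^+ r by rewrite exprn_gt0.
  rewrite -(ler_pM2r dr) -[leRHS]mulrA; apply: le_trans KPi.
  rewrite mulrAC -exprMn; apply: ler_wpM2r; first exact: normc_ge0.
  apply: lerXn2r => //; rewrite nnegrE ?normc_ge0 //.
  by rewrite !mulr_ge0 ?normc_ge0 ?ler0n // ltW.
have kr : 0 < k ^+ r by rewrite exprn_gt0.
apply: (@le_trans _ _ ((M.*2.+1 ^ d)%:R * K2)); last first.
  by apply: ler_wpM2l; [exact: ltW | lra].
rewrite /K2 mulrA ler_pdivlMr // mulrCA -mulrA.
apply: (@le_trans _ _ (2 ^+ r * ((k * (Znorm n)%:R) ^+ r * normc (S M n)))); last first.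
  by rewrite ler_wpM2l // exprn_ge0.
rewrite exprMn [leRHS](_ : _ = normc (S M n) * ((2 * (Znorm n)%:R) ^+ r * k ^+ r)); last by rewrite exprMn; ring.
rewrite ler_wpM2l ?normc_ge0 // ler_wpM2r ?(ltW kr) //.
apply: lerXn2r; rewrite ?nnegrE ?mulr_ge0 ?ler0n //.
by rewrite -natrM ler_nat mul2n -addnn -addn1 leq_add2l.
Qed.

(** All [n - k] lie in the period that is kept, so the convolution is the transform of the product
    of h/g by g, and the support of h is too small for aliasing. *)
Lemma gridinv_exact M D n : (forall k, lcoef g k != 0 -> (Znorm k <= D)%N) ->
  (forall k, lcoef (u ^+ r.+1) k != 0 -> (Znorm k <= M)%N) -> (Znorm n + D <= M)%N ->
  lsum (fun k => gridinv M (n - k)) g = (lcoef (u ^+ r.+1) n)%:~R.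
Proof.
move=> gD hM nD.
have Nd0 : (M.*2.+1 ^ d)%:R != 0 :> C by rewrite pnatr_eq0 -lt0n expn_gt0.
have -> : lsum (fun k => gridinv M (n - k)) g =
    ((M.*2.+1 ^ d)%:R)^-1 * \sum_x leval (u ^+ r.+1) (gridpt R (M := M) x) * chi (gridpt R x) (- n).
  transitivity (\sum_(k <- lsupp g) (lcoef g k)%:~R * (((M.*2.+1 ^ d)%:R)^-1 * S M (n - k))).
    rewrite /lsum big_seq [RHS]big_seq; apply: eq_bigr => k.
    rewrite mem_lsupp => /gD kD; rewrite /gridinv ifT //.
    by rewrite (leq_trans (ZnormD _ _)) // ZnormN (leq_trans _ nD) // leq_add2l.
  under eq_bigr do rewrite mulrCA; rewrite -mulr_sumr; congr (_ * _).
  under eq_bigr do rewrite mulr_sumr; rewrite exchange_big /=; apply: eq_bigr => x _.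
  have [h hE] := leval_rmorph (@gridpt_neq0 R d M x).
  rewrite -hE rmorphXn hE.
  transitivity (F x * leval g (gridpt R x) * chi (gridpt R x) (- n)).
    rewrite leval_chi /lsum -mulrA mulr_suml mulr_sumr; apply: eq_bigr => k _.
    rewrite opprB addrC chiD; last exact: gridpt_neq0.
    by ring.
  congr (_ * _); rewrite /F; have [g0|g0] := eqVneq (leval g (gridpt R x)) 0; last by rewrite divfK.
  have := ug (fun i => (x i)%:R / (M.*2.+1)%:R); rewrite -/(gridpt R x) g0 normc0 mulr0 => h0.
  have /eq0_normc -> : normc (leval u (gridpt R x)) = 0 by apply/le_anti; rewrite h0 normc_ge0.
  by rewrite exprS !mul0r.
apply: (mulfI Nd0); rewrite mulrA divff // mul1r.
under eq_bigr => x _ do rewrite leval_chi mulr_suml.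
rewrite exchange_big /=.
transitivity (\sum_(k <- lsupp (u ^+ r.+1)) (lcoef (u ^+ r.+1) k)%:~R *
    (if k - n == 0 then (M.*2.+1 ^ d)%:R else 0 : C)).
  rewrite big_seq [RHS]big_seq; apply: eq_bigr => k; rewrite mem_lsupp => /hM kM.
  rewrite -sum_chi; last first.
    move=> i; apply: leq_trans (Znorm_ge _ i) _; apply: leq_trans (ZnormD _ _) _.
    by rewrite ZnormN -addnn leq_add // (leq_trans _ nD) // leq_addr.
  rewrite mulr_sumr; apply: eq_bigr => x _; rewrite chiD ?mulrA //.
  exact: gridpt_neq0.
rewrite -[lcoef _ n in RHS]lpair_delta /lpair rmorph_sum mulr_sumr.
apply: eq_bigr => k _; rewrite subr_eq0 rmorphM /=.
by case: eqP; rewrite ?mulr0 ?mulr1 // mulrC.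
Qed.

(** Errors occur only near or outside the border of the box, where h has no coefficient and the
    decay makes the convolution at most A K / m. Only the box depends on [eta], not [K]. *)
Lemma approx_inverse : exists2 K, 0 <= K & forall eta, 0 < eta ->
  exists Phi : Zd -> C, (forall n, normc (Phi n) * (Znorm n).+1%:R ^+ r <= K) /\
   (forall n, normc (lsum (fun k => Phi (n - k)) g - (lcoef (u ^+ r.+1) n)%:~R) <= eta).
Proof.
have [K K0 KP] := gridinv_decay; exists K => // eta eta0.
have [D gD] := lsupp_bounded g; have [D' hD] := lsupp_bounded (u ^+ r.+1).
pose A := lnorm1 R g.
have A0 : 0 <= A := lnorm1_ge0 R g.
pose m := (Num.truncn (A * K / eta)).+1.
have mP : A * K / eta < m%:R by rewrite /m truncnS_gt.
(* [D'] contains the support of h. One [D] is the margin required of [n], the other bounds the shift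
   by [k]; what remains puts [n - k] at norm at least [m]. *)
pose M := (2 * D + D' + m).+1.
exists (gridinv M); split; first by move=> n; apply: KP.
move=> n; have [nM|nM] := leqP (Znorm n + D) M.
  rewrite (gridinv_exact gD _ nM) ?subrr ?normc0 ?(ltW eta0) //.
  by move=> k /hD h; rewrite (leq_trans h) // /M; lia.
have -> : lcoef (u ^+ r.+1) n = 0.
  apply: contraTeq nM => /hD h; rewrite -leqNgt (leq_trans (leq_add h (leqnn D))) // /M; lia.
rewrite subr0; apply: (@le_trans _ _ (A * (K / m%:R))).
  apply: normc_lsum => k; rewrite mem_lsupp => /gD kD.
  have nk : (m <= Znorm (n - k))%N.
    have : (Znorm n <= Znorm (n - k) + Znorm k)%N by rewrite -{1}[n](subrK k) ZnormD.
    by move: nM; rewrite /M; lia.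
  rewrite ler_pdivlMr ?ltr0n //; apply: le_trans (KP M (n - k) isT).
  apply: ler_wpM2l; first exact: normc_ge0.
  apply: (@le_trans _ _ (Znorm (n - k)).+1%:R); first by rewrite ler_nat ltnW.
  by rewrite -[leLHS]expr1; apply: ler_weXn2l => //; rewrite ler1n.
rewrite ltr_pdivrMr // in mP.
by rewrite mulrA ler_pdivrMr ?ltr0n // ltW // [ltRHS]mulrC.
Qed.

End ApproximateInverse.

(** * Divisibility across a gap *)

Section Tail.
Variable R : realType.

Lemma sum_inv_square_le n : \sum_(j < n) ((j.+1%:R ^+ 2)^-1 : R) <= 2.
Proof.
have H m : \sum_(j < m.+1) ((j.+1%:R ^+ 2)^-1 : R) <= 2 - m.+1%:R^-1.
  elim: m => [|m IH]; first by rewrite big_ord_recl big_ord0 expr1n invr1; lra.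
  rewrite big_ord_recr /=; have m1 : 0 < m.+1%:R :> R by rewrite ltr0n.
  have m2 : m.+2%:R = m.+1%:R + 1 :> R by rewrite -natr1.
  have : (m.+2%:R ^+ 2)^-1 <= m.+1%:R^-1 - m.+2%:R^-1 :> R.
    rewrite m2; move: m1; move: (m.+1%:R : R) => a a0.
    have -> : a^-1 - (a + 1)^-1 = (a * (a + 1))^-1.
      have an0 : a != 0 by rewrite gt_eqF.
      have a1 : a + 1 != 0 by rewrite gt_eqF // addr_gt0.
      by field; rewrite ?an0 ?a1.
    by rewrite lef_pV2 ?posrE ?exprn_gt0 ?mulr_gt0 //; nra.
  by move=> h; apply: le_trans (lerD IH h) _; rewrite addrA subrK.
case: n => [|n]; first by rewrite big_ord0.
by apply: le_trans (H n) _; rewrite gerBl invr_ge0.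
Qed.

Lemma sum_uniq_le (T : finType) (s : seq T) (F : T -> R) : uniq s ->
  (forall x, 0 <= F x) -> \sum_(x <- s) F x <= \sum_x F x.
Proof.
move=> us F0; rewrite (big_uniq _ us) [leRHS](bigID (mem s)) /= lerDl.
by apply: sumr_ge0.
Qed.

(** One factor of the power is at least m+1, and the other 2d dominate the product of the
    (1+|x_i|)^2. The sum of products factors into d one-dimensional sums, each at most 4: two signs,
    and at most 2 for each. *)
Lemma tail_sum d (X : seq 'rV[int]_d) m : uniq X ->
  (forall x, x \in X -> (m <= Znorm x)%N) ->
  \sum_(x <- X) (((Znorm x).+1%:R ^+ d.*2.+1)^-1 : R) <= 4 ^+ d / m.+1%:R.
Proof.
move=> uX Xm; pose B := \max_(x <- X) Znorm x.
pose a (j : bool * 'I_B.+1) : R := (j.2.+1%:R ^+ 2)^-1.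
(* Sign and absolute value of each coordinate embed [X] in a finite function type, over which the
   sum of products can be distributed. *)
pose f (x : 'rV[int]_d) : {ffun 'I_d -> bool * 'I_B.+1} :=
  [ffun i => (x 0 i < 0, inord (absz (x 0 i)))].
have XB x i : x \in X -> (`|x 0%R i| <= B)%N.
  by move=> xX; rewrite (leq_trans (Znorm_ge x i)) // /B leq_bigmax_seq.
have fX : uniq (map f X).
  rewrite map_inj_in_uniq // => x y xX yX /ffunP fxy; apply/rowP => i.
  have := fxy i; rewrite !ffunE => -[sxy /(congr1 (@nat_of_ord _))].
  rewrite !inordK ?ltnS ?XB //; move: sxy.
  by move: (x 0 i) (y 0 i) => b c; case: (ltP b 0); case: (ltP c 0) => // *; lia.
have sum4 : \sum_j a j <= 4.
  rewrite -(pair_big xpredT xpredT (fun b j => a (b, j))) /=.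
  rewrite big_bool /= /a /=; have := sum_inv_square_le B.+1; lra.
have a0 j : 0 <= a j by rewrite invr_ge0 exprn_ge0.
apply: (@le_trans _ _ (\sum_(x <- X) m.+1%:R^-1 * \prod_i a (f x i))).
  rewrite big_seq [leRHS]big_seq; apply: ler_sum => x xX.
  have -> : \prod_i a (f x i) = (\prod_(i < d) (`|x 0%R i|%N.+1%:R ^+ 2))^-1.
    rewrite -prodfV; apply: eq_bigr => i _; rewrite ffunE /a /= inordK //.
    by rewrite ltnS XB.
  have pp : 0 < \prod_(i < d) (`|x 0%R i|%N.+1%:R ^+ 2) :> R.
    by apply: prodr_gt0 => i _; rewrite exprn_gt0 // ltr0n.
  rewrite -invfM lef_pV2 ?posrE ?mulr_gt0 ?exprn_gt0 ?ltr0n //.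
  rewrite exprS; apply: ler_pM => //; first exact: ltW.
    by rewrite ler_nat ltnS Xm.
  apply: (@le_trans _ _ (\prod_(i < d) ((Znorm x).+1%:R ^+ 2))); last first.
    by rewrite prodr_const card_ord -exprM mul2n.
  apply: ler_prod => i _; rewrite exprn_ge0 //=.
  by apply: lerXn2r; rewrite ?nnegrE // ler_nat ltnS Znorm_ge.
rewrite -mulr_sumr mulrC ler_wpM2r ?invr_ge0 //.
rewrite -(big_map f xpredT (fun y => \prod_i a (y i))).
apply: le_trans (sum_uniq_le fX _) _; first by move=> y; apply: prodr_ge0.
rewrite -(bigA_distr_bigA (fun _ : 'I_d => a)) prodr_const card_ord.
by apply: lerXn2r; rewrite ?nnegrE //; apply: sumr_ge0.
Qed.

End Tail.

Section Gap.
Variables (R : realType) (d : nat) (g h : laurent d) (K : R).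
Local Notation C := R[i].
Local Notation Zd := 'rV[int]_d.
Hypothesis K_ge0 : 0 <= K.
Hypothesis approx : forall eta : R, 0 < eta ->
  exists Phi : Zd -> C, (forall n, normc (Phi n) * (Znorm n).+1%:R ^+ d.*2.+1 <= K) /\
   (forall n, normc (lsum (fun k => Phi (n - k)) g - (lcoef h n)%:~R) <= eta).

Lemma lsum_coefM (f1 f2 : laurent d) n :
  (lcoef (f1 * f2) n)%:~R = lsum (fun k => (lcoef f2 (n - k))%:~R) f1 :> C.
Proof.
rewrite {1}[f1]lmono_sum mulr_suml lcoef_sum rmorph_sum; apply: eq_bigr => k _.
by rewrite lcoef_monoM rmorphM.
Qed.

Lemma lsumB (A : pzRingType) (phi psi : Zd -> A) (f : laurent d) :
  lsum phi f - lsum psi f = lsum (fun n => phi n - psi n) f.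
Proof. by rewrite -sumrB; apply: eq_bigr => n _; rewrite mulrBr. Qed.

Lemma lrestrictE (S : set Zd) (v : laurent d) n :
  lcoef (lrestrict S v) n = if `[< S n >] then lcoef v n else 0.
Proof.
by rewrite /= fsfunE; case: ifPn => // /lcoef_notin ->; rewrite if_same.
Qed.

(** The decay is summable, so the bound depends on the size of the coefficients but not on their
    number. *)
Lemma conv_far (Phi : Zd -> C) (f : laurent d) (H m : nat) n :
  (forall n, normc (Phi n) * (Znorm n).+1%:R ^+ d.*2.+1 <= K) ->
  (forall k, (`|lcoef f k| <= H)%N) ->
  (forall k, lcoef f k != 0 -> (m <= Znorm (n - k))%N) ->
  normc (lsum (fun k => Phi (n - k)) f) <= H%:R * K * 4 ^+ d / m.+1%:R.
Proof.
move=> PhiK fH fm; apply: le_trans (normc_sum _ _ _) _.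
apply: (@le_trans _ _ (\sum_(k <- lsupp f) H%:R * K * ((Znorm (n - k)).+1%:R ^+ d.*2.+1)^-1)).
  rewrite big_seq [leRHS]big_seq; apply: ler_sum => k _.
  rewrite normcM normc_int -mulrA; apply: ler_pM => //; first exact: normc_ge0.
    by rewrite ler_nat.
  by rewrite ler_pdivlMr ?exprn_gt0 ?ltr0n.
rewrite -mulr_sumr -[leRHS]mulrA; apply: ler_wpM2l; first by rewrite mulr_ge0.
rewrite -(big_map (fun k => n - k) xpredT (fun x => ((Znorm x).+1%:R ^+ d.*2.+1)^-1)).
apply: tail_sum.
  rewrite map_inj_uniq ?fset_uniq // => x y /addrI; exact: oppr_inj.
by move=> x /mapP[k kf ->]; apply: fm; rewrite -mem_lsupp.
Qed.

Lemma gap_dvd (H : nat) : exists2 m : nat, (1 <= m)%N &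
  forall S S' : set Zd,
  (forall n n', S n -> S' n' -> (m <= Znorm (n - n'))%N) ->
  forall v : laurent d, bounded_on (S `|` S') H v ->
  ldivides g v -> ldivides g (h * lrestrict S v).
Proof.
pose A := lnorm1 R g; have A0 : 0 <= A := lnorm1_ge0 R g.
pose E := H%:R * K * 4 ^+ d; have E0 : 0 <= E by rewrite !mulr_ge0 ?exprn_ge0.
pose m0 := (Num.truncn (4 * A * E)).+1.
have m0P : 4 * A * E < m0%:R by rewrite /m0 truncnS_gt.
pose eps := E / m0.+1%:R.
have eps0 : 0 <= eps by rewrite divr_ge0.
have Aeps : A * eps <= 1 / 4.
  rewrite /eps mulrA ler_pdivrMr ?ltr0n // -[m0.+1%:R]natr1; lra.
(* A point closer than [m0] to [S] is then at distance at least [m0] from [S']. *)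
exists m0.*2; first by rewrite /m0; lia.
move=> S S' SS' v [vSS' vH] [q vq].
pose vS := lrestrict S v; pose vS' := v - vS.
have vS'E n : lcoef vS' n = if `[< S n >] then 0 else lcoef v n.
  by rewrite lcoefD lcoefN lrestrictE; case: ifP; rewrite ?subrr ?subr0.
have vHn n : (`|lcoef v n| <= H)%N by have := vH n; lia.
have vSn n : lcoef vS n != 0 -> S n.
  by rewrite lrestrictE; case: asboolP => //; rewrite eqxx.
have vS'n n : lcoef vS' n != 0 -> S' n.
  rewrite vS'E; case: asboolP; rewrite ?eqxx // => nS /vSS'[]//.
have vSH n : (`|lcoef vS n| <= H)%N by rewrite lrestrictE; case: ifP.
have vS'H n : (`|lcoef vS' n| <= H)%N by rewrite vS'E; case: ifP.
pose Q := lnorm1 R q; have Q0 : 0 <= Q := lnorm1_ge0 R q.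
pose V := lnorm1 R vS; have V0 : 0 <= V := lnorm1_ge0 R vS.
(* [Q] and [V] depend on [v], but they enter only through [eta], which is chosen here, after
   [m0]. *)
pose T := A * Q + V + 1; have T0 : 0 < T by have := mulr_ge0 A0 Q0; rewrite /T; lra.
have [Phi [PhiK Phig]] := approx (divr_gt0 (divr_gt0 ltr01 (ltr0n R 4)) T0).
set eta := 1 / 4 / T in Phig.
have etaT : A * (Q * eta) + V * eta <= 1 / 4.
  have -> : A * (Q * eta) + V * eta = (A * Q + V) * eta by ring.
  rewrite /eta mulrA ler_pdivrMr // [leLHS]mulrC ler_wpM2l //; rewrite /T; lra.
pose conv f n := lsum (fun k => Phi (n - k)) f.
have convD f1 f2 n : conv (f1 + f2) n = conv f1 n + conv f2 n by rewrite /conv lsumD.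
have convM f1 f2 n : conv (f1 * f2) n = lsum (fun k => conv f2 (n - k)) f1.
  rewrite /conv lsumM; apply: eq_bigr => k _; congr (_ * _).
  by apply: eq_bigr => l _; rewrite opprD addrA.
pose cond n := `[< exists2 k, lcoef vS k != 0 & (Znorm (n - k) < m0)%N >].
(* The quotient of [h * vS] by [g] is going to be [h * q] cut off to the neighbourhood of the
   support of [vS]. *)
pose wt : laurent d := Laurent [fsfun n in lsupp (h * q) => if cond n then lcoef (h * q) n else 0].
have wtE n : lcoef wt n = if cond n then lcoef (h * q) n else 0.
  by rewrite /= fsfunE; case: ifPn => // /lcoef_notin ->; rewrite if_same.
have near n : normc ((lcoef wt n)%:~R - conv vS n) <= eps + Q * eta.
  rewrite wtE /cond; case: asboolP => [[k0 k0S nk0]|ncond]; last first.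
    rewrite sub0r normcN; apply: le_trans (_ : eps <= _); last by rewrite lerDl mulr_ge0 // divr_ge0 // ltW.
    apply: conv_far => // k kS; rewrite leqNgt; apply/negP => nk.
    by apply: ncond; exists k.
  have far k : lcoef vS' k != 0 -> (m0 <= Znorm (n - k))%N.
    move=> /vS'n kS'; have := SS' _ _ (vSn _ k0S) kS'.
    have : (Znorm (k0 - k) <= Znorm (n - k) + Znorm (n - k0))%N.
      have -> : k0 - k = (n - k) + - (n - k0) by rewrite opprB [RHS]addrC subrKA.
      by apply: leq_trans (ZnormD _ _) _; rewrite ZnormN.
    by move: nk0; move: (Znorm _) (Znorm _) (Znorm _) (m0); clear; lia.
  (* Near [S] the contribution of [vS'] is a tail, and the convolution with [v] equals that of [q]
     with g Phi, which is close to h. *)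
  have -> : (lcoef (h * q) n)%:~R - conv vS n = conv vS' n + ((lcoef (h * q) n)%:~R - conv v n).
    have -> : v = vS + vS' by rewrite addrC subrK.
    by rewrite convD; ring.
  apply: le_trans (normcD _ _) _; apply: lerD; first exact: conv_far.
  rewrite vq [g * q]mulrC [h * q]mulrC convM lsum_coefM lsumB.
  by apply: normc_lsum => k _; rewrite normcB; exact: Phig.
exists wt; apply: laurentP => n; apply/eqP; rewrite -subr_eq0.
suff : normc ((lcoef (h * vS) n - lcoef (g * wt) n)%:~R : C) < 1.
  by rewrite normc_int ltrn1 ltnS leqn0 absz_eq0.
rewrite [h * vS]mulrC intrB !lsum_coefM.
have E1 : lsum (fun k => conv vS (n - k)) g = lsum (fun k => conv g (n - k)) vS.
  by rewrite -!convM mulrC.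
have -> : lsum (fun k => (lcoef h (n - k))%:~R) vS - lsum (fun k => (lcoef wt (n - k))%:~R) g =
  lsum (fun k => (lcoef h (n - k))%:~R - conv g (n - k)) vS +
  lsum (fun k => conv vS (n - k) - (lcoef wt (n - k))%:~R) g.
  by rewrite -!lsumB E1; ring.
apply: le_lt_trans (normcD _ _) _.
(* Of the total error, [A * eps] takes at most 1/4 and the terms in [eta] together at most 1/4. *)
apply: (@le_lt_trans _ _ (V * eta + A * (eps + Q * eta))); last by rewrite mulrDr; lra.
apply: lerD; apply: normc_lsum => k _; rewrite normcB; [exact: Phig | exact: near].
Qed.

End Gap.

(** * Self-conjugate Laurent polynomials *)

Section Conj.
Variable d : nat.
Implicit Types f g : laurent d.

Lemma lconjK f : lconj (lconj f) = f.
Proof. by apply: laurentP => n; rewrite !lconjE opprK. Qed.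

Lemma lconjD f g : lconj (f + g) = lconj f + lconj g.
Proof. by apply: laurentP => n; rewrite lcoefD !lconjE lcoefD. Qed.

Lemma lconj_sum (I : Type) (r : seq I) P (F : I -> laurent d) :
  lconj (\sum_(j <- r | P j) F j) = \sum_(j <- r | P j) lconj (F j).
Proof.
apply: big_morph; first exact: lconjD.
by apply: laurentP => n; rewrite lconjE !lcoef0.
Qed.

Lemma lconj_mono c k : lconj (lmono c k) = lmono c (- k) :> laurent d.
Proof. by apply: laurentP => n; rewrite lconjE !lmonoE eqr_oppLR. Qed.

Lemma lconjM f g : lconj (f * g) = lconj f * lconj g.
Proof.
rewrite {1 2}[f]lmono_sum mulr_suml !lconj_sum mulr_suml; apply: eq_bigr => k _.
rewrite {1 2}[g]lmono_sum mulr_sumr !lconj_sum mulr_sumr; apply: eq_bigr => l _.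
by rewrite lmonoM !lconj_mono lmonoM opprD.
Qed.

(* The coefficient of [q q^*] at the origin is the sum of the squares of the
   coefficients of [q]. *)
Lemma conj_unit_mono q : q * lconj q = 1 -> exists2 c : int, c = 1 \/ c = -1 & exists a, q = lmono c a :> laurent d.
Proof.
move=> qq.
have s1 : \sum_(k <- lsupp q) lcoef q k ^+ 2 = 1.
  have := congr1 (fun f => lcoef f 0) qq.
  rewrite {1}[q]lmono_sum mulr_suml lcoef_sum -lmono0 lmonoE eqxx => <-.
  by apply: eq_bigr => k _; rewrite lcoef_monoM lconjE sub0r opprK expr2.
have [a qa] : exists a, lcoef q a != 0.
  apply: laurent_neq0; apply: contra_eq_neq qq => ->.
  by rewrite mul0r eq_sym oner_neq0.
have asupp : a \in lsupp q by rewrite mem_lsupp.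
rewrite (big_fsetD1 a) //= in s1.
have rest0 : 0 <= \sum_(k <- (lsupp q `\ a)%fset) lcoef q k ^+ 2.
  by apply: sumr_ge0 => k _; exact: sqr_ge0.
exists (lcoef q a).
  move: s1 rest0 qa; move: (lcoef q a) (\sum_(k <- _) _) => x y.
  by rewrite expr2; nia.
exists a; apply: laurentP => n; rewrite lmonoE; case: eqP => [->//|/eqP na].
apply/eqP; apply: contraT => qn.
have nsupp : n \in (lsupp q `\ a)%fset by rewrite in_fsetD1 na mem_lsupp.
move: s1; rewrite (big_fsetD1 n) //=.
have : 0 <= \sum_(k <- (lsupp q `\ a `\ n)%fset) lcoef q k ^+ 2.
  by apply: sumr_ge0 => k _; exact: sqr_ge0.
move: qa qn; move: (lcoef q a) (lcoef q n) (\sum_(k <- _) _) => x y z.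
by rewrite !expr2; nia.
Qed.

Lemma lsum_scale (A : pzRingType) (phi : 'rV[int]_d -> A) (w : 'rV[int]_d -> int) f u :
  (forall n, lcoef u n = w n * lcoef f n) ->
  lsum phi u = lsum (fun n => (w n)%:~R * phi n) f.
Proof.
move=> uw; rewrite (lsumW phi (D := lsupp f)).
  by apply: eq_bigr => n _; rewrite uw mulrC intrM mulrA.
apply/fsubsetP => n; rewrite !mem_lsupp uw; apply: contraNN => /eqP ->.
by rewrite mulr0.
Qed.

Lemma lsumZ (A : comPzRingType) (x : A) (phi : 'rV[int]_d -> A) f :
  lsum (fun n => x * phi n) f = x * lsum phi f.
Proof. by rewrite /lsum mulr_sumr; apply: eq_bigr => n _; rewrite mulrCA. Qed.

End Conj.

Section Conjugate.
Variables (R : realType) (d : nat).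
Local Notation C := R[i].

Definition torpt (t : 'rV[R]_d) (j : 'I_d) : C := expi2pi (t 0 j).

Definition dotp (n : 'rV[int]_d) (t : 'rV[R]_d) : R := \sum_j (n 0 j)%:~R * t 0 j.

Lemma torpt_neq0 t j : torpt t j != 0.
Proof. exact: expi2pi_neq0. Qed.

Lemma expi2pi_sum (I : Type) (r : seq I) (F : I -> R) :
  expi2pi (\sum_(j <- r) F j) = \prod_(j <- r) expi2pi (F j).
Proof. by apply: big_morph; [exact: expi2piD | exact: expi2pi0]. Qed.

Lemma chi_torpt t n : chi (torpt t) n = expi2pi (dotp n t).
Proof. by rewrite expi2pi_sum; apply: eq_bigr => j _; rewrite expi2piMz. Qed.

Lemma conjc_int (n : int) : ((n%:~R : C)^*%C) = n%:~R.
Proof. exact: rmorph_int. Qed.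

Lemma conjcM (x y : C) : conjc (x * y) = conjc x * conjc y.
Proof. exact: rmorphM. Qed.

Lemma dotpN n t : dotp (- n) t = - dotp n t.
Proof. by rewrite /dotp -sumrN; apply: eq_bigr => j _; rewrite mxE intrN mulNr. Qed.

Lemma lconj_leval (f : laurent d) t : leval (lconj f) (torpt t) = (leval f (torpt t))^*%C.
Proof.
have E : lconj f = \sum_(n <- lsupp f) lmono (lcoef f n) (- n).
  by rewrite {1}[f]lmono_sum lconj_sum; apply: eq_bigr => n _; rewrite lconj_mono.
rewrite leval_chi E lsum_big leval_chi /lsum rmorph_sum; apply: eq_bigr => n _.
rewrite -/(lsum _ _) lsum_mono rmorphM /= conjc_int !chi_torpt dotpN; congr (_ * _).
by rewrite expi2pi_conj.
Qed.

End Conjugate.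

Section RealForm.
Variables (R : realType) (d : nat) (g : laurent d) (a : 'rV[int]_d) (c : int) (i : 'I_d).
Hypothesis c1 : c = 1 \/ c = -1.
Hypothesis gconj : lconj g = lmono c a * g.
Local Notation C := R[i].
Implicit Types t : 'rV[R]_d.

(* [exp (i pi a.t) g(t)] is real if [c = 1] and imaginary if [c = -1]. *)
Let kappa : C := if c == 1 then 1 else 'i%C.

Definition phase (n : 'rV[int]_d) t : R := dotp n t + dotp a t / 2.

Definition twist (f : laurent d) t : C := kappa * lsum (fun n => expi2pi (phase n t)) f.

(** In exp (i pi a.t) g(t) the exponent n has frequency n_i + a_i/2 along coordinate i, so
    differentiation multiplies its coefficient by i pi (a_i + 2 n_i); [umul] carries the integral
    part of that factor. *)
Definition umul : laurent d := lmono (a 0 i) 0 * g + lderiv i g *+ 2.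

Lemma umulE n : lcoef umul n = (a 0 i + 2 * n 0 i) * lcoef g n.
Proof.
by rewrite /umul mulr2n !lcoefD lcoef_monoM subr0 lderivE; ring.
Qed.

(** The factor a_i + 2 n_i is odd under the symmetry n -> -n - a of the support of [g], hence the
    change of sign of [c]. The factor i pi in [realder] undoes it. *)
Lemma umul_conj : lconj umul = lmono (- c) a * umul.
Proof.
apply: laurentP => n; rewrite lconjE lcoef_monoM !umulE !mxE.
have := congr1 (fun f => lcoef f n) gconj; rewrite lconjE lcoef_monoM => ->; ring.
Qed.

Lemma normc_kappa : normc kappa = 1.
Proof.
rewrite /kappa; case: ifP => _; first by rewrite normc1.
by rewrite /= expr0n /= add0r expr1n sqrtr1.
Qed.

Lemma kappa_conj : kappa^*%C * c%:~R = kappa.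
Proof.
rewrite /kappa; case: c1 => ->; rewrite ?eqxx /=.
  by apply/eqP; rewrite mulr1 eq_complex /= oppr0 !eqxx.
by rewrite mulrN1z mulrN1; apply/eqP; rewrite eq_complex /= oppr0 opprK !eqxx.
Qed.

Lemma twistE f t : twist f t = kappa * (expi2pi (dotp a t / 2) * leval f (torpt t)).
Proof.
apply: (congr1 (fun z => kappa * z)).
rewrite leval_chi /lsum mulr_sumr; apply: eq_bigr => n _.
by rewrite chi_torpt /phase expi2piD; ring.
Qed.

Lemma normc_twist f t : normc (twist f t) = normc (leval f (torpt t)).
Proof. by rewrite twistE !normcM normc_kappa normc_expi2pi !mul1r. Qed.

Lemma twist_conj f (e : int) (k : C) t : lconj f = lmono e a * f ->
  k^*%C * kappa^*%C * e%:~R = k * kappa -> ((k * twist f t)^*)%C = k * twist f t.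
Proof.
move=> fconj kk; rewrite twistE !conjcM -lconj_leval fconj.
have [h hE] := leval_rmorph (torpt_neq0 t).
rewrite -!hE rmorphM !hE leval_chi lsum_mono chi_torpt expi2pi_conj.
transitivity (k^*%C * kappa^*%C * e%:~R * (expi2pi (- (dotp a t / 2)) * expi2pi (dotp a t)) * leval f (torpt t)).
  by rewrite !mulrA; ring.
rewrite kk -expi2piD; have -> : - (dotp a t / 2) + dotp a t = dotp a t / 2 by field.
by rewrite !mulrA.
Qed.

Lemma normc_real (z : C) : (z^*)%C = z -> normc z = `|complex.Re z|.
Proof.
case: z => x y /= [yy]; have -> : y = 0 by lra.
by rewrite expr0n addr0 sqrtr_sqr.
Qed.

Lemma dotp_shift n t s : dotp n (t + s *: delta_mx 0 i) = dotp n t + (n 0 i)%:~R * s.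
Proof.
rewrite /dotp (eq_bigr (fun j => (n 0 j)%:~R * t 0 j + (n 0 j)%:~R * (s * (j == i)%:R))); last first.
  by move=> j _; rewrite !mxE eqxx mulrDr.
rewrite big_split /=; congr (_ + _).
rewrite (bigD1 i) //= eqxx mulr1 big1 ?addr0 // => j /negbTE ->.
by rewrite !mulr0.
Qed.

Lemma phase_shift n t s :
  phase n (t + s *: delta_mx 0 i) = phase n t + ((n 0 i)%:~R + (a 0 i)%:~R / 2) * s.
Proof. by rewrite /phase !dotp_shift; field. Qed.

(** [realpart] is the real function with absolute value |g|, and [realder] its partial derivative.
    The latter is given by a formula; all that is used of it is the quadratic estimate, the
    Lipschitz bound and its link with [umul]. *)
Definition realpart t : R := complex.Re (twist g t).
Definition realder t : R := complex.Re ((0 +i* pi)%C * twist umul t).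

Lemma norm_realpart t : `|realpart t| = normc (leval g (torpt t)).
Proof.
rewrite -normc_twist normc_real //; have := @twist_conj g c 1 t gconj.
by rewrite rmorph1 !mul1r; apply; exact: kappa_conj.
Qed.

Lemma norm_realder t : `|realder t| = pi * normc (leval umul (torpt t)).
Proof.
rewrite -normc_twist /realder -normc_real.
  rewrite normcM; congr (_ * _).
  by rewrite /= expr0n add0r sqrtr_sqr ger0_norm // pi_ge0.
apply: (twist_conj _ umul_conj).
have -> : ((0 +i* pi)^*)%C = - (0 +i* pi)%C :> C by apply/eqP; rewrite eq_complex /= oppr0 !eqxx.
rewrite intrN mulrN !mulNr opprK -mulrA kappa_conj //.
Qed.

(** The exponentials are expanded term by term, all frequencies being at most [B]. The summand 1
    makes [K] positive, as later divisions require. *)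
Lemma realpart_taylor : exists2 K, 0 < K & forall t s,
  `|realpart (t + s *: delta_mx 0 i) - realpart t - s * realder t| <= K * s ^+ 2.
Proof.
have [D gD] := lsupp_bounded g.
pose B : R := D%:R + `|(a 0 i)%:~R| / 2.
exists (lnorm1 R g * (2 * (2 * pi * B) ^+ 2) + 1).
  by rewrite ltr_wpDl // mulr_ge0 ?lnorm1_ge0 // mulr_ge0 // sqr_ge0.
move=> t s; set T := (X in `|X|).
have -> : T = complex.Re (twist g (t + s *: delta_mx 0 i) - twist g t -
                          (s%:C)%C * ((0 +i* pi)%C * twist umul t)).
  rewrite /T /realpart /realder; move: (twist g _) (twist g t) (_ * twist umul t) => x y z.
  by case: x y z => [x1 x2] [y1 y2] [z1 z2] /=; rewrite mul0r subr0.
apply: le_trans (normc_Re_le _) _.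
pose y (n : 'rV[int]_d) : R := ((n 0 i)%:~R + (a 0 i)%:~R / 2) * s.
have -> : twist g (t + s *: delta_mx 0 i) - twist g t - (s%:C)%C * ((0 +i* pi)%C * twist umul t) =
  kappa * lsum (fun n => expi2pi (phase n t) * (expi2pi (y n) - 1 - (0 +i* (2 * pi * y n))%C)) g.
  rewrite /twist [in X in _ - X](lsum_scale _ umulE).
  rewrite [X in _ - X](_ : _ = kappa * lsum (fun n => (s%:C)%C * (0 +i* pi)%C *
     ((a 0 i + 2 * n 0 i)%:~R * expi2pi (phase n t))) g); last first.
    by rewrite lsumZ; ring.
  rewrite -!mulrBr; congr (_ * _); rewrite !lsumB; apply: eq_bigr => n _; congr (_ * _).
  rewrite phase_shift expi2piD -/(y n) !mulrBr mulr1; congr (_ - _).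
  transitivity (expi2pi (phase n t) * ((s%:C)%C * (0 +i* pi)%C * (a 0 i + 2 * n 0 i)%:~R)); first by ring.
  congr (_ * _).
  have -> : ((a 0 i + 2 * n 0 i)%:~R : C) = (((a 0 i + 2 * n 0 i)%:~R : R)%:C)%C by rewrite rmorph_int.
  apply/eqP; rewrite eq_complex /=; apply/andP; split; apply/eqP; first by ring.
  by rewrite /y intrD intrM; field.
rewrite normcM normc_kappa mul1r.
apply: (@le_trans _ _ (lnorm1 R g * (2 * (2 * pi * B) ^+ 2 * s ^+ 2))); last first.
  by rewrite [leRHS]mulrDl mul1r !mulrA lerDl sqr_ge0.
apply: normc_lsum => n; rewrite mem_lsupp => /gD nD.
rewrite normcM normc_expi2pi mul1r; apply: le_trans (expi2pi_taylor _) _.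
rewrite -[leRHS]mulrA -exprMn ler_wpM2l //.
rewrite -[leLHS]real_normK ?num_real // -[leRHS]real_normK ?num_real //.
apply: lerXn2r; rewrite ?nnegrE // /y !normrM -!mulrA ler_wpM2l // ler_wpM2l //.
rewrite ler_wpM2r //; apply: le_trans (ler_normD _ _) _; apply: le_trans (ler_norm _).
apply: lerD; last by rewrite normrM normfV normr_nat.
rewrite -intr_norm -abszE -pmulrn ler_nat; apply: leq_trans nD; exact: Znorm_ge.
Qed.

Lemma twist_lipschitz (f : laurent d) : exists2 L, 0 <= L & forall t t' delta,
  (forall j, `|t 0 j - t' 0 j| <= delta) -> normc (twist f t - twist f t') <= L * delta.
Proof.
have [D fD] := lsupp_bounded f.
pose B : R := D%:R + (Znorm a)%:R / 2.
exists (lnorm1 R f * (2 * pi * (d%:R * B))).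
  by rewrite mulr_ge0 ?lnorm1_ge0 // !mulr_ge0 ?pi_ge0 ?addr_ge0 ?divr_ge0.
move=> t t' delta tt; rewrite /twist -mulrBr normcM normc_kappa mul1r lsumB -[leRHS]mulrA.
apply: normc_lsum => n; rewrite mem_lsupp => /fD nD.
have -> : expi2pi (phase n t) - expi2pi (phase n t') =
   expi2pi (phase n t') * (expi2pi (phase n t - phase n t') - 1) :> C.
  by rewrite mulrBr mulr1 -expi2piD [phase n t' + _]addrC subrK.
rewrite normcM normc_expi2pi mul1r; apply: le_trans (normcB_expi2pi _) _.
rewrite -[leRHS]mulrA ler_wpM2l ?mulr_ge0 ?pi_ge0 //.
have -> : phase n t - phase n t' = \sum_(j < d) ((n 0 j)%:~R + (a 0 j)%:~R / 2) * (t 0 j - t' 0 j).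
  rewrite /phase /dotp; set s1 := \sum_j _; set s2 := \sum_j _.
  transitivity (s1 - \sum_j (n 0 j)%:~R * t' 0 j + (s2 - \sum_j (a 0 j)%:~R * t' 0 j) / 2); first by field.
  rewrite /s1 /s2 -!sumrB mulr_suml -big_split.
  by apply: eq_bigr => j _ /=; field.
apply: le_trans (ler_norm_sum _ _ _) _.
rewrite -[leRHS]mulrA mulr_natl -[d in leRHS]card_ord -sumr_const; apply: ler_sum => j _.
rewrite normrM; apply: ler_pM => //.
apply: le_trans (ler_normD _ _) _; apply: lerD.
  rewrite -intr_norm -abszE -pmulrn ler_nat; apply: leq_trans nD; exact: Znorm_ge.
rewrite normrM normfV normr_nat // ler_wpM2r ?invr_ge0 //.
by rewrite -intr_norm -abszE -pmulrn ler_nat Znorm_ge.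
Qed.

Lemma realpart_lipschitz : exists2 L, 0 <= L & forall t t' delta,
  (forall j, `|t 0 j - t' 0 j| <= delta) ->
  `|realpart t - realpart t'| <= L * delta /\ `|realder t - realder t'| <= L * delta.
Proof.
have ReB (x y : C) : complex.Re x - complex.Re y = complex.Re (x - y) by case: x; case: y.
have [L1 L10 L1P] := twist_lipschitz g; have [L2 L20 L2P] := twist_lipschitz umul.
have pi0 := pi_ge0 R.
exists (L1 + pi * L2); first by rewrite addr_ge0 // mulr_ge0.
move=> t t' delta tt.
have h1 := L1P _ _ _ tt; have h2 := L2P _ _ _ tt.
have h10 : 0 <= L1 * delta := le_trans (normc_ge0 _) h1.
have h20 : 0 <= L2 * delta := le_trans (normc_ge0 _) h2.
split; rewrite ReB; apply: le_trans (normc_Re_le _) _.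
  by apply: le_trans h1 _; rewrite mulrDl lerDl -mulrA mulr_ge0.
rewrite -mulrBr normcM.
have -> : normc (0 +i* pi)%C = pi :> R by rewrite /= expr0n add0r sqrtr_sqr ger0_norm.
apply: le_trans (_ : pi * (L2 * delta) <= _); first by rewrite ler_wpM2l.
by rewrite [leRHS]mulrDl mulrA lerDr.
Qed.

End RealForm.

(** * Cells in the unitary variety *)

Lemma rV_continuous (R : realType) (T : topologicalType) n (f : T -> 'rV[R]_n) x :
  (forall k, {for x, continuous (fun y => f y 0 k : R)}) -> {for x, continuous f}.
Proof.
move=> fk; apply/cvg_ballP => e e0.
have fkj j : \forall y \near x, ball (f x 0 j) e (f y 0 j).
  by have /cvg_ballP/(_ e e0) := fk j.
near=> y; split=> // i j; rewrite !ord1.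
by move: j; near: y; apply: filter_forall.
Unshelve. all: by end_near. Qed.

Lemma rV_continuous_norm (R : realType) (T : topologicalType) n (f : T -> 'rV[R]_n) x :
  (forall eps, 0 < eps -> \forall y \near x, forall j, `|f x 0 j - f y 0 j| < eps) ->
  {for x, continuous f}.
Proof.
move=> fx; apply/cvg_ballP => e e0; have fe := fx e e0.
by near=> y; split=> // i j; rewrite !ord1 /ball /=; move: j; near: y.
Unshelve. all: by end_near. Qed.

Lemma lipschitz_continuous (R : realType) (f : R -> R) (C : R) :
  (forall x y, `|f x - f y| <= C * `|x - y|) -> continuous f.
Proof.
move=> fC x; apply/cvg_ballP => eps eps0.
have C1 : 0 < `|C| + 1 by rewrite ltr_wpDl.
have near1 : \forall y \near x, ball x (eps / (`|C| + 1)) y.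
  by apply: nbhsx_ballx; rewrite divr_gt0.
near=> y; have : ball x (eps / (`|C| + 1)) y by near: y.
rewrite /ball /= ltr_pdivlMr // mulrC; apply: le_lt_trans.
apply: le_trans (fC x y) _; apply: ler_wpM2r => //.
by apply: le_trans (ler_norm C) _; rewrite lerDl.
Unshelve. all: by end_near. Qed.

Lemma affine_continuous (R : realType) (a b : R) : continuous (fun z : R => a * z + b).
Proof.
apply: (lipschitz_continuous (C := `|a|)) => x y.
by rewrite opprD addrACA subrr addr0 -mulrBr normrM.
Qed.

Section Chart.
Variable R : realType.

(** Keeps the argument of [asin] away from -1 and 1, so that [saw] is continuous everywhere. *)
Definition clamp (y : R) : R := Num.max (- (1 / 2)) (Num.min (1 / 2) y).

Lemma clamp_bound y : - (1 / 2) <= clamp y <= 1 / 2.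
Proof.
rewrite /clamp le_max lexx /= ge_max ge_min lexx /= andbT; lra.
Qed.

Lemma clamp_id y : `|y| <= 1 / 2 -> clamp y = y.
Proof.
rewrite ler_norml => /andP[y1 y2]; rewrite /clamp (min_idPr y2) //; exact/max_idPr.
Qed.

Lemma clamp_continuous : continuous clamp.
Proof.
move=> y; apply: (@continuous_max R R (fun=> - (1 / 2)) (fun z => Num.min (1 / 2) z)).
  exact: cst_continuous.
apply: (@continuous_min R R (fun=> 1 / 2) id); first exact: cst_continuous.
exact: cvg_id.
Qed.

(* A continuous 1-periodic function equal to the identity near 0: it extends the
   inverse of a chart to the whole torus. *)
Definition saw (y : R) : R := asin (clamp (sin (2 * pi * y))) / (2 * pi).

(** The bound 1/16 and pi < 4 give |2 pi y| <= 1/2, where the sine is not clamped and [asin] inverts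
    it. *)
Lemma saw_id y : `|y| <= 1 / 16 -> saw y = y.
Proof.
move=> y16; have pi2 := @pihalf_lt2 R; have pi1 := @pihalf_ge1 R.
have y12 : `|2 * pi * y| <= 1 / 2.
  rewrite !normrM normr_nat ger0_norm ?pi_ge0 //.
  have : pi * `|y| <= 4 * (1 / 16) by apply: ler_pM => //; [exact: pi_ge0 | lra].
  by move=> h; rewrite -mulrA; lra.
rewrite /saw clamp_id; last exact: le_trans (sin_norm_le _) y12.
move: y12; rewrite ler_norml => /andP[h1 h2].
rewrite sinK ?in_itv /=; last by apply/andP; split; lra.
have p0 : 2 * pi != 0 :> R by rewrite mulf_neq0 // gt_eqF // pi_gt0.
by rewrite mulrAC divff // mul1r.
Qed.

Lemma saw_int y (n : int) : saw (y + n%:~R) = saw y.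
Proof.
rewrite /saw; have := expi2piD y n%:~R; rewrite expi2pi_int mulr1.
by move/(congr1 (@complex.Im R)) => /= ->.
Qed.

Lemma saw_continuous : continuous saw.
Proof.
move=> y; apply: (@cvgMl _ R); have [h1 h2] := andP (clamp_bound (sin (2 * pi * y))).
apply: (@continuous_comp _ _ _ (fun z => clamp (sin (2 * pi * z))) asin); last first.
  by apply: continuous_asin; apply/andP; split; lra.
apply: (@continuous_comp _ _ _ (fun z => sin (2 * pi * z)) clamp); last exact: clamp_continuous.
apply: (@continuous_comp _ _ _ (fun z => 2 * pi * z) sin); last exact: continuous_sin.
by apply: cvgMr; exact: cvg_id.
Qed.

End Chart.

Lemma rV_addBB (R : zmodType) n (u v w : 'rV[R]_n) j :
  (u + w) 0 j - (v + w) 0 j = u 0 j - v 0 j.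
Proof. by rewrite !mxE opprD addrACA subrr addr0. Qed.

Lemma rV_addZBB (R : pzRingType) n (u v w : 'rV[R]_n) a b j :
  (u + a *: w) 0 j - (v + b *: w) 0 j = u 0 j - v 0 j + (a - b) * w 0 j.
Proof. by rewrite !mxE opprD addrACA mulrBl. Qed.

Section Cell.
Variables (R : realType) (d' : nat) (i : 'I_d'.+1).
Local Notation V := 'rV[R]_d'.+1.
Variables (G G1 : V -> R) (K L : R).
Local Notation e := (delta_mx 0 i : V).
Hypothesis K_gt0 : 0 < K.
Hypothesis L_ge0 : 0 <= L.
Hypothesis taylor : forall t s, `|G (t + s *: e) - G t - s * G1 t| <= K * s ^+ 2.
Hypothesis lip : forall (t t' : V) (delta : R), (forall j, `|t 0 j - t' 0 j| <= delta) ->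
  `|G t - G t'| <= L * delta /\ `|G1 t - G1 t'| <= L * delta.

Lemma line_continuous t : continuous (fun s : R => G (t + s *: e)).
Proof.
apply: (lipschitz_continuous (C := L)) => s s'; apply: (lip _).1 => j.
rewrite !mxE eqxx /=.
have -> : t 0 j + s * (j == i)%:R - (t 0 j + s' * (j == i)%:R) = (s - s') * (j == i)%:R by ring.
by case: (j == i); rewrite ?mulr1 // mulr0 normr0.
Qed.

Variable p : V.
Hypothesis Gp : G p = 0.
Hypothesis G1p : 0 < G1 p.
Let c := G1 p.
(** Within [eta] of [p] the derivative stays above 3c/4, and over steps up to [2 * eta] the
    quadratic remainder costs a slope of at most c/8; this leaves a slope of at least c/2. *)
Let eta := c / (4 * (L + 4 * K)).

Lemma eta_gt0 : 0 < eta.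
Proof. by rewrite divr_gt0 // mulr_gt0 // ltr_wpDl // mulr_gt0. Qed.

Lemma eta_small : L * eta <= c / 4 /\ K * eta <= c / 16.
Proof.
have LK : 0 < L + 4 * K by rewrite ltr_wpDl // mulr_gt0.
have e0 := eta_gt0.
have h : (L + 4 * K) * eta = c / 4 by rewrite /eta; field; rewrite gt_eqF.
have h1 : 0 <= L * eta by rewrite mulr_ge0 // ltW.
have h2 : 0 <= K * eta by rewrite mulr_ge0 // ltW.
by move: h; rewrite mulrDl -mulrA; split; lra.
Qed.

Lemma line_increasing (t : V) s : (forall j, `|t 0 j - p 0 j| <= eta) -> 0 <= s -> s <= 2 * eta ->
  s * (c / 2) <= G (t + s *: e) - G t.
Proof.
move=> tp s0 s2; have [h1 h2] := eta_small.
have := (lip tp).2; rewrite ler_norml -/c => /andP[g1 _].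
have := taylor t s; rewrite ler_norml => /andP[g2 _].
have h3 : s * (3 / 4 * c) <= s * G1 t by rewrite ler_wpM2l //; lra.
have h4 : K * s <= K * (2 * eta) by rewrite ler_wpM2l // ltW.
have h5 : s * (K * s) <= s * (c / 8) by rewrite ler_wpM2l //; lra.
have -> : G (t + s *: e) - G t = (G (t + s *: e) - G t - s * G1 t) + s * G1 t by ring.
have : 0 <= s * c by rewrite mulr_ge0 // ltW.
rewrite expr2 in g2; lra.
Qed.

(** Three constraints: base points stay within [eta] of [p], [saw] inverts the chart, and moving the
    base point changes G by less than it gains along a step [eta], so that the signs at both ends
    persist. *)
Let rho := Num.min eta (Num.min (1 / 16) (eta * c / (4 * (L + 1)))).

Lemma rho_props : [/\ 0 < rho, rho <= eta, rho <= 1 / 16 & L * rho <= eta * c / 4].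
Proof.
have e0 := eta_gt0; have L1 : 0 < L + 1 by rewrite ltr_wpDl.
have ec : 0 < eta * c by rewrite mulr_gt0.
have r0 : 0 < rho by rewrite /rho !lt_min e0 divr_gt0 //= divr_gt0 // mulr_gt0.
have r3 : rho <= eta * c / (4 * (L + 1)) by rewrite /rho !ge_min lexx !orbT.
split=> //; first by rewrite /rho ge_min lexx.
  by rewrite /rho !ge_min lexx orbT.
apply: (@le_trans _ _ ((L + 1) * (eta * c / (4 * (L + 1))))).
  by apply: ler_pM => //; [exact: ltW | rewrite lerDl].
by rewrite le_eqVlt; apply/orP; left; apply/eqP; field; rewrite gt_eqF.
Qed.

Definition cellbase (x : 'rV[R]_d') : V :=
  \row_j (p 0 j + if unlift i j is Some k then rho * (2 * x 0 k - 1) else 0).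

Lemma cellbase_near x : open_cube R d' x -> forall j, `|cellbase x 0 j - p 0 j| <= rho.
Proof.
move=> cx j; have [r0 _ _ _] := rho_props.
rewrite mxE addrAC subrr add0r; case: (unlift i j) => [k|]; last by rewrite normr0 ltW.
rewrite normrM gtr0_norm // ler_piMr // ?(ltW r0) //.
have /andP[x0 x1] := cx k; rewrite ler_norml; apply/andP; split; lra.
Qed.

Lemma cell_root x : open_cube R d' x ->
  exists s, `|s| <= eta /\ G (cellbase x + s *: e) = 0.
Proof.
move=> cx; have e0 := eta_gt0; have [r0 re r16 rL] := rho_props.
have ec : 0 < eta * c by rewrite mulr_gt0.
have shift s : `|G (cellbase x + s *: e) - G (p + s *: e)| <= L * rho.
  apply: (lip _).1 => j; rewrite rV_addBB.
  exact: cellbase_near.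
have up : 0 < G (cellbase x + eta *: e).
  have := shift eta; rewrite ler_norml => /andP[h _].
  have : eta * (c / 2) <= G (p + eta *: e) - G p.
    by apply: line_increasing; [move=> j; rewrite subrr normr0 ltW|exact: ltW|lra].
  rewrite Gp; lra.
have down : G (cellbase x + (- eta) *: e) < 0.
  have := shift (- eta); rewrite ler_norml => /andP[_ h].
  have : eta * (c / 2) <= G ((p + (- eta) *: e) + eta *: e) - G (p + (- eta) *: e).
    apply: line_increasing; [|exact: ltW|lra] => j.
    rewrite !mxE addrAC subrr add0r normrM normrN (gtr0_norm e0).
    by rewrite ler_piMr ?(ltW e0) //; case: (_ && _); rewrite ?normr1 ?normr0.
  rewrite -addrA -scalerDl addNr scale0r addr0 Gp; lra.
have lc : {within `[- eta, eta], continuous (fun s : R => G (cellbase x + s *: e))}.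
  by apply: continuous_subspaceT; exact: line_continuous.
have [||s] := @IVT R _ (- eta) eta 0 _ lc.
- lra.
- by rewrite ge_min le_max (ltW up) (ltW down) /= orbT.
- by rewrite in_itv /= -ler_norml => se s0; exists s.
Qed.

Lemma cell_sigma : exists sigma : 'rV[R]_d' -> R, forall x, open_cube R d' x ->
  `|sigma x| <= eta /\ G (cellbase x + sigma x *: e) = 0.
Proof.
have [|sigma sP] := @choice _ _ (fun x s => open_cube R d' x -> `|s| <= eta /\ G (cellbase x + s *: e) = 0).
  move=> x; have [cx|nx] := pselect (open_cube R d' x); last by exists 0.
  by have [s sP] := cell_root cx; exists s.
by exists sigma => x; exact: sP.
Qed.

(** Moving along the line from one implicit value to the other changes G at slope at least c/2,
    whereas changing the base point costs only [L * delta]. *)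
Lemma cell_sigma_lip sigma : (forall x, open_cube R d' x ->
    `|sigma x| <= eta /\ G (cellbase x + sigma x *: e) = 0) ->
  forall x y (delta : R), open_cube R d' x -> open_cube R d' y ->
  (forall j, `|cellbase x 0 j - cellbase y 0 j| <= delta) ->
  `|sigma x - sigma y| * (c / 2) <= L * delta.
Proof.
move=> sP.
have H x y (delta : R) : open_cube R d' x -> open_cube R d' y ->
    (forall j, `|cellbase x 0 j - cellbase y 0 j| <= delta) ->
    sigma y <= sigma x -> (sigma x - sigma y) * (c / 2) <= L * delta.
  move=> cx cy bxy yx; have [sx Gx] := sP _ cx; have [sy Gy] := sP _ cy.
  have e0 := eta_gt0; have [r0 re r16 rL] := rho_props.
  move: sx sy; rewrite !ler_norml => /andP[x1 x2] /andP[y1 y2].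
  have tp j : `|(cellbase y + sigma y *: e) 0 j - p 0 j| <= eta.
    rewrite !mxE; have := cellbase_near cy j; rewrite mxE; have [k jk|ji] := unliftP i j.
      rewrite jk eqxx /= eq_sym (negbTE (neq_lift i k)) mulr0 addr0 => h.
      exact: le_trans h re.
    by move=> _; rewrite ji !eqxx /= addr0 mulr1 addrAC subrr add0r ler_norml y1 y2.
  have h := line_increasing tp (s := sigma x - sigma y) _ _.
  apply: le_trans (h _ _) _; [lra|lra|].
  rewrite -addrA -scalerDl addrC [sigma y + _]addrC subrK Gy subr0 addrC -[G _]subr0 -Gx.
  apply: le_trans (ler_norm _) _; apply: (lip _).1 => j.
  rewrite rV_addBB distrC; exact: bxy.
move=> x y delta cx cy bxy; have [yx|xy] := leP (sigma y) (sigma x).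
  by rewrite ger0_norm ?subr_ge0 //; apply: H.
rewrite distrC gtr0_norm ?subr_gt0 //; apply: H => //; last exact: ltW.
by move=> j; rewrite distrC.
Qed.

Lemma cellbase_continuous : continuous cellbase.
Proof.
move=> x; apply: rV_continuous => j.
have -> : (fun y => cellbase y 0 j) =
   (fun y => p 0 j + if unlift i j is Some k then rho * (2 * y 0 k - 1) else 0).
  by apply/funext => y; rewrite mxE.
case: (unlift i j) => [k|]; last exact: cst_continuous.
have -> : (fun y : 'rV[R]_d' => p 0 j + rho * (2 * y 0 k - 1)) =
   (fun z => rho * 2 * z + (p 0 j - rho)) \o (fun y : 'rV[R]_d' => y 0 k).
  by apply/funext => y /=; ring.
by apply: continuous_comp; [exact: coord_continuous | exact: affine_continuous].
Qed.

Lemma open_cube_nbhs n (x : 'rV[R]_n) : open_cube R n x -> \forall y \near x, open_cube R n y.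
Proof.
move=> cx; near=> y => k; move: k; near: y; apply: filter_forall => k.
have /andP[x0 x1] := cx k.
have H : \forall z \near (x 0 k : R), 0 < z < 1.
  near=> z; apply/andP; split; near: z; [exact: lt_nbhsr | exact: lt_nbhsl].
exact: (@coord_continuous R 1 n 0 k x _ H).
Unshelve. all: by end_near. Qed.

Definition cellinv_lift (t : V) : 'rV[R]_d' :=
  \row_k ((saw (t 0 (lift i k) - p 0 (lift i k)) / rho + 1) / 2).

Lemma cellinv_lift_continuous : continuous cellinv_lift.
Proof.
move=> t; apply: rV_continuous => k.
have -> : (fun y => cellinv_lift y 0 k) = (fun z => (2 * rho)^-1 * z + 2^-1) \o (@saw R) \o
     (fun z => 1 * z + - p 0 (lift i k)) \o (fun y : V => y 0 (lift i k)).
  apply/funext => y; rewrite mxE /= mul1r; have [r0 _ _ _] := rho_props.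
  by field; rewrite gt_eqF.
apply: continuous_comp; first exact: coord_continuous.
apply: continuous_comp; first exact: affine_continuous.
by apply: continuous_comp; [exact: saw_continuous | exact: affine_continuous].
Qed.

(** Near [p] the zero set contains the graph of the implicit function over a cube in the other
    coordinates. The inverse reads those coordinates off. *)
Lemma cell_of_regular_zero :
  contains_cell R [set \pi_(torus R d'.+1) t | t in [set t | G t = 0]] d'.
Proof.
have [sigma sP] := cell_sigma; have slip := cell_sigma_lip sP.
have [r0 re r16 rL] := rho_props.
pose f x := \pi_(torus R d'.+1) (cellbase x + sigma x *: e).
(* Periodicity of [saw] makes the inverse descend to the torus, where it is continuous by the
   quotient topology. *)
have inv_homo : {homo cellinv_lift : a b / \pi_(torus R d'.+1) a == \pi_(torus R d'.+1) b >-> a == b}.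
  move=> a b /eqP/eqmodP /forallP ab; apply/eqP/rowP => k; rewrite !mxE.
  have /intrP [n an] := ab (lift i k).
  have -> : a 0 (lift i k) = b 0 (lift i k) + n%:~R by rewrite -an addrC subrK.
  by rewrite addrAC saw_int.
exists f, (cellinv_lift \o generic_quotient.repr); split.
- by move=> _ [x cx <-]; exists (cellbase x + sigma x *: e) => //=; case: (sP x cx).
- apply: continuous_in_subspaceT => x; rewrite inE => cx.
  apply: (@continuous_comp _ _ _ (fun x => cellbase x + sigma x *: e) \pi_(torus R d'.+1)); last exact: pi_continuous.
  apply: rV_continuous_norm => eps eps0.
  pose delta := Num.min (eps / 2) (eps / 2 * (c / 2) / (L + 1)).
  have c2 : 0 < c / 2 by rewrite divr_gt0.
  have L1 : 0 < L + 1 by rewrite ltr_wpDl.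
  have e2 : 0 < eps / 2 by rewrite divr_gt0.
  have delta0 : 0 < delta by rewrite lt_min e2 /= divr_gt0 // mulr_gt0.
  have de : delta <= eps / 2 by rewrite ge_min lexx.
  have dL : (L + 1) * delta <= eps / 2 * (c / 2).
    by rewrite mulrC -ler_pdivlMr // ge_min lexx orbT.
  have near1 : \forall y \near x, ball (cellbase x) delta (cellbase y).
    by have /cvg_ballP/(_ delta delta0) := @cellbase_continuous x.
  have near2 := open_cube_nbhs cx.
  near=> y => j.
  have cy : open_cube R d' y by near: y.
  have [_ bxy] : ball (cellbase x) delta (cellbase y) by near: y.
  have h := slip x y delta cx cy (fun j => ltW (bxy 0 j)).
  have sxy : `|sigma x - sigma y| < eps / 2.
    rewrite -(ltr_pM2r c2); apply: le_lt_trans h _; apply: lt_le_trans dL.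
    by rewrite mulrDl mul1r ltrDl.
  have bj : `|cellbase x 0 j - cellbase y 0 j| < eps / 2 by exact: lt_le_trans (bxy 0 j) de.
  have ej : `|e 0 j| <= 1 by rewrite mxE; case: (_ && _); rewrite ?normr1 ?normr0.
  rewrite rV_addZBB; apply: le_lt_trans (ler_normD _ _) _.
  rewrite [ltRHS](splitr eps); apply: ltr_leD => //.
  by rewrite normrM; apply: le_trans (ltW sxy); rewrite ler_piMr.
- apply: continuous_subspaceT; exact: repr_comp_continuous cellinv_lift_continuous inv_homo.
- move=> x; rewrite inE => cx; rewrite /f /=.
  have -> : cellinv_lift (generic_quotient.repr (\pi_(torus R d'.+1) (cellbase x + sigma x *: e))) =
            cellinv_lift (cellbase x + sigma x *: e).
    by apply/eqP; apply: inv_homo; rewrite reprK.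
  apply/rowP => k; rewrite !mxE liftK eq_sym (negbTE (neq_lift i k)) andbF mulr0 addr0.
  rewrite addrAC subrr add0r saw_id.
    by field; rewrite gt_eqF.
  have := cellbase_near cx (lift i k); rewrite mxE liftK addrAC subrr add0r => h.
  exact: le_trans h r16.
Unshelve. all: by end_near. Qed.

End Cell.

(** * Regular zeros and the dominated polynomial *)

Lemma rprime_pow (A : comNzRingType) (p u x : A) k :
  rprime p -> ~ rdvd p u -> rdvd p (u ^+ k * x) -> rdvd p x.
Proof.
move=> [_ pP] pu; elim: k => [|k IHk]; first by rewrite expr0 mul1r.
by rewrite exprS -mulrA => /pP[/pu//|/IHk].
Qed.

(** Otherwise the support is a single point, and primitivity makes [g] a monomial with coefficient 1
    or -1, a unit. *)
Lemma primitive_support_spread d (g : laurent d) : primitive g -> ~ lunit g ->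
  exists i n m, [/\ lcoef g n != 0, lcoef g m != 0 & n 0 i != m 0 i].
Proof.
move=> [g0 gprim] gU; have [n gn] := laurent_neq0 g0.
apply: contrapT => spread.
have gE : g = lmono (lcoef g n) n.
  apply: laurentP => m; rewrite lmonoE; case: eqP => [->//|mn].
  apply/eqP; apply: contraT => gm; case: mn; apply/rowP => i; apply/eqP.
  by apply: contraT => mn; case: spread; exists i, m, n; split.
have suppE : lsupp g = [fset n]%fset.
  apply/fsetP => m; rewrite mem_lsupp in_fset1 gE lmonoE.
  by case: (m =P n) => //= _; rewrite eqxx.
rewrite suppE big_seq_fset1 in gprim.
apply: gU; exists (lmono (lcoef g n) (- n)).
rewrite {1}gE lmonoM subrr -lmono0; congr lmono.
by move: gprim; move: (lcoef g n) => z; lia.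
Qed.

(** Makes an arc of the circle an admissible infinite set for [laurent_nonvanishing]. Capping the
    radius at 1 keeps the arguments within less than one turn, so the points are distinct. *)
Lemma expi2pi_infinite (R : realType) (x rho : R) n : 0 < rho ->
  exists r : seq R[i], [/\ size r = n, uniq r & forall a, a \in r ->
    exists2 th, `|th - x| <= rho & a = expi2pi th].
Proof.
move=> rho0; pose rho1 : R := Num.min rho 1.
have rho10 : 0 < rho1 by rewrite lt_min rho0 ltr01.
have rho1le : rho1 <= rho by rewrite ge_min lexx.
have rho11 : rho1 <= 1 by rewrite ge_min lexx orbT.
have frac k : (k < n)%N -> 0 <= (k%:R / n%:R : R) < 1.
  move=> kn; have n0 : (0 : R) < n%:R by rewrite ltr0n; lia.
  by rewrite divr_ge0 //= ltr_pdivrMr // mul1r ltr_nat.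
pose th k : R := x + rho1 * (k%:R / n%:R).
exists [seq expi2pi (th k) | k <- iota 0 n]; split; first by rewrite size_map size_iota.
  rewrite map_inj_in_uniq ?iota_uniq //.
  have main k l : (k < l < n)%N -> expi2pi (th k) <> expi2pi (th l).
    move=> /andP[kl ln] kle.
    have lk : (l - k < n)%N by lia.
    have /andP[f0 f1] := frac _ lk.
    have n0 : (0 : R) < n%:R by rewrite ltr0n; lia.
    have f0' : 0 < (l - k)%:R / n%:R :> R by rewrite divr_gt0 // ltr0n; lia.
    have : 0 < rho1 * ((l - k)%:R / n%:R) < 1.
      rewrite mulr_gt0 //=; apply: le_lt_trans f1.
      by rewrite ler_piMl.
    move=> /expi2piB1_neq0 /eqP; apply.
    apply: (mulfI (expi2pi_neq0 (th k))); rewrite mulr1 -expi2piD [RHS]kle.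
    congr expi2pi; rewrite /th -addrA -mulrDr -mulrDl natrB; last by lia.
    by rewrite [k%:R + _]addrC subrK.
  move=> k l; rewrite !mem_iota /= !add0n => kn ln kle.
  by case: (ltngtP k l) => // kl; [case: (@main k l) | case: (@main l k)]; rewrite ?kl //=.
move=> a /mapP[k]; rewrite mem_iota add0n => /andP[_ kn] ->; exists (th k) => //.
have /andP[f0 f1] := frac _ kn.
rewrite /th [x + _]addrC addrK ger0_norm ?mulr_ge0 //; last exact: ltW.
by apply: le_trans rho1le; rewrite ler_piMr // ltW.
Qed.

(* Glaeser's inequality, from the value of [f] at [- D / (2 K)]. *)
Lemma constant_sign_deriv (R : realType) (f : R -> R) (D K : R) : 0 < K ->
  (forall s, `|f s - f 0 - s * D| <= K * s ^+ 2) ->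
  ~ (exists s1 s2, f s1 < 0 /\ 0 < f s2) -> D ^+ 2 <= 4 * K * `|f 0|.
Proof.
move=> K0; have K2 : 2 * K != 0 by rewrite mulf_neq0 ?gt_eqF.
have nonneg (h : R -> R) (E : R) : (forall s, `|h s - h 0 - s * E| <= K * s ^+ 2) ->
    (forall s, 0 <= h s) -> E ^+ 2 <= 4 * K * `|h 0|.
  move=> tay h0; pose s := - E / (2 * K); have := tay s; have hs := h0 s.
  rewrite ler_norml => /andP[_]; rewrite (ger0_norm (h0 0)).
  have sE : 2 * K * s = - E by rewrite /s mulrC divfK.
  by clearbody s; move: (h s) (h 0) hs => x y; nra.
move=> tay sgn; have [pos|/existsNP[s1 /negP]] := pselect (forall s, 0 <= f s).
  exact: nonneg.
rewrite -ltNge => fs1; have := nonneg (fun s => - f s) (- D); rewrite sqrrN normrN; apply.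
  move=> s; have -> : - f s - - f 0 - s * - D = - (f s - f 0 - s * D) by ring.
  by rewrite normrN.
move=> s; rewrite oppr_ge0 leNgt; apply/negP => fs; apply: sgn.
by exists s1, s.
Qed.

Section RegularZero.
Variables (R : realType) (d' : nat) (g : laurent d'.+1).
Variables (a : 'rV[int]_d'.+1) (c : int) (i : 'I_d'.+1).
Hypothesis c1 : c = 1 \/ c = -1.
Hypothesis gconj : lconj g = lmono c a * g.
Local Notation G := (realpart (R:=R) g a c).
Local Notation G1 := (realder (R:=R) g a c i).
Local Notation V := ('rV[R]_d'.+1).
Local Notation e := (delta_mx 0 i : V).

Lemma realpart_eq0 (t : V) : G t = 0 <-> leval g (torpt t) = 0.
Proof.
split=> h.
  by apply: eq0_normc; rewrite -(norm_realpart c1 gconj) h normr0.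
by apply/eqP; rewrite -normr_eq0 (norm_realpart c1 gconj) h normc0.
Qed.

Lemma unitary_variety_realpart :
  unitary_variety R g = [set \pi_(torus R d'.+1) t | t in [set t | G t = 0]].
Proof. by congr image; apply/funext => t; apply/propext; rewrite /= realpart_eq0. Qed.

Lemma leval_const_line (f : laurent d'.+1) (t : V) s : lderiv i f = 0 ->
  leval f (torpt (t + s *: e)) = leval f (torpt t).
Proof.
move=> f0; rewrite !leval_chi /lsum; apply: eq_big_seq => n; rewrite mem_lsupp => fn.
apply: (congr1 (fun z => _ * z)); apply: eq_bigr => j _.
case: (eqVneq j i) => [->|ji]; first by rewrite (lderiv_eq0 f0 fn) !expr0z.
by rewrite /torpt !mxE (negbTE ji) mulr0 addr0.
Qed.

Lemma sign_change_zero (t : V) s1 s2 : G (t + s1 *: e) < 0 -> 0 < G (t + s2 *: e) ->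
  exists s, G (t + s *: e) = 0.
Proof.
move=> G1s G2s; have [L _ LP] := realpart_lipschitz R g a c i.
have cont := line_continuous LP (t := t).
have [s12|s21] := leP s1 s2.
- have [||s _ Gs] := @IVT R (fun s => G (t + s *: e)) s1 s2 0 s12.
  + exact: continuous_subspaceT.
  + by rewrite ge_min (ltW G1s) le_max (ltW G2s) orbT.
  + by exists s.
- have [||s _ Gs] := @IVT R (fun s => G (t + s *: e)) s2 s1 0 (ltW s21).
  + exact: continuous_subspaceT.
  + by rewrite ge_min (ltW G1s) le_max (ltW G2s) orbT.
  + by exists s.
Qed.

(** By the Lipschitz bound the sign change survives on all nearby parallel lines. One of them is
    chosen where the eliminant [cc], constant along the line, is nonzero; a zero of [g] on that line
    is then not a zero of its derivative. *)
Lemma regular_zero n m (t : V) s1 s2 : ~ lunit g -> irreducible g ->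
  lcoef g n != 0 -> lcoef g m != 0 -> n 0 i != m 0 i ->
  G (t + s1 *: e) < 0 -> 0 < G (t + s2 *: e) -> exists p, G p = 0 /\ G1 p != 0.
Proof.
move=> gU gI gn gm nm Gs1 Gs2.
have [cc [A [B [cc0 Dcc ccE]]]] := lderiv_bezout gU gI gn gm nm.
have [L L0 LP] := realpart_lipschitz R g a c i.
pose eps := Num.min (- G (t + s1 *: e)) (G (t + s2 *: e)).
have eps0 : 0 < eps by rewrite lt_min Gs2 oppr_gt0 Gs1.
have L10 : 0 < L + 1 by rewrite ltr_wpDl.
pose rho := eps / (2 * (L + 1)).
have rho0 : 0 < rho by rewrite divr_gt0 // mulr_gt0.
have Lrho : L * rho < eps.
  have e1 : (L + 1) * rho = eps / 2 by rewrite /rho; field; rewrite gt_eqF.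
  by move: (rho) (eps) e1 rho0 eps0 => x y; nra.
pose E j z := exists2 th, `|th - t 0 j| <= rho & z = expi2pi th :> R[i].
have [||j k|y yE yc] := @laurent_nonvanishing d' _ E _ _ _ cc cc0.
- by move=> z /eqP; rewrite intr_eq0 => /eqP.
- by move=> j z [th _ ->]; exact: expi2pi_neq0.
- exact: expi2pi_infinite.
have thE j : exists z : R, `|z - t 0 j| <= rho /\ y j = expi2pi z.
  by have [z z1 z2] := yE j; exists z.
have [th thP] := boolp.choice thE.
pose t' : V := \row_j th j.
have yt : y = torpt t' by apply/funext => j; rewrite /torpt mxE; case: (thP j).
rewrite yt -leval_chi in yc.
have near s : `|G (t' + s *: e) - G (t + s *: e)| <= L * rho.
  have [] // := LP (t' + s *: e) (t + s *: e) rho _.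
  move=> j; rewrite !mxE; case: (thP j) => h _; move: h.
  by move: (th j) (t 0 j) (s * _) => x z w; rewrite opprD addrACA subrr addr0.
have eps1 : eps <= - G (t + s1 *: e) by rewrite ge_min lexx.
have eps2 : eps <= G (t + s2 *: e) by rewrite ge_min lexx orbT.
have [s Gs] : exists s, G (t' + s *: e) = 0.
  apply: (@sign_change_zero t' s1 s2).
    by have := near s1; rewrite ler_norml => /andP[_]; lra.
  by have := near s2; rewrite ler_norml => /andP[]; lra.
exists (t' + s *: e); split=> //.
set p := t' + s *: e in Gs *.
have gp : leval g (torpt p) = 0 by apply/realpart_eq0.
have cp : leval cc (torpt p) != 0 by rewrite /p leval_const_line.
have [h hE] := leval_rmorph (torpt_neq0 p).
have up : leval (umul g a i) (torpt p) != 0.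
  apply: contra_neq cp; rewrite -!hE /umul ccE !rmorphD !rmorphM !hE gp !mulr0 !add0r.
  by rewrite -mulr2n => /eqP; rewrite mulrn_eq0 /= => /eqP ->; rewrite mulr0.
rewrite -normr_eq0 (norm_realder i c1 gconj); apply: mulf_neq0; first by rewrite gt_eqF ?pi_gt0.
by apply: contra_neq up; exact: eq0_normc.
Qed.

Lemma regular_zero_dim (p : V) : G p = 0 -> G1 p != 0 ->
  (d'%:R%:E <= real_dim R (unitary_variety R g))%E.
Proof.
move=> Gp G1p; apply: ereal_sup_ubound; exists d' => //.
have [K K0 KP] := realpart_taylor R g a c i.
have [L L0 LP] := realpart_lipschitz R g a c i.
rewrite unitary_variety_realpart.
have [G1pos|G1neg|G1z] := ltgtP (G1 p) 0.
- have -> : [set t | G t = 0] = [set t | - G t = 0].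
    by apply/seteqP; split=> t /= /eqP; rewrite ?oppr_eq0 => /eqP ->; rewrite ?oppr0.
  apply: (@cell_of_regular_zero R d' i (fun t => - G t) (fun t => - G1 t) K L _ _ _ _ p) => //.
  + move=> t s; have := KP t s; rewrite -normrN; congr (`|_| <= _).
    by rewrite mulrN; ring.
  + move=> t t' del /LP[h1 h2]; split.
      by rewrite -normrN opprB opprK addrC.
    by rewrite -normrN opprB opprK addrC.
  + by rewrite Gp oppr0.
  + by rewrite oppr_gt0.
- exact: (cell_of_regular_zero K0 L0 KP LP Gp G1neg).
- by rewrite G1z eqxx in G1p.
Qed.

End RegularZero.

Lemma atoral_dominated (R : realType) d' (g : laurent d'.+1) :
  primitive g -> irreducible g -> atoral R g ->
  exists u, ~ ldivides g u /\ exists2 C0, 0 <= C0 & forall t : 'rV[R]_d'.+1,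
    normc (leval u (torpt t)) <= C0 * normc (leval g (torpt t)).
Proof.
move=> gprim gI [g0 gU gdim].
have [gD|gD] := pselect (ldivides g (lconj g)); last first.
  exists (lconj g); split=> //; exists 1 => // t.
  rewrite mul1r lconj_leval; case: (leval g _) => x y /=.
  by rewrite sqrrN.
case: gD => q gq.
(* Conjugating twice gives back [g], so the cofactor has norm one. *)
have qq : q * lconj q = 1.
  have : g * (1 - q * lconj q) = 0.
    by rewrite mulrBr mulr1 mulrA -gq -lconjM -gq lconjK subrr.
  case/laurent_mulf_eq0 => [/eqP|/eqP]; first by rewrite (negbTE g0).
  by rewrite subr_eq0 => /eqP.
have [c c1 [a qa]] := conj_unit_mono qq.
have gconj : lconj g = lmono c a * g by rewrite gq qa mulrC.
have [i [n [m [gn gm nm]]]] := primitive_support_spread gprim gU.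
have gP := laurent_prime gU gI.
have umulN : ~ ldivides g (umul g a i).
  case=> w uw; apply: (not_dvd_lderiv gn gm nm).
  exists (w - lmono (a 0 i) 0); rewrite mulrBr -uw /umul [g * _]mulrC.
  by rewrite [_ * g + _]addrC addrK.
exists (umul g a i * umul g a i); split; first by move=> /(gP.2 _ _)[].
have [K K0 KP] := realpart_taylor R g a c i.
(* Glaeser's inequality gives 4 K; [pi ^+ 2] comes from [norm_realder], the derivative being pi
   times |[umul]| in absolute value. *)
exists (4 * K / pi ^+ 2); first by rewrite divr_ge0 ?sqr_ge0 // mulr_ge0 // ltW.
move=> t; have [h hE] := leval_rmorph (torpt_neq0 t).
rewrite -hE rmorphM !hE normcM -(norm_realpart c1 gconj).
have := norm_realder i c1 gconj t.
rewrite -expr2 [_ / _ * _]mulrAC ler_pdivlMr ?exprn_gt0 ?pi_gt0 // mulrC -exprMn => <-.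
rewrite real_normK ?num_real //.
have G0 : realpart g a c t = realpart g a c (t + 0 *: delta_mx 0 i) by rewrite scale0r addr0.
rewrite G0.
apply: (@constant_sign_deriv R (fun s => realpart g a c (t + s *: delta_mx 0 i))) => //.
  by move=> s /=; rewrite -G0; exact: KP.
move=> [s1 [s2 [Gs1 Gs2]]].
have [p [Gp G1p]] := regular_zero c1 gconj gU gI gn gm nm Gs1 Gs2.
have := le_trans (regular_zero_dim c1 gconj Gp G1p) gdim.
by rewrite lee_fin -natr1; lra.
Qed.

Theorem theorem7p3 (R : realType) (d : nat) (g : laurent d) :
  (1 <= d)%N ->
  primitive g -> irreducible g -> atoral R g ->
  forall H : nat, (1 <= H)%N ->
  exists2 m : nat, (1 <= m)%N &
  forall S S' : set 'rV[int]_d, S !=set0 -> S' !=set0 ->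
  (forall n n' : 'rV[int]_d, S n -> S' n' -> (m <= Znorm (n - n'))%N) ->
  forall v : laurent d, bounded_on (S `|` S') H v ->
  ldivides g v -> ldivides g (lrestrict S v).
Proof.
case: d g => // d' g _ gprim gI gA H _.
have [u [gu [C0 C00 uC]]] := atoral_dominated gprim gI gA.
have ug (t : 'I_d'.+1 -> R) : normc (leval u (fun i => expi2pi (t i))) <=
    C0 * normc (leval g (fun i => expi2pi (t i))).
  have -> : (fun i => expi2pi (t i)) = torpt (\row_j t j).
    by apply/funext => j; rewrite /torpt mxE.
  exact: uC.
(* The decay exponent is 2d+1, the one of [tail_sum]; accordingly h is [u] to the power 2d+2. *)
have [K K0 KP] := @approx_inverse R _ g u d'.+1.*2.+1 C0 C00 isT ug.
have [m m1 mP] := gap_dvd K0 KP H; exists m => // S S' _ _ SS' v vb gv.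
have [_ gU _] := gA.
exact: (rprime_pow (laurent_prime gU gI) gu (mP S S' SS' v vb gv)).
Qed.
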